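(* (Reconstruction) Let $(\mathsf A,\mathsf T)$ be an abstract space with $\underline\beta:=\min\mathsf A\in(-4,0)$ and skeleton $\Gamma$. Assume we are given $v\in\mathcal S'(\mathbb R^2;\mathsf T)$ such that for all $\beta\in\mathsf A$, $x\in\mathbb R^2$, $T\in(0,1]$ $$\|\Gamma_\beta(x)v_T(x)\|_{\mathsf T_\beta}\le(T^{\frac14})^\beta.$$ Then for each $V\in\mathcal D^{\overline\alpha}(\mathsf T;\Gamma)$ with $\overline\alpha>0$ there exists a unique $\mathcal RV\in\mathcal S'(\mathbb R^2)$ such that for all $T\in(0,1]$ $$\|(\mathcal RV)_T-V.v_T\|\le C\,(1+\|\Gamma\|_{sk})^{|\mathsf A|-1}\,[V]_{\mathcal D^{\overline\alpha}(\mathsf T;\Gamma)}\,(T^{\frac14})^{\overline\alpha},$$ where $|\mathsf A|$ is the number of elements of $\mathsf A$, $\|\cdot\|$ is the supremum norm on $\mathbb R^2$, $(V.v_T)(x):=V(x).v_T(x)$, and the constant $C$ depends only on $\mathsf A$ and $\overline\alpha$.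
   Context: Metric and kernel: $d(x,y)=|x_1-y_1|+\sqrt{|x_2-y_2|}$ on $\mathbb R^2$. For $T>0$, $\psi_T$ is the Schwartz function with Fourier transform $\hat\psi_T(k)=\exp(-T(k_1^4+k_2^2))$, i.e. the kernel of $\exp(-T(\partial_1^4-\partial_2^2))$; for a tempered distribution $g$ (real- or Banach-space-valued), $g_T(x):=\langle g,\psi_T(x-\cdot)\rangle$. Abstract space: a pair $(\mathsf A,\mathsf T)$ with $\mathsf A\subset\mathbb R$ finite and $\mathsf T=\bigoplus_{\beta\in\mathsf A}\mathsf T_\beta$ a direct sum of (real) Banach spaces; elements are written $\mathsf v=(\mathsf v_\beta)_{\beta\in\mathsf A}$. $\mathcal L(X,Y)$ denotes bounded linear operators, $\mathsf T^*=\mathcal L(\mathsf T,\mathbb R)$, $C^0(\mathbb R^2;X)$ denotes strongly continuous $X$-valued functions. Skeleton: $\Gamma\in C^0(\mathbb R^2;\mathcal L(\mathsf T,\mathsf T))$ with components $\Gamma_\beta(x)\mathsf v:=(\Gamma(x)\mathsf v)_\beta$ such that (1) $\Gamma_\beta(x)\mathsf v=\mathsf v_\beta+\sum_{\gamma<\beta}\Gamma_\beta^\gamma(x)\mathsf v_\gamma$ with $\Gamma_\beta^\gamma\in C^0(\mathbb R^2;\mathcal L(\mathsf T_\gamma,\mathsf T_\beta))$; (2) for some constant $C'\ge0$ and all $\beta\in\mathsf A$, $\mathsf v\in\mathsf T$, $d(y,x)\le1$: $\|(\Gamma_\beta(y)-\Gamma_\beta(x))\mathsf v\|_{\mathsf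 T_\beta}\le C'\sum_{\gamma<\beta}d^{\beta-\gamma}(y,x)\|\Gamma_\gamma(x)\mathsf v\|_{\mathsf T_\gamma}$. The minimal $C'$ is $\|\Gamma\|_{sk}$. Modelled distribution: $V\in C^0(\mathbb R^2;\mathsf T^* )$ belongs to $\mathcal D^{\overline\alpha}(\mathsf T;\Gamma)$ if there are finite constants $M^b_\beta,M^c\ge0$ with $|V(x).\mathsf v|\le\sum_{\beta\in\mathsf A}M^b_\beta\|\Gamma_\beta(x)\mathsf v\|_{\mathsf T_\beta}$ for all $x,\mathsf v$, and $|(V(y)-V(x)).\mathsf v|\le M^c\sum_{\beta\in\mathsf A}d^{(\overline\alpha-\beta)\vee0}(y,x)\|\Gamma_\beta(x)\mathsf v\|_{\mathsf T_\beta}$ for all $\mathsf v$ and $d(y,x)\le1$. The smallest $M^c$ is $[V]_{\mathcal D^{\overline\alpha}(\mathsf T;\Gamma)}$. *)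

(* Defs.v *)
From HB Require Import structures.
From mathcomp Require Import all_boot all_order all_algebra finmap complex ring.
From mathcomp Require Import all_classical all_reals all_analysis.

Set Implicit Arguments.
Unset Strict Implicit.
Unset Printing Implicit Defensive.

Import Order.TTheory GRing.Theory Num.Theory.
Import numFieldNormedType.Exports.

Local Open Scope classical_set_scope.
Local Open Scope ring_scope.

Section SchwartzSpace.
Variable R : realType.
Implicit Types (f g : R * R -> R) (w : seq bool) (x y : R * R).

Definition axis (i : bool) : R * R := if i then (0, 1) else (1, 0).

(* Iterated partial derivatives are indexed by words instead of multi-indices,
   so that C^infty regularity reads "all iterated partial derivatives, in any
   order, exist and are continuous". *)
Fixpoint partials w f : R * R -> R :=
  if w is i :: w' then 'D_(axis i) (partials w' f) else f.

Definition smooth f := forall w, continuous (partials w f) /\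
  forall i x, derivable (partials w f) x (axis i).

Definition rapidly_decreasing f := forall w (a b : nat), exists C : R,
  forall x, `|x.1 ^+ a * x.2 ^+ b * partials w f x| <= C.

Definition schwartz_pred : {pred (R * R -> R)} :=
  [pred f | `[< smooth f /\ rapidly_decreasing f >]].

Lemma schwartz_predP f :
  reflect (smooth f /\ rapidly_decreasing f) (f \in schwartz_pred).
Proof. exact: asboolP. Qed.

Lemma partialsD w (c : R) f g : smooth f -> smooth g ->
  partials w (c *: f + g) = c *: partials w f + partials w g.
Proof.
move=> sf sg; elim: w => [//|i w ih]; rewrite /= ih; apply/funext => x.
have df := (sf w).2 i x; have dg := (sg w).2 i x.
by rewrite deriveD ?deriveZ//; exact: derivableZ.
Qed.

Lemma partials0 w : partials w 0 = 0.
Proof.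
elim: w => [//|i w ih]; rewrite /= ih; apply/funext => x.
by rewrite (derive_cst (0 : R)).
Qed.

Lemma schwartz_submod : submod_closed schwartz_pred.
Proof.
split=> [|c f g /schwartz_predP[sf rf] /schwartz_predP[sg rg]];
  apply/schwartz_predP; split.
- move=> w; rewrite partials0; split=> [|i] x; first exact: cst_continuous.
  exact: (derivable_cst (0 : R)).
- by move=> w a b; exists 0 => x; rewrite partials0 mulr0 normr0.
- move=> w; rewrite partialsD//; have [cf df] := sf w; have [cg dg] := sg w.
  split=> [|i] x; last by apply: derivableD => //; exact: derivableZ.
  by apply: continuousD; [apply: continuousZr; exact: cf|exact: cg].
- move=> w a b; have [C hC] := rf w a b; have [D hD] := rg w a b.
  exists (`|c| * C + D) => x; rewrite partialsD//=.
  rewrite [X in `|_ * X|](_ : _ = c * partials w f x + partials w g x)//.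
  rewrite mulrDr mulrCA (le_trans (ler_normD _ _))// lerD//.
  by rewrite normrM ler_wpM2l.
Qed.

HB.instance Definition _ :=
  GRing.isSubmodClosed.Build R _ schwartz_pred schwartz_submod.

Record schwartz := Schwartz {
  schwartz_fun :> R * R -> R ;
  _ : schwartz_fun \in schwartz_pred }.

HB.instance Definition _ := [isSub for schwartz_fun].
HB.instance Definition _ := [Choice of schwartz by <:].
HB.instance Definition _ := [SubChoice_isSubLmodule of schwartz by <:].

Lemma is_derive_reflect f x y v : derivable f (x - y) v ->
  is_derive y v (fun z => f (x - z)) (- 'D_v f (x - y)).
Proof.
move=> /cvg_ex[l hl].
have opp0 : -%R @ (0 : R)^' --> (0 : R)^'.
  move=> P [e /= e0 eP]; exists e => //= h; rewrite /ball_/= sub0r normrN => he h0.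
  by apply: eP; rewrite ?oppr_eq0//= /ball_/= sub0r !normrN.
have hlN : (fun h => h^-1 *: (((fun z => f (x - z)) \o shift y) (h *: v)
    - f (x - y))) @ (0 : R)^' --> (- l : R).
  rewrite [X in X @ _ --> _](_ : _ =
    -%R \o (fun h => h^-1 *: ((f \o shift (x - y)) (h *: v) - f (x - y))) \o -%R).
    by apply: (cvg_comp _ _ opp0); exact: cvgN.
  apply/funext => h /=; rewrite invrN scaleNr opprK scaleNr.
  by rewrite opprD addrCA addrA.
have -> : - 'D_v f (x - y) = - l by congr (- _); exact: (cvg_lim _ hl).
by apply: DeriveDef; [apply/cvg_ex; exists (- l)|exact: (cvg_lim _ hlN)].
Qed.

Lemma partials_reflect w f x : smooth f ->
  partials w (fun y => f (x - y)) =
  fun y => (-1) ^+ size w * partials w f (x - y).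
Proof.
move=> sf; elim: w => [|i w ih] /=; first by apply/funext => y; rewrite mul1r.
rewrite ih; apply/funext => y; have df := (sf w).2 i (x - y).
have dr := is_derive_reflect df.
rewrite [LHS](deriveZ (f := fun y => partials w f (x - y))); last exact: ex_derive.
by rewrite derive_val exprS mulN1r mulNr; exact: mulrN.
Qed.

Lemma schwartz_reflect_subproof (phi : schwartz) x :
  (fun y => phi (x - y)) \in schwartz_pred.
Proof.
case: phi => f /= /schwartz_predP[sf rf]; apply/schwartz_predP; split=> w.
- rewrite partials_reflect//; split=> [y|i y].
    apply: cvgMr; apply: (@cvg_comp _ _ _ (fun y => x - y) (partials w f)).
      by apply: cvgB; [exact: cvg_cst|exact: cvg_id].
    exact: (sf w).1.
  have dr := is_derive_reflect ((sf w).2 i (x - y)).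
  exact: (derivableZ (f := fun y => partials w f (x - y))).
- move=> a b; rewrite partials_reflect//.
  have bnd (n : nat) (s t : R) :
      `|t ^+ n| <= 2 ^+ n * (`|s| ^+ n + `|s - t| ^+ n).
    have tri : `|t| <= `|s| + `|s - t|.
      by have := ler_normB s (s - t); rewrite subKr.
    rewrite normrX; have [st|st] := leP `|s| `|s - t|.
      apply: (@le_trans _ _ ((2 * `|s - t|) ^+ n)).
        rewrite lerXn2r ?nnegrE ?mulr_ge0//.
        by rewrite (le_trans tri)// mulr_natl mulr2n lerD2r.
      by rewrite exprMn ler_wpM2l ?exprn_ge0// lerDr exprn_ge0.
    apply: (@le_trans _ _ ((2 * `|s|) ^+ n)).
      rewrite lerXn2r ?nnegrE ?mulr_ge0//.
      by rewrite (le_trans tri)// mulr_natl mulr2n lerD2l ltW.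
    by rewrite exprMn ler_wpM2l ?exprn_ge0// lerDl exprn_ge0.
  have [C0 h0] := rf w 0 0; have [C1 h1] := rf w a 0.
  have [C2 h2] := rf w 0 b; have [C3 h3] := rf w a b.
  exists (2 ^+ a * 2 ^+ b * (`|x.1| ^+ a * `|x.2| ^+ b * C0
    + `|x.2| ^+ b * C1 + `|x.1| ^+ a * C2 + C3)) => y.
  rewrite normrM normrMsign normrM.
  apply: (@le_trans _ _ ((2 ^+ a * (`|x.1| ^+ a + `|x.1 - y.1| ^+ a)) *
     (2 ^+ b * (`|x.2| ^+ b + `|x.2 - y.2| ^+ b)) * `|partials w f (x - y)|)).
    by rewrite ler_wpM2r// ler_pM.
  rewrite mulrACA -[leLHS]mulrA ler_wpM2l ?mulr_ge0 ?exprn_ge0//.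
  have := h0 (x - y); have := h1 (x - y); have := h2 (x - y); have := h3 (x - y).
  rewrite /= !expr0 ?mul1r ?mulr1 !normrM !normrX.
  set p := `|partials w f _|; set s := `|x.1 - y.1| ^+ a.
  set t := `|x.2 - y.2| ^+ b => H3 H2 H1 H0.
  rewrite mulrDl mulrDr 2!mulrDl -!mulrA.
  rewrite [leLHS](_ : _ = `|x.1| ^+ a * (`|x.2| ^+ b * p) + `|x.2| ^+ b * (s * p)
    + `|x.1| ^+ a * (t * p) + s * t * p); last by ring.
  by rewrite !lerD// ?ler_wpM2l ?mulr_ge0 ?exprn_ge0.
Qed.

(* [schwartz_reflect phi x] is the function phi (x - .). *)
Definition schwartz_reflect (phi : schwartz) x : schwartz :=
  Schwartz (schwartz_reflect_subproof phi x).

Definition schwartz_seminorm (N : nat) (phi : schwartz) : R :=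
  \sum_(a < N.+1) \sum_(b < N.+1) \sum_(n < N.+1) \sum_(w : n.-tuple bool)
    sup (range (fun x : R * R => `|x.1 ^+ a * x.2 ^+ b * partials w phi x|)).

Definition fourier f (k : R * R) : R[i] :=
  let mu := (@lebesgue_measure R \x @lebesgue_measure R)%E in
  ((\int[mu]_x (f x * cos (k.1 * x.1 + k.2 * x.2)))%R
   -i* (\int[mu]_x (f x * sin (k.1 * x.1 + k.2 * x.2)))%R)%C.

(* Convention: fourier f k is the integral of f x * exp(- i k.x), so that
   [psi t] is the kernel of exp (- t (d_1^4 - d_2^2)) and has integral 1. *)
Definition semigroup_kernel (psi : R -> schwartz) :=
  forall t, 0 < t -> forall k,
    fourier (psi t) k = (expR (- (t * (k.1 ^+ 4 + k.2 ^+ 2))))%:C%C.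

End SchwartzSpace.

Section BoundedOperators.
Variable R : realType.

Structure bounded_operator (X Y : normedModType R) := BoundedOperator {
  bop_fun :> {linear X -> Y} ;
  bop_continuous : continuous bop_fun }.

Definition strongly_continuous (X Y : normedModType R)
    (F : R * R -> bounded_operator X Y) :=
  forall v : X, continuous (fun x => F x v).

Structure tempered_distribution (X : normedModType R) := TemperedDistribution {
  td_fun :> {linear schwartz R -> X} ;
  td_continuous : exists (N : nat) (C : R),
    forall phi, `|td_fun phi| <= C * schwartz_seminorm N phi }.

Lemma tempered_distribution_ext (X : normedModType R)
    (u v : tempered_distribution X) : u =1 v -> u = v.
Proof.
case: u v => [[u lu] cu] [[v lv] cv] /= /funext uv.
rewrite /= in uv; subst v.
have luv : lu = lv.
  case: lu lv {cu cv} => [[pu] [su]] [[pv] [sv]].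
  by congr (GRing.Linear.Class _ _); congr (_ _); exact: Prop_irrelevance.
by subst lv; congr TemperedDistribution; exact: Prop_irrelevance.
Qed.

(* [smear u phi x] is <u, phi (x - .)>; g_T is [smear g (psi T)]. *)
Definition smear (X : normedModType R) (u : tempered_distribution X)
  (phi : schwartz R) (x : R * R) : X := u (schwartz_reflect phi x).

Definition sup_norm (f : R * R -> R) : \bar R :=
  ereal_sup (range (fun x => `|f x|%:E)).

Definition dist (x y : R * R) : R :=
  `|x.1 - y.1| + Num.sqrt `|x.2 - y.2|.

End BoundedOperators.

Section DirectSum.
Variables (R : realType) (A : {fset R}) (T : A -> completeNormedModType R).

Definition dsum := forall b : A, T b.

HB.instance Definition _ := gen_eqMixin dsum.
HB.instance Definition _ := gen_choiceMixin dsum.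

Implicit Types u v w : dsum.

Definition dsum_zero : dsum := fun=> 0.
Definition dsum_opp u : dsum := fun b => - u b.
Definition dsum_add u v : dsum := fun b => u b + v b.
Definition dsum_scale (c : R) u : dsum := fun b => c *: u b.

Fact dsum_addA : associative dsum_add.
Proof.
by move=> u v w; apply: functional_extensionality_dep => b; exact: addrA.
Qed.

Fact dsum_addC : commutative dsum_add.
Proof.
by move=> u v; apply: functional_extensionality_dep => b; exact: addrC.
Qed.

Fact dsum_add0 : left_id dsum_zero dsum_add.
Proof.
by move=> u; apply: functional_extensionality_dep => b; exact: add0r.
Qed.

Fact dsum_addN : left_inverse dsum_zero dsum_opp dsum_add.
Proof.
by move=> u; apply: functional_extensionality_dep => b; exact: addNr.
Qed.

HB.instance Definition _ :=
  GRing.isZmodule.Build dsum dsum_addA dsum_addC dsum_add0 dsum_addN.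

Fact dsum_scaleA a c u : dsum_scale a (dsum_scale c u) = dsum_scale (a * c) u.
Proof. by apply: functional_extensionality_dep => b; exact: scalerA. Qed.

Fact dsum_scale1 : left_id 1 dsum_scale.
Proof.
by move=> u; apply: functional_extensionality_dep => b; exact: scale1r.
Qed.

Fact dsum_scaleDr : right_distributive dsum_scale +%R.
Proof.
by move=> a u v; apply: functional_extensionality_dep => b; exact: scalerDr.
Qed.

Fact dsum_scaleDl v : {morph dsum_scale^~ v : a c / a + c}.
Proof.
by move=> a c; apply: functional_extensionality_dep => b; exact: scalerDl.
Qed.

HB.instance Definition _ := GRing.Zmodule_isLmodule.Build R dsum
  dsum_scaleA dsum_scale1 dsum_scaleDr dsum_scaleDl.

(* A is finite, so the l^1 norm is equivalent to any other product norm; nothing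
   below depends on the norm beyond equivalence. *)
Definition dsum_norm v : R := \sum_b `|v b|.

Fact ler_dsum_normD u v : dsum_norm (u + v) <= dsum_norm u + dsum_norm v.
Proof. by rewrite -big_split; apply: ler_sum => b _; exact: ler_normD. Qed.

Fact dsum_normZ (c : R) v : dsum_norm (c *: v) = `|c| * dsum_norm v.
Proof. by rewrite mulr_sumr; apply: eq_bigr => b _; exact: normrZ. Qed.

Fact dsum_norm0_eq0 v : dsum_norm v = 0 -> v = 0.
Proof.
move=> /psumr_eq0P v0; apply: functional_extensionality_dep => b.
by apply/normr0_eq0/v0.
Qed.

HB.instance Definition _ :=
  Lmodule_isNormed.Build R dsum ler_dsum_normD dsum_normZ dsum_norm0_eq0.

End DirectSum.

Section Skeleton.
Variables (R : realType) (A : {fset R}) (T : A -> completeNormedModType R).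
Variable Gamma : R * R -> bounded_operator (dsum T) (dsum T).

Definition skeleton_const (C : R) := 0 <= C /\
  forall (b : A) (v : dsum T) (x y : R * R), dist y x <= 1 ->
    `|Gamma y v b - Gamma x v b| <=
    C * \sum_(g : A | fsval g < fsval b)
          dist y x `^ (fsval b - fsval g) * `|Gamma x v g|.

(* The blocks with index g >= b in [G] are irrelevant. *)
Definition triangular := exists
  G : forall b g : A, R * R -> bounded_operator (T g) (T b),
  (forall b g, strongly_continuous (G b g)) /\
  forall x (v : dsum T) (b : A),
    Gamma x v b = v b + \sum_(g : A | fsval g < fsval b) G b g x (v g).

Definition skeleton := [/\ strongly_continuous Gamma, triangular &
  exists C, skeleton_const C].

Definition skeleton_norm : R := inf [set C | skeleton_const C].

Variables (alpha : R) (V : R * R -> bounded_operator (dsum T) R^o).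

Definition modelled_bound (M : A -> R) := (forall b, 0 <= M b) /\
  forall x (v : dsum T), `|V x v| <= \sum_b M b * `|Gamma x v b|.

Definition modelled_const (M : R) := 0 <= M /\
  forall (v : dsum T) (x y : R * R), dist y x <= 1 ->
    `|V y v - V x v| <=
    M * \sum_b dist y x `^ Num.max (alpha - fsval b) 0 * `|Gamma x v b|.

Definition modelled := [/\ strongly_continuous V,
  exists M, modelled_bound M & exists M, modelled_const M].

Definition modelled_seminorm : R := inf [set M | modelled_const M].

End Skeleton.

(* Main.v *)
(* Let F_t(x) = V(x).v_t(x). The semigroup property of psi gives
   (F_tau)_s(x) - F_{tau+s}(x) = int psi_s(x - y) (V(y) - V(x)).v_tau(y) dy,
   and the skeleton and modelled bounds, chained along segments when d(x, y) > 1,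
   bound this by tau^(alpha/4), up to constants, as soon as tau <= s <= 3 tau.
   Since |F_tau| <= B tau^(min A / 4) with min A > -4 and
   phi_tau - phi = O(tau) for a Schwartz function phi, the pairings of F_{2^-n}
   with phi form a geometrically convergent sequence, whose limit is RV(phi).
   Telescoping over dyadic scales gives the bound on (RV)_t - F_t with a constant
   that only sees the increments. For uniqueness, two reconstructions differ by
   O(t^(alpha/4)) after smearing at scale t, hence by the same order when tested
   against phi_t, and phi_t converges to phi. All facts on psi, which is given only
   through its Fourier transform, come from injectivity of the Fourier transform. *)
From HB Require Import structures.
Require Import Defs.
From mathcomp Require Import all_boot all_order all_algebra finmap ring lra.
From mathcomp Require Import all_classical all_reals all_analysis.
From mathcomp Require Import measurable_realfun.

Set Implicit Arguments.
Unset Strict Implicit.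
Unset Printing Implicit Defensive.

Import Order.TTheory GRing.Theory Num.Theory.
Import numFieldNormedType.Exports.

Local Open Scope classical_set_scope.
Local Open Scope ring_scope.

(** * Lebesgue integration on the plane *)

Section LebesguePlane.
Variable R : realType.
Local Notation mu := (@lebesgue_measure R).
Local Notation mT := (measurableTypeR R).
Implicit Types (f g : R * R -> R) (x y : R * R).

(** Since the kernel is known only by its Fourier transform, the semigroup law, the parabolic
    scaling and the evenness in each variable are all reduced to equal integrals against cosines. No
    inversion formula enters: powers of cosines approximate Gaussians, and Gaussians concentrate at
    a point. Although v takes values in a direct sum of Banach spaces, only real integrals occur:
    for frozen x, V(x) composed with v is a real tempered distribution. The estimate has to be
    linear in the modelled seminorm, so the size of V itself may serve only for integrability and
    convergence, and the quantitative part sees just the one-step error. The power |A| - 1 comes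
    from the triangular structure: along a chain of points an index only feels strictly smaller
    ones, so at most |A| - 1 sums are nested. A chain costs a power of distance over scale, which
    the moments of the kernel at that scale absorb. Decay is measured throughout by one polynomial
    weight [wt], which behaves well under translations. *)

Definition plane_measure : set (mT * mT) -> \bar R := (mu \x mu)%E.

HB.instance Definition _ := Measure.on plane_measure.

Lemma plane_measureX (A B : set mT) : measurable A -> measurable B ->
  plane_measure (A `*` B) = (mu A * mu B)%E.
Proof. exact: product_measure1E. Qed.

Lemma plane_measure_sigma_finite : sigma_finite setT plane_measure.
Proof.
have /sigma_finiteP[F [TF ndF Foo]] := sigma_finiteT mu.
exists (fun n => F n `*` F n) => [|n].
  apply/seteqP; split=> // -[x y] _.
  have [i _ Fi] : (\bigcup_i F i) x by rewrite -TF.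
  have [j _ Fj] : (\bigcup_i F i) y by rewrite -TF.
  exists (maxn i j) => //; split=> /=.
    exact: (subsetPset _ _ (ndF _ _ (leq_maxl i j))).
  exact: (subsetPset _ _ (ndF _ _ (leq_maxr i j))).
have [mF Fn] := Foo n; split; first exact: measurableX.
by rewrite plane_measureX// lte_mul_pinfty// ge0_fin_numE.
Qed.

HB.instance Definition _ :=
  Measure_isSigmaFinite.Build _ _ _ plane_measure plane_measure_sigma_finite.

(* Locked, so that rewriting with [mulrA] and the like does not see through it. *)
Definition wt x : R := locked ((1 + x.1 ^+ 2) * (1 + x.2 ^+ 2)).

Lemma wtE x : wt x = (1 + x.1 ^+ 2) * (1 + x.2 ^+ 2).
Proof. by rewrite /wt -lock. Qed.

Lemma onesqr_ge1 (t : R) : 1 <= 1 + t ^+ 2.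
Proof. by rewrite lerDl sqr_ge0. Qed.

Lemma onesqr_gt0 (t : R) : 0 < 1 + t ^+ 2.
Proof. exact: lt_le_trans (onesqr_ge1 t). Qed.

Lemma wt_ge1 x : 1 <= wt x.
Proof. by rewrite wtE mulr_ege1 ?onesqr_ge1. Qed.

Lemma wt_gt0 x : 0 < wt x.
Proof. exact: lt_le_trans (wt_ge1 x). Qed.

Lemma onesqr_le_wt x : 1 + x.1 ^+ 2 <= wt x /\ 1 + x.2 ^+ 2 <= wt x.
Proof.
by split; [rewrite wtE ler_peMr|rewrite wtE ler_peMl]; rewrite ?onesqr_ge1// ltW// onesqr_gt0.
Qed.

(** The mesh may grow like 1 + t ^ 2, so finitely many cells cover the whole line: cells of length 1
    / m on [-m, m[ and one unbounded cell tagged 0, on which |t| <= t ^ 2 / m. The [c j] are the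
    indicators of the cells. *)
Lemma grid1 (e : R) : 0 < e -> exists (J : finType) (a : J -> R) (c : J -> R -> R),
  [/\ forall j, measurable_fun [set: mT] (c j : mT -> mT),
      forall t, \sum_j c j t = 1, forall j t, c j t = 0 \/ c j t = 1 &
      forall j t, c j t != 0 -> `|t - a j| <= e * (1 + t ^+ 2)].
Proof.
move=> e0; pose m := (Num.truncn e^-1).+1.
have me : m%:R^-1 <= e.
  by rewrite -[leRHS]invrK lef_pV2 ?posrE ?invr_gt0//; apply/ltW/truncnS_gt.
have m0 : 0 < m%:R :> R by [].
(* There are 2 * m ^ 2 cells of length 1 / m between -m and m. *)
pose n := (m * m).*2.
pose b (j : nat) : R := - m%:R + j%:R / m%:R.
pose H (j : nat) (t : R) : R := \1_[set` `[b j, +oo[] t.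
have HE j t : H j t = (b j <= t)%R%:R.
  by rewrite /H indicE mem_setE in_itv/= andbT.
have bS j : b j <= b j.+1 by rewrite /b lerD2l ler_pM2r ?invr_gt0// ler_nat.
have b0 : b 0%N = - m%:R by rewrite /b mul0r addr0.
have bn : b n = m%:R.
  by rewrite /b /n -addnn natrD natrM mulrDl -mulrA divff ?lt0r_neq0// mulr1; ring.
have mH j : measurable_fun [set: mT] (H j : mT -> mT).
  have mI : measurable ([set` `[b j, +oo[] : set mT) by exact: measurable_itv.
  exact: measurable_indic.
(* Differences of half-line indicators, so that their sum telescopes; [None] is the complement of
   [-m, m[. *)
pose c (o : option 'I_n) := if o is Some j then fun t => H j t - H j.+1 t
  else fun t => 1 - (H 0%N t - H n t).
exists (option 'I_n), (fun o : option 'I_n => if o is Some j then b j else 0), c.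
have nle (s t : R) : s <= t -> (t - s)%R >= 0 by rewrite subr_ge0.
split.
- case=> [j|] /=; first by apply: measurable_funB; exact: mH.
  by apply: measurable_funB => //; apply: measurable_funB; exact: mH.
- move=> t; rewrite (bigD1 None)//= (reindex_omap Some id)/=; last by case.
  under eq_bigl do rewrite eqxx.
  have := telescope_sumr (H^~ t) (leq0n n); rewrite big_mkord => tel.
  rewrite [X in _ + X](_ : _ = - (H n t - H 0%N t)); first by ring.
  by rewrite -tel -sumrN; apply: eq_bigr => i _; rewrite opprB.
- case=> [j|] t /=; rewrite !HE.
    have := bS j; case: (leP (b j) t) => h1; case: (leP (b j.+1) t) => h2 h3 /=.
    + by left; rewrite subrr.
    + by right; rewrite subr0.
    + by have := lt_le_trans h1 (le_trans h3 h2); rewrite ltxx.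
    + by left; rewrite subrr.
  rewrite b0 bn; case: (leP (- m%:R) t) => h1; case: (leP m%:R t) => h2 /=.
  + by right; ring.
  + by left; ring.
  + by exfalso; lra.
  + by right; ring.
- case=> [j|] t /=; rewrite !HE.
    have bS' : b j.+1 = b j + m%:R^-1 by rewrite /b -natr1 mulrDl mul1r addrA.
    case: (leP (b j) t) => h1; case: (leP (b j.+1) t) => h2 /=.
    + by rewrite subrr eqxx.
    + move=> _; rewrite ger0_norm ?subr_ge0//.
      apply: (@le_trans _ _ m%:R^-1); first by rewrite lerBlDl -bS' ltW.
      apply: (le_trans me); rewrite ler_peMr ?onesqr_ge1//; exact: ltW.
    + by exfalso; have := bS j; lra.
    + by rewrite subrr eqxx.
  rewrite b0 bn subr0; case: (leP (- m%:R) t) => h1; case: (leP m%:R t) => h2 /=.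
  + move=> _; rewrite ger0_norm ?(le_trans (ltW m0))//.
    have : t <= m%:R^-1 * t ^+ 2.
      by rewrite mulrC ler_pdivlMr// expr2 ler_wpM2l// (le_trans (ltW m0)).
    move/le_trans; apply; apply: ler_pM => //; rewrite ?sqr_ge0//.
    by rewrite lerDr.
  + by rewrite subr0 subrr eqxx.
  + by exfalso; lra.
  + move=> _; have t0 : t < 0 by lra.
    rewrite ltr0_norm//.
    have : - t <= m%:R^-1 * t ^+ 2.
      rewrite mulrC ler_pdivlMr// -sqrrN expr2 ler_wpM2l//; lra.
    move/le_trans; apply; apply: ler_pM => //; rewrite ?sqr_ge0//.
    by rewrite lerDr.
Qed.

Definition pmeas f := measurable_fun [set: mT * mT] (f : mT * mT -> mT).

Lemma grid2 (e : R) : 0 < e ->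
  exists (J : finType) (a : J -> R * R) (c : J -> R * R -> R),
  [/\ forall j, pmeas (c j),
      forall x, \sum_j c j x = 1, forall j x, c j x = 0 \/ c j x = 1 &
      forall j x, c j x != 0 ->
        `|x.1 - (a j).1| <= e * wt x /\ `|x.2 - (a j).2| <= e * wt x].
Proof.
move=> e0; have [J [a [c [mc c1 c01 ca]]]] := grid1 e0.
exists (J * J)%type, (fun j => (a j.1, a j.2)), (fun j x => c j.1 x.1 * c j.2 x.2).
split.
- move=> j; apply: measurable_funM.
    by apply: (measurableT_comp (mc j.1)); exact: measurable_fst.
  by apply: (measurableT_comp (mc j.2)); exact: measurable_snd.
- move=> x; rewrite -(pair_bigA _ (fun i j => c i x.1 * c j x.2))/=.
  under eq_bigr do rewrite -mulr_sumr c1 mulr1.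
  exact: c1.
- move=> j x; have [->|->] := c01 j.1 x.1; first by rewrite mul0r; left.
  by rewrite mul1r; exact: c01.
- move=> j x; rewrite mulf_eq0 negb_or => /andP[h1 h2] /=.
  have [w1 w2] := onesqr_le_wt x; split.
    by apply: (le_trans (ca _ _ h1)); rewrite ler_wpM2l// ltW.
  by apply: (le_trans (ca _ _ h2)); rewrite ler_wpM2l// ltW.
Qed.

(** Measurability refers to the product sigma-algebra of the two lines. It is obtained by writing f
    as the pointwise limit of the step functions that take on each grid cell the value of f at its
    tag; at a fixed x the mesh [wt x / (n + 1)] tends to 0. *)
Lemma continuous_pmeas f : continuous f -> pmeas f.
Proof.
move=> cf.
have en n : 0 < n.+1%:R^-1 :> R by [].
have hF n : exists F : R * R -> R, pmeas F /\ forall x (e d : R), 0 < e ->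
   n.+1%:R^-1 * wt x < d -> (forall y, `|x.1 - y.1| < d -> `|x.2 - y.2| < d ->
     `|f y - f x| <= e) -> `|F x - f x| <= e.
  have [J [a [c [mc c1 c01 ca]]]] := grid2 (en n).
  exists (fun x => \sum_j c j x * f (a j)).
  split=> [|x e d e0 nd hd].
    rewrite /pmeas; apply: measurable_sum => j.
    by apply: measurable_funM; [exact: mc|exact: measurable_cst].
  rewrite -[f x]mul1r -(c1 x) mulr_suml -sumrB.
  apply: (le_trans (ler_norm_sum _ _ _)).
  rewrite -[leRHS]mul1r -(c1 x) mulr_suml; apply: ler_sum => j _.
  rewrite -mulrBr normrM; have [cj|cj] := eqVneq (c j x) 0.
    by rewrite cj normr0 !mul0r.
  have cj1 : c j x = 1 by have [/eqP|//] := c01 j x; rewrite (negbTE cj).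
  rewrite cj1 normr1 !mul1r; have [h1 h2] := ca _ _ cj.
  by apply: hd; apply: le_lt_trans nd.
have [F FP] := choice hF.
apply: (@measurable_fun_cvg _ _ _ _ F) => [n|x _].
  exact: (FP n).1.
apply/cvgrPdist_le => e e0.
have /cvgrPdist_le/(_ e e0)/nbhs_ballP[d d0 hd] := cf x.
near=> n.
rewrite distrC; apply: ((FP n).2 x e d) => //.
  rewrite mulrC ltr_pdivrMr//.
  near: n; exists (Num.truncn (wt x / d)) => // n /= hn.
  rewrite -ltr_pdivrMl// mulrC (lt_le_trans (truncnS_gt _))// ler_nat ltnS.
  exact: hn.
by move=> y h1 h2; rewrite distrC; apply: hd; split.
Unshelve. all: by end_near. Qed.

End LebesguePlane.

(** * Integrals of functions dominated by an integrable weight *)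

Section PlaneIntegral.
Variable R : realType.
Local Notation mu := (@lebesgue_measure R).
Local Notation mT := (measurableTypeR R).
Implicit Types (f g : R * R -> R) (x y a l : R * R).

(** A working class of integrable functions: [1 / wt] is a product of two integrable functions of
    one variable, and by Peetre's inequality domination by it survives affine changes of
    variable. *)
Definition decaying f := pmeas f /\ exists K, forall x, `|f x| <= K / wt x.

Definition pint f : R := \int[@plane_measure R]_x f x.

(** Peetre's inequality for this weight; the difference of the two sides is a sum of squares. It
    lets polynomial weights be moved across translations. *)
Lemma onesqr_peetre (s t : R) :
  1 + s ^+ 2 <= 2 * (1 + t ^+ 2) * (1 + (s - t) ^+ 2).
Proof.
rewrite -subr_ge0 [X in 0 <= X](_ : _ = 1 + (2 * t - s) ^+ 2 +
  2 * (t * (s - t)) ^+ 2); last by ring.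
apply: addr_ge0; first by rewrite addr_ge0 ?sqr_ge0.
apply: mulr_ge0 => //; exact: sqr_ge0.
Qed.

Lemma wt_peetre x y : wt x <= 4 * wt y * wt (x - y).
Proof.
rewrite !wtE [leRHS](_ : _ = (2 * (1 + y.1 ^+ 2) * (1 + (x.1 - y.1) ^+ 2)) *
  (2 * (1 + y.2 ^+ 2) * (1 + (x.2 - y.2) ^+ 2))); last by rewrite /=; ring.
by apply: ler_pM; rewrite ?onesqr_peetre ?ltW ?onesqr_gt0.
Qed.

Lemma wtN x : wt (- x) = wt x.
Proof. by rewrite !wtE /= !sqrrN. Qed.

Lemma wtVge0 x : 0 <= (wt x)^-1.
Proof. by rewrite invr_ge0 ltW ?wt_gt0. Qed.

Lemma cst_pmeas (c : R) : pmeas (fun=> c).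
Proof. exact: measurable_cst. Qed.

Lemma pmeasD f g : pmeas f -> pmeas g -> pmeas (fun x => f x + g x).
Proof. by move=> mf mg; apply: measurable_funD. Qed.

Lemma pmeasB f g : pmeas f -> pmeas g -> pmeas (fun x => f x - g x).
Proof. by move=> mf mg; apply: measurable_funB. Qed.

Lemma pmeasM f g : pmeas f -> pmeas g -> pmeas (fun x => f x * g x).
Proof. by move=> mf mg; apply: measurable_funM. Qed.

Lemma pmeas_norm f : pmeas f -> pmeas (fun x => `|f x|).
Proof. by move=> mf; apply: measurableT_comp. Qed.

Lemma pmeas_fst (h : R -> R) : continuous h -> pmeas (fun x => h x.1).
Proof.
move=> ch; apply: (@measurableT_comp _ _ _ _ _ _ (h : mT -> mT)).
  exact: continuous_measurable_fun.
exact: measurable_fst.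
Qed.

Lemma pmeas_snd (h : R -> R) : continuous h -> pmeas (fun x => h x.2).
Proof.
move=> ch; apply: (@measurableT_comp _ _ _ _ _ _ (h : mT -> mT)).
  exact: continuous_measurable_fun.
exact: measurable_snd.
Qed.

Lemma measurable_map2 d (T : measurableType d) (f1 f2 : T -> mT) :
  measurable_fun setT f1 -> measurable_fun setT f2 ->
  measurable_fun setT (fun z => (f1 z, f2 z) : mT * mT).
Proof. exact: measurable_fun_pair. Qed.

Definition affine a l x : R * R := (a.1 + l.1 * x.1, a.2 + l.2 * x.2).

Lemma measurable_affine a l :
  measurable_fun setT (affine a l : mT * mT -> mT * mT).
Proof.
apply: measurable_map2; apply: measurable_funD; try exact: measurable_cst.
  by apply: measurable_funM; [exact: measurable_cst|exact: measurable_fst].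
by apply: measurable_funM; [exact: measurable_cst|exact: measurable_snd].
Qed.

Lemma pmeas_affine a l f : pmeas f -> pmeas (fun x => f (affine a l x)).
Proof.
move=> mf; apply: (@measurableT_comp _ _ _ _ _ _ (f : mT * mT -> mT)) => //.
exact: measurable_affine.
Qed.

Lemma wtV_continuous : continuous (fun x => (wt x)^-1).
Proof.
rewrite (_ : (fun _ => _) = (fun x => ((1 + x.1 ^+ 2) * (1 + x.2 ^+ 2))^-1)).
  2: by apply/funext => x; rewrite wtE.
move=> x; apply: cvgV.
  exact: lt0r_neq0 (mulr_gt0 (onesqr_gt0 _) (onesqr_gt0 _)).
apply: cvgM; apply: cvgD; try exact: cvg_cst.
  apply: (cvg_comp (fun x : R * R => x.1) (fun t : R => t ^+ 2)); first exact: cvg_fst.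
  exact: exprn_continuous.
apply: (cvg_comp (fun x : R * R => x.2) (fun t : R => t ^+ 2)); first exact: cvg_snd.
exact: exprn_continuous.
Qed.

Lemma wtV_pmeas : pmeas (fun x => (wt x)^-1).
Proof. by apply: continuous_pmeas; exact: wtV_continuous. Qed.

Lemma integral_onesqrV : (\int[mu]_t ((1 + t ^+ 2)^-1)%:E)%E = pi%:E.
Proof.
have c1 : continuous (fun t : R => (1 + t ^+ 2)^-1) := @continuous_oneDsqrV R.
rewrite ge0_symfun_integralT//=.
- rewrite (_ : [set x : R | 0 <= x] = `[0, +oo[%classic); last first.
    by apply/seteqP; split=> x /=; rewrite in_itv/= andbT.
  rewrite integral0y_oneDsqr -EFinM; congr EFin.
  by rewrite mulrCA divff// mulr1.
- by move=> x; rewrite invr_ge0 ltW ?onesqr_gt0.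
- by move=> x; rewrite /= sqrrN.
Qed.

Lemma wtV_integrable : (@plane_measure R).-integrable setT
  (fun x : mT * mT => ((wt x)^-1)%:E).
Proof.
have mw : measurable_fun [set: mT * mT] (fun x : mT * mT => ((wt x)^-1)%:E).
  by apply/measurable_EFinP; exact: wtV_pmeas.
apply: ((@integrable12ltyP _ _ _ _ _ mu mu _ mw).2).
have c1 : continuous (fun t : R => (1 + t ^+ 2)^-1) := @continuous_oneDsqrV R.
have m1 : measurable_fun [set: mT] (fun t : mT => ((1 + t ^+ 2)^-1)%:E).
  by apply/measurable_EFinP; exact: continuous_measurable_fun.
have p1 (t : R) : 0 <= (1 + t ^+ 2)^-1 by rewrite invr_ge0 ltW ?onesqr_gt0.
rewrite (eq_integral (fun x : mT => ((1 + x ^+ 2)^-1)%:E * pi%:E)%E); last first.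
  move=> t _; rewrite -integral_onesqrV -ge0_integralZl//; last 2 first.
    by move=> s _; rewrite lee_fin.
    by rewrite lee_fin.
  apply: eq_integral => s _; rewrite !wtE /= ger0_norm ?invfM//.
  by rewrite mulr_ge0.
rewrite ge0_integralZr//; last 2 first.
  by move=> s _; rewrite lee_fin.
  by rewrite lee_fin pi_ge0.
by rewrite integral_onesqrV -EFinM ltry.
Qed.

Lemma decaying_integrable f : decaying f ->
  (@plane_measure R).-integrable setT (fun x : mT * mT => (f x)%:E).
Proof.
move=> [mf [K hK]].
apply: (@le_integrable _ _ _ (@plane_measure R) setT measurableT _ (fun x : mT * mT => (K%:E * ((wt x)^-1)%:E)%E)).
- exact/measurable_EFinP.
- move=> x _; rewrite -EFinM /= lee_fin.
  by rewrite (le_trans (hK x))// ler_norm.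
- by apply: integrableZl => //; exact: wtV_integrable.
Qed.

Lemma decaying_le f g : pmeas f -> decaying g ->
  (exists K, forall x, `|f x| <= K * `|g x|) -> decaying f.
Proof.
move=> mf [mg [L hL]] [K hK]; split=> //; exists (`|K| * L) => x.
apply: (le_trans (hK x)); rewrite -mulrA.
apply: (@le_trans _ _ (`|K| * `|g x|)).
  by rewrite ler_wpM2r// ler_norm.
by rewrite ler_wpM2l.
Qed.

Lemma wtV_decaying : decaying (fun x => (wt x)^-1).
Proof.
split; first exact: wtV_pmeas.
by exists 1 => x; rewrite mul1r ger0_norm// wtVge0.
Qed.

Lemma decayingD f g : decaying f -> decaying g -> decaying (fun x => f x + g x).
Proof.
move=> [mf [K hK]] [mg [L hL]]; split; first exact: pmeasD.
by exists (K + L) => x; rewrite mulrDl (le_trans (ler_normD _ _))// lerD.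
Qed.

Lemma decayingM f g : pmeas g -> (exists B, forall x, `|g x| <= B) ->
  decaying f -> decaying (fun x => g x * f x).
Proof.
move=> mg [B hB] df; have [mf _] := df.
apply: (decaying_le _ df); first exact: pmeasM.
by exists B => x; rewrite normrM ler_wpM2r.
Qed.

Lemma decayingZ c f : decaying f -> decaying (fun x => c * f x).
Proof.
by apply: decayingM; [exact: cst_pmeas|exists `|c|].
Qed.

Lemma decayingZr c f : decaying f -> decaying (fun x => f x * c).
Proof. by move=> /(decayingZ c); under eq_fun do rewrite mulrC. Qed.

Lemma decayingB f g : decaying f -> decaying g -> decaying (fun x => f x - g x).
Proof.
move=> df dg; rewrite (_ : (fun _ => _) = (fun x => f x + (-1) * g x)).
  by apply: decayingD => //; exact: decayingZ.
by apply/funext => x; rewrite mulN1r.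
Qed.

Lemma decaying_norm f : decaying f -> decaying (fun x => `|f x|).
Proof.
move=> [mf [K hK]]; split; first exact: pmeas_norm.
by exists K => x; rewrite normr_id.
Qed.

Lemma decaying0 : decaying (fun=> 0).
Proof.
by split; [exact: cst_pmeas|exists 0 => x; rewrite normr0 mul0r].
Qed.

Lemma decaying_sum (I : finType) (F : I -> R * R -> R) :
  (forall i, decaying (F i)) -> decaying (fun x => \sum_i F i x).
Proof.
move=> dF; elim: (index_enum I) => [|i s ih].
  by under eq_fun do rewrite big_nil; exact: decaying0.
by under eq_fun do rewrite big_cons; exact: decayingD.
Qed.

Lemma eq_pint f g : f =1 g -> pint f = pint g.
Proof. by move=> /funext ->. Qed.

Lemma pintD f g : decaying f -> decaying g ->
  pint (fun x => f x + g x) = pint f + pint g.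
Proof.
by move=> df dg; apply: RintegralD => //; exact: decaying_integrable.
Qed.

Lemma pintB f g : decaying f -> decaying g ->
  pint (fun x => f x - g x) = pint f - pint g.
Proof.
by move=> df dg; apply: RintegralB => //; exact: decaying_integrable.
Qed.

Lemma pintZ c f : decaying f -> pint (fun x => c * f x) = c * pint f.
Proof.
by move=> df; apply: RintegralZl => //; exact: decaying_integrable.
Qed.

Lemma pint0 : pint (fun=> 0) = 0.
Proof.
rewrite -[RHS](mul0r (pint (fun=> 0))) -pintZ; last exact: decaying0.
by apply: eq_pint => x; rewrite mul0r.
Qed.

Lemma pintZr c f : decaying f -> pint (fun x => f x * c) = pint f * c.
Proof.
by move=> df; rewrite mulrC -pintZ//; apply: eq_pint => x; rewrite mulrC.
Qed.

Lemma pint_sum (I : finType) (F : I -> R * R -> R) : (forall i, decaying (F i)) ->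
  pint (fun x => \sum_i F i x) = \sum_i pint (F i).
Proof.
move=> dF; elim: (index_enum I) => [|i s ih].
  rewrite big_nil; transitivity (pint (fun=> 0)); last exact: pint0.
  by apply: eq_pint => x; rewrite big_nil.
rewrite big_cons -ih -pintD//; first by apply: eq_pint => x; rewrite big_cons.
elim: s {ih} => [|j s ih].
  by under eq_fun do rewrite big_nil; exact: decaying0.
by under eq_fun do rewrite big_cons; exact: decayingD.
Qed.

Lemma le_pint f g : decaying f -> decaying g -> (forall x, f x <= g x) ->
  pint f <= pint g.
Proof.
by move=> df dg fg; apply: le_Rintegral => //; exact: decaying_integrable.
Qed.

Lemma norm_pint f : decaying f -> `|pint f| <= pint (fun x => `|f x|).
Proof.
by move=> df; apply: le_normr_Rintegral => //; exact: decaying_integrable.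
Qed.

Lemma norm_pint_le f g : pmeas f -> decaying g -> (forall x, `|f x| <= g x) ->
  `|pint f| <= pint g.
Proof.
move=> mf dg fg; have df : decaying f.
  apply: (decaying_le mf dg); exists 1 => x; rewrite mul1r.
  by rewrite (le_trans (fg x))// ler_norm.
apply: (le_trans (norm_pint df)); apply: le_pint => //; exact: decaying_norm.
Qed.

Lemma pint_ge0 f : (forall x, 0 <= f x) -> 0 <= pint f.
Proof. by move=> f0; apply: Rintegral_ge0. Qed.

Definition wt_mass : R := pint (fun x => (wt x)^-1).

Lemma wt_mass_ge0 : 0 <= wt_mass.
Proof. by apply: pint_ge0 => x; exact: wtVge0. Qed.

Lemma norm_pint_wt f K : pmeas f -> (forall x, `|f x| <= K / wt x) ->
  `|pint f| <= K * wt_mass.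
Proof.
move=> mf fK; rewrite /wt_mass -pintZ; last exact: wtV_decaying.
by apply: norm_pint_le => //; exact: decayingZ wtV_decaying.
Qed.

Lemma pint_cvg (F : nat -> R * R -> R) f K : (forall n, pmeas (F n)) ->
  (forall n x, `|F n x| <= K / wt x) -> (forall x, F ^~ x @ \oo --> f x) ->
  pint \o F @ \oo --> pint f.
Proof.
move=> mF FK Ff.
have mf : pmeas f.
  by apply: (@measurable_fun_cvg _ _ _ _ F) => [n|x _]; [exact: mF|exact: Ff].
have ig : (@plane_measure R).-integrable setT (fun x : mT * mT => (K / wt x)%:E).
  by apply/decaying_integrable/decayingZ/wtV_decaying.
have mFE n : measurable_fun [set: mT * mT] (fun x : mT * mT => (F n x)%:E).
  by apply/measurable_EFinP; exact: mF.
have mfE : measurable_fun [set: mT * mT] (fun x : mT * mT => (f x)%:E).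
  by apply/measurable_EFinP; exact: mf.
have cv : {ae @plane_measure R, forall x, setT x ->
    (fun n => (F n x)%:E) @ \oo --> (f x)%:E}.
  by apply: aeW => x _; apply: cvg_EFin; [exact: nearW|exact: Ff].
have dm : {ae @plane_measure R, forall x n, setT x ->
    (`|(F n x)%:E| <= (K / wt x)%:E)%E}.
  by apply: aeW => x n _; rewrite lee_fin.
have [if_ _ cvi] := dominated_convergence measurableT mFE mfE cv ig dm.
apply: fine_cvg; rewrite fineK//.
exact: integrable_fin_num if_.
Qed.

(** * Affine changes of variables *)

Lemma measurable_affine1 (a l : R) :
  measurable_fun setT ((fun t => a + l * t) : mT -> mT).
Proof.
apply: measurable_funD; first exact: measurable_cst.
by apply: measurable_funM; [exact: measurable_cst|exact: measurable_id].
Qed.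

(** By uniqueness of Lebesgue measure it is enough that the rescaled pushforward is right on
    half-open intervals; a negative l exchanges the open and the closed end, whence the two
    cases. *)
Lemma lebesgue_measure_affine (a l : R) (A : set mT) : l != 0 -> measurable A ->
  mu A = (`|l|%:E * mu ((fun t : mT => (a + l * t)%R : mT) @^-1` A))%E.
Proof.
move=> l0 mA; have l0' : 0 <= `|l| by [].
pose h : mT -> mT := fun t => a + l * t.
have mh : measurable_fun setT h := measurable_affine1 a l.
pose k : {nonneg R} := NngNum l0'.
pose pf : {measure set mT -> \bar R} :=
  mscale k (measure_function_pushforward__canonical__measure_function_Measure mu mh).
transitivity (pf A) => //.
apply: lebesgue_measure_unique => //= _ [[u v]] _ <-.
rewrite /mscale /= /pushforward.
rewrite lebesgue_measure_itv/= lte_fin.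
have [lp|ln] : 0 < l \/ l < 0 by case: (ltgtP l 0) l0 => //; [right|left].
- rewrite (_ : h @^-1` _ = [set` `](u - a) / l, (v - a) / l]]); last first.
    apply/seteqP; split=> t; rewrite /= !in_itv/= /h ltr_pdivrMr// ler_pdivlMr//;
    by rewrite ltrBlDl lerBrDl (mulrC t).
  rewrite lebesgue_measure_itv/= lte_fin ltr_pM2r ?invr_gt0// ltrBlDr subrK.
  case: ifPn => [uv|]; last by rewrite mule0.
  rewrite -!EFinB -EFinM; congr EFin.
  by rewrite gtr0_norm// -mulrBl opprB addrA subrK mulrC divfK.
- rewrite (_ : h @^-1` _ = [set` `[(v - a) / l, (u - a) / l[]); last first.
    apply/seteqP; split=> t; rewrite /= !in_itv/= /h ltr_ndivlMr// ler_ndivrMr//;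
    by rewrite andbC ltrBlDl lerBrDl (mulrC t).
  rewrite lebesgue_measure_itv/= lte_fin ltr_nM2r ?invr_lt0// ltrBlDr subrK.
  case: ifPn => [uv|]; last by rewrite mule0.
  rewrite -!EFinB -EFinM; congr EFin.
  by rewrite ltr0_norm// -mulrBl opprB addrA subrK mulrC mulrN divfK ?opprB.
Qed.

Lemma plane_measure_affine a l (A : set (mT * mT)) : l.1 != 0 -> l.2 != 0 ->
  measurable A -> plane_measure A =
  (`|l.1 * l.2|%:E * plane_measure ((affine a l : mT * mT -> mT * mT) @^-1` A))%E.
Proof.
move=> l1 l2 mA; have k0 : 0 <= `|l.1 * l.2| by [].
pose m : {measure set (mT * mT) -> \bar R} := mscale (NngNum k0)
  (measure_function_pushforward__canonical__measure_function_Measure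
    (@plane_measure R) (measurable_affine a l)).
transitivity (m A) => //.
apply: (@product_measure_unique _ _ _ _ _ mu mu m) => // B C mB mC.
rewrite /m /= /mscale /= /pushforward.
rewrite (_ : _ @^-1` (B `*` C) = ((fun t : mT => a.1 + l.1 * t : mT) @^-1` B) `*`
  ((fun t : mT => a.2 + l.2 * t : mT) @^-1` C)) //.
have mp (c r : R) (D : set mT) : measurable D ->
    measurable ((fun t : mT => c + r * t : mT) @^-1` D).
  by move=> mD; rewrite -[X in measurable X]setTI; exact: measurable_affine1.
rewrite plane_measureX; [|exact: mp|exact: mp].
rewrite (lebesgue_measure_affine a.1 l1 mB) (lebesgue_measure_affine a.2 l2 mC).
by rewrite muleACA -EFinM -normrM.
Qed.

Lemma pint_affine a l f : l.1 != 0 -> l.2 != 0 -> decaying f ->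
  decaying (fun x => f (affine a l x)) ->
  pint (fun x => f (affine a l x)) = `|l.1 * l.2|^-1 * pint f.
Proof.
move=> l1 l2 df dfa.
have k0 : 0 < `|l.1 * l.2| by rewrite normr_gt0 mulf_neq0.
pose nu := measure_function_pushforward__canonical__measure_function_Measure
    (@plane_measure R) (measurable_affine a l).
have mf : measurable_fun [set: mT * mT] (fun x : mT * mT => (f x)%:E).
  by apply/measurable_EFinP; case: df.
have i1 := decaying_integrable dfa.
have i2 := decaying_integrable df.
(* The change of measure is made for nonnegative integrands; positive and negative parts are
   recombined below, where both integrals are finite. *)
have iE (g : mT * mT -> \bar R) : measurable_fun setT g -> (forall x, 0 <= g x)%E ->
    (\int[@plane_measure R]_x g x = `|l.1 * l.2|%:E * \int[nu]_x g x)%E.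
  move=> mg g0; rewrite -(@ge0_integral_mscale _ _ _ nu _ measurableT (NngNum (ltW k0)) _ mg)//.
  by apply: eq_measure_integral => //= A mA _; exact: plane_measure_affine.
have E : (\int[@plane_measure R]_x (f x)%:E = `|l.1 * l.2|%:E *
    \int[nu]_x (f x)%:E)%E.
  rewrite [LHS]integralE [X in (_ * X)%E]integralE.
  rewrite (iE _ (measurable_funepos mf)); last by [].
  rewrite (iE _ (measurable_funeneg mf)); last by [].
  have : nu.-integrable setT (fun x : mT * mT => (f x)%:E).
    exact: (@integrable_pushforward _ _ _ _ _ _ (measurable_affine a l) (@plane_measure R) setT _ mf i1 measurableT).
  move=> inu; have aux (k u v : \bar R) : k \is a fin_num -> u \is a fin_num ->
      v \is a fin_num -> (k * u - k * v = k * (u - v))%E.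
    by case: k u v => [k| |] [u| |] [v| |]// _ _ _; congr EFin; rewrite mulrBr.
  apply: aux => //; first exact: (integrable_pos_fin_num measurableT inu).
  exact: (integrable_neg_fin_num measurableT inu).
have E2 := @integral_pushforward _ _ _ _ _ _ (measurable_affine a l) (@plane_measure R) setT _ mf i1 measurableT.
have E3 := etrans E (congr1 (fun z => `|l.1 * l.2|%:E * z)%E E2).
rewrite /pint /Rintegral E3.
have fin1 := integrable_fin_num measurableT i1.
rewrite (fineM (x := `|l.1 * l.2|%:E) isT fin1).
exact: (esym (mulKf (lt0r_neq0 k0) _)).
Qed.

(** Writing t = r^-1 * ((c + r * t) - c), Peetre's inequality bounds the weight of a point by a
    constant times the weight of its image, one coordinate at a time. *)
Lemma decaying_affine a l f : l.1 != 0 -> l.2 != 0 -> decaying f ->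
  decaying (fun x => f (affine a l x)).
Proof.
move=> l1 l2 [mf [K hK]]; split; first exact: pmeas_affine.
have aux (c r t : R) : r != 0 -> 1 + t ^+ 2 <=
    2 * (1 + r^-1 ^+ 2) * (1 + c ^+ 2) * (1 + (c + r * t) ^+ 2).
  move=> r0; have : t = r^-1 * ((c + r * t) - c).
    by rewrite [c + _]addrC addrK mulKf.
  move: (c + r * t) => s ->.
  apply: (@le_trans _ _ ((1 + r^-1 ^+ 2) * (1 + (s - c) ^+ 2))).
    rewrite exprMn; have := sqr_ge0 r^-1; have := sqr_ge0 (s - c); nra.
  rewrite [leRHS](_ : _ = (1 + r^-1 ^+ 2) *
    (2 * (1 + s ^+ 2) * (1 + (s - c - s) ^+ 2))); last by ring.
  by rewrite ler_wpM2l ?onesqr_peetre// ltW ?onesqr_gt0.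
pose C := 2 * (1 + l.1^-1 ^+ 2) * (1 + a.1 ^+ 2) *
  (2 * (1 + l.2^-1 ^+ 2) * (1 + a.2 ^+ 2)).
exists (`|K| * C) => x; apply: (le_trans (hK _)).
apply: (@le_trans _ _ (`|K| / wt (affine a l x))).
  by rewrite ler_wpM2r ?wtVge0// ler_norm.
rewrite -[X in _ <= X]mulrA ler_wpM2l// ler_pdivlMr ?wt_gt0// mulrC.
rewrite ler_pdivrMr ?wt_gt0// !wtE /C [leRHS]mulrACA; apply: ler_pM; rewrite ?aux ?ltW ?onesqr_gt0//.
Qed.

Lemma pint_reflect f y : decaying f -> pint (fun x => f (y - x)) = pint f.
Proof.
move=> df; have E x : y - x = affine y (-1, -1) x.
  by rewrite /affine /= !mulN1r; case: x y => ? ? [].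
under eq_pint do rewrite E.
have n1 : -1 != 0 :> R by rewrite oppr_eq0 oner_eq0.
rewrite pint_affine//; last exact: decaying_affine.
by rewrite /= mulrNN mul1r normr1 invr1 mul1r.
Qed.

Lemma pint_shift f y : decaying f -> pint (fun x => f (y + x)) = pint f.
Proof.
move=> df; have E x : y + x = affine y (1, 1) x.
  by rewrite /affine /= !mul1r; case: x y => ? ? [].
under eq_pint do rewrite E.
rewrite pint_affine ?oner_eq0//; last by apply: decaying_affine; rewrite ?oner_eq0.
by rewrite /= mul1r normr1 invr1 mul1r.
Qed.

Lemma decaying_reflect f y : decaying f -> decaying (fun x => f (y - x)).
Proof.
move=> df; rewrite (_ : (fun _ => _) = (fun x => f (affine y (-1, -1) x))).
  by apply: decaying_affine; rewrite // oppr_eq0 oner_eq0.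
by apply/funext => x; rewrite /affine /= !mulN1r; case: x y => ? ? [].
Qed.

(** * Fubini's theorem for integrands of convolution type *)

Definition pmeas2 (h : R * R -> R * R -> R) :=
  measurable_fun [set: (mT * mT) * (mT * mT)]
    ((fun z => h z.1 z.2) : (mT * mT) * (mT * mT) -> mT).

Section Fubini.
Variables (h : R * R -> R * R -> R) (K : R).
Hypothesis mh : pmeas2 h.
Hypothesis hK : forall x y, `|h x y| <= K / (wt x * wt (x - y)).

Lemma fubini_K_ge0 : 0 <= K.
Proof.
have := le_trans (normr_ge0 _) (hK 0 0).
by rewrite pmulr_lge0// invr_gt0 mulr_gt0 ?wt_gt0.
Qed.

(** The domination [hK] is not symmetric in x and y; Peetre's inequality still extracts decay in y
    from it, at the price of a factor 4. *)
Lemma fubini_decaying1 x : decaying (h x).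
Proof.
split.
  have := @measurableT_comp _ _ _ _ _ _ _ _ _ mh (pair1_measurable (x : mT * mT)).
  exact.
exists (K * 4) => y; apply: (le_trans (hK x y)).
rewrite -[K * 4 / _]mulrA ler_wpM2l ?fubini_K_ge0//.
rewrite ler_pdivlMr ?wt_gt0// mulrC ler_pdivrMr ?mulr_gt0 ?wt_gt0//.
by have := wt_peetre y x; rewrite -[wt (y - x)]wtN opprB -mulrA.
Qed.

Lemma fubini_decaying2 y : decaying (h ^~ y).
Proof.
split.
  have := @measurableT_comp _ _ _ _ _ _ _ _ _ mh (pair2_measurable (y : mT * mT)).
  exact.
exists K => x; apply: (le_trans (hK x y)).
rewrite ler_wpM2l ?fubini_K_ge0// lef_pV2 ?posrE ?mulr_gt0 ?wt_gt0//.
by rewrite ler_peMr ?wt_ge1// ltW ?wt_gt0.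
Qed.

Let hE z := (h z.1 z.2)%:E.

Let integrable_h : (@plane_measure R \x @plane_measure R)%E.-integrable setT
   (hE : (mT * mT) * (mT * mT) -> \bar R).
Proof.
have mhE : measurable_fun setT (hE : (mT * mT) * (mT * mT) -> \bar R).
  by apply/measurable_EFinP; exact: mh.
apply: ((@integrable12ltyP _ _ _ _ _ (@plane_measure R) (@plane_measure R) _ mhE).2).
(* Tonelli: reflecting and translating the weight, the inner integral of |h x| is at most
   [K * wt_mass / wt x]. *)
apply: (@le_lt_trans _ _ (\int[@plane_measure R]_x ((K * wt_mass) / wt x)%:E)%E).
  apply: ge0_le_integral => //.
  - by move=> x _; apply: integral_ge0.
  - have mah : measurable_fun setT (abse \o (hE : (mT * mT) * (mT * mT) -> \bar R)).
      exact: (measurableT_comp (@abse_measurable R setT) mhE).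
    exact: (measurable_fun_fubini_tonelli_F (m2 := @plane_measure R) _ mah (fun z => abse_ge0 _)).
  - apply/measurable_EFinP; apply: measurable_funM; first exact: measurable_cst.
    exact: wtV_pmeas.
  move=> x _ /=; have dx := decaying_norm (fubini_decaying1 x).
  rewrite -[leLHS]fineK; last exact: (integrable_fin_num _ (decaying_integrable dx)).
  rewrite lee_fin -[fine _]/(pint (fun y => `|h x y|)).
  have dw : decaying (fun y => (wt (x - y))^-1).
    exact: (decaying_reflect x wtV_decaying).
  rewrite mulrAC /wt_mass -(pint_reflect x wtV_decaying) -pintZ//.
  apply: le_pint => //; first exact: decayingZ.
  by move=> y; rewrite (le_trans (hK x y))// invfM mulrA.
have /integrableP[_] := decaying_integrable (decayingZ (K * wt_mass) wtV_decaying).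
apply: le_lt_trans; apply: ge0_le_integral => //.
- by move=> x _; rewrite lee_fin divr_ge0 ?mulr_ge0 ?fubini_K_ge0 ?wt_mass_ge0// ltW ?wt_gt0.
- apply/measurable_EFinP; apply: measurable_funM; first exact: measurable_cst.
  exact: wtV_pmeas.
- apply/measurable_EFinP; apply: measurableT_comp => //.
  apply: measurable_funM; first exact: measurable_cst.
  exact: wtV_pmeas.
- by move=> x _; rewrite lee_fin ler_norm.
Qed.

Lemma pint_fubini :
  pint (fun x => pint (h x)) = pint (fun y => pint (h ^~ y)).
Proof.
rewrite /pint /Rintegral; congr fine.
transitivity (\int[@plane_measure R]_x \int[@plane_measure R]_y hE (x, y))%E.
  apply: eq_integral => x _; rewrite fineK//.
  exact: (integrable_fin_num _ (decaying_integrable (fubini_decaying1 x))).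
rewrite (@Fubini _ _ _ _ _ (@plane_measure R) (@plane_measure R) _ integrable_h).
apply: eq_integral => y _; rewrite fineK//.
exact: (integrable_fin_num _ (decaying_integrable (fubini_decaying2 y))).
Qed.

Lemma fubini_decaying_pint : decaying (fun x => pint (h x)).
Proof.
split.
  have := @measurable_fubini_F _ _ _ _ _ (@plane_measure R) (@plane_measure R) _ integrable_h.
  move=> mF; rewrite /pmeas; apply/measurable_EFinP.
  rewrite (_ : EFin \o _ = fubini_F (@plane_measure R) (hE : (mT * mT) * (mT * mT) -> \bar R))//.
  apply/funext => x /=; rewrite /fubini_F /= fineK//.
  exact: (integrable_fin_num _ (decaying_integrable (fubini_decaying1 x))).
exists (K * wt_mass) => x.
have dw : decaying (fun y => (wt (x - y))^-1).
  exact: (decaying_reflect x wtV_decaying).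
rewrite mulrAC /wt_mass -(pint_reflect x wtV_decaying) -pintZ//.
apply: norm_pint_le; [by case: (fubini_decaying1 x)|exact: decayingZ|].
by move=> y; rewrite (le_trans (hK x y))// invfM mulrA.
Qed.

End Fubini.

End PlaneIntegral.

Arguments pint {R} f.

(** * Injectivity of the Fourier transform *)

Section Taylor.
Variable R : realType.

Lemma mvt_between (f df : R -> R) (a b : R) :
  (forall t : R, is_derive t (1 : R) f (df t)) -> exists c,
    Num.min a b <= c <= Num.max a b /\ f b - f a = df c * (b - a).
Proof.
move=> fdf; have cf : continuous f.
  move=> t; apply/differentiable_continuous/derivable1_diffP.
  exact: (@ex_derive _ _ _ _ _ _ _ (fdf t)).
have cfs (s t : R) : {within `[s, t], continuous f} by apply: continuous_subspaceT.
have [ab|ba] := leP a b.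
  have [c] := MVT_segment ab (fun x _ => fdf x) (cfs a b).
  by rewrite in_itv/= => cab ->; exists c.
have [c] := MVT_segment (ltW ba) (fun x _ => fdf x) (cfs b a).
rewrite in_itv/= => cab E; exists c; split=> //.
by rewrite -opprB E -mulrN opprB.
Qed.

(** [F j] plays the role of the j-th derivative. The mean value theorem for [F 0] minus its Taylor
    polynomial reduces order n + 1 at z to order n at an intermediate point, for the shifted family;
    the factor 1 / n! is given up. *)
Lemma taylor_bound n (F : nat -> R -> R) (K z : R) :
  (forall j (t : R), (j < n)%N -> is_derive t (1 : R) (F j) (F j.+1 t)) ->
  (forall t, `|t| <= `|z| -> `|F n t| <= K) ->
  `|F 0%N z - \sum_(j < n) F j 0 / j`!%:R * z ^+ j| <= K * `|z| ^+ n.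
Proof.
elim: n F z => [|n ih] F z dF FK; first by rewrite big_ord0 subr0 expr0 mulr1 FK.
pose p : {poly R} := \sum_(j < n.+1) (F j 0 / j`!%:R) *: 'X^j.
have pE t : p.[t] = \sum_(j < n.+1) F j 0 / j`!%:R * t ^+ j.
  by rewrite horner_sum; apply: eq_bigr => j _; rewrite hornerZ hornerXn.
have dpE t : p^`().[t] = \sum_(j < n) F j.+1 0 / j`!%:R * t ^+ j.
  rewrite raddf_sum big_ord_recl/= expr0 derivZ derivC scaler0 add0r horner_sum.
  apply: eq_bigr => j _; rewrite derivZ derivXn hornerZ hornerMn hornerXn.
  rewrite -[bump 0 j]/(j.+1) [_.-1]/= -[t ^+ j *+ _]mulr_natr factS natrM invfM.
  have jn : j.+1%:R != 0 :> R by rewrite pnatr_eq0.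
  rewrite -!mulrA; congr (_ * _).
  by rewrite mulrCA [t ^+ j * _]mulrC mulKf.
pose g t := F 0%N t - p.[t].
have dg (t : R) : is_derive t (1 : R) g (F 1%N t - p^`().[t]).
  by apply: is_deriveB; exact: (dF 0%N t isT).
have g0 : g 0 = 0.
  rewrite /g pE big_ord_recl big1 ?addr0 ?expr0 ?fact0 ?divr1 ?mulr1 ?subrr//.
  by move=> j _; rewrite /= expr0n /= mulr0.
have [c [cz gE]] := mvt_between 0 z dg.
have cz' : `|c| <= `|z|.
  move: cz; rewrite /Num.min /Num.max; case: ltP => z0 /andP[c1 c2].
    by rewrite !ger0_norm// ltW.
  by rewrite !ler0_norm// lerN2.
rewrite -pE -/(g z) -[g z]subr0 -g0 gE subr0 normrM exprSr mulrA.
rewrite ler_wpM2r// dpE.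
have := ih (fun j => F j.+1) c (fun j t jn => dF j.+1 t jn).
move=> /(_ (fun t tc => FK t (le_trans tc cz')))/le_trans; apply.
have K0 : 0 <= K by apply: le_trans (FK 0 _); rewrite ?normr0.
by rewrite ler_wpM2l// lerXn2r ?nnegrE.
Qed.

Lemma cos_taylor (u : R) : `|cos u - (1 - u ^+ 2 / 2)| <= u ^+ 4.
Proof.
pose F (j : nat) : R -> R :=
  if j is 1 then - sin else if j is 2 then - cos else if j is 3 then sin else cos.
have dF (j : nat) (t : R) : (j < 4)%N -> is_derive t (1 : R) (F j) (F j.+1 t).
  case: j => [|[|[|[|j]]]]//= _.
  - exact: is_derive_cos.
  - exact: (is_deriveN (is_derive_sin t)).
  - by have := is_deriveN (is_derive_cos t); rewrite opprK.
  - exact: is_derive_sin.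
have u4 : `|u ^+ 4| = u ^+ 4 by rewrite ger0_norm ?exprn_even_ge0.
suff -> : 1 - u ^+ 2 / 2 = \sum_(j < 4) F j 0 / j`!%:R * u ^+ j.
  by have := taylor_bound (K := 1) (z := u) dF (fun t _ => cos_max t); rewrite mul1r -normrX u4.
have nE (f : R -> R) (x : R) : (- f) x = - f x by [].
rewrite !big_ord_recl big_ord0 /= !nE sin0 cos0.
rewrite !(expr0, oppr0, mul0r, addr0, add0r, mulr1, fact0, divr1).
by rewrite mulN1r mulNr [_^-1 * _]mulrC.
Qed.

Lemma expRN_taylor (v : R) : 0 <= v -> `|expR (- v) - (1 - v)| <= v ^+ 2.
Proof.
move=> v0; have h1 := expR_ge1Dx (- v).
have h2 : expR (- v) <= 1 - v + v ^+ 2.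
  rewrite expRN invf_ple ?posrE ?expR_gt0//; last nra.
  apply: le_trans (expR_ge1Dx v); rewrite -[leLHS]mul1r ler_pdivrMr; last nra.
  rewrite (_ : _ * _ = 1 + v ^+ 3); last by ring.
  by rewrite lerDl exprn_ge0.
by rewrite ger0_norm; lra.
Qed.

Lemma norm_exprB (a b : R) n : `|a| <= 1 -> `|b| <= 1 ->
  `|a ^+ n - b ^+ n| <= n%:R * `|a - b|.
Proof.
move=> a1 b1; elim: n => [|n ih]; first by rewrite !expr0 subrr normr0 mul0r.
rewrite [X in `|X|](_ : _ = a * (a ^+ n - b ^+ n) + (a - b) * b ^+ n); last first.
  by rewrite !exprS; ring.
rewrite (le_trans (ler_normD _ _))// !normrM -natr1 mulrDl mul1r lerD//.
  by rewrite (le_trans _ ih)// ler_piMl.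
by rewrite ler_piMr// normrX exprn_ile1.
Qed.

(** With u = s / sqrt N, the numbers cos u and exp(- u ^ 2 / 2) differ by at most 2 * u ^ 4 = 2 * s
    ^ 4 / N ^ 2, and N-th powers of numbers bounded by 1 cost only a factor N. *)
Lemma cos_pow_cvg (s : R) :
  (fun n => cos (s / Num.sqrt n.+1%:R) ^+ n.+1) @ \oo --> expR (- (s ^+ 2 / 2)).
Proof.
have b n : `|cos (s / Num.sqrt n.+1%:R) ^+ n.+1 - expR (- (s ^+ 2 / 2))| <=
    2 * s ^+ 4 * n.+1%:R^-1.
  set u := s / _; have u2 : u ^+ 2 = s ^+ 2 / n.+1%:R.
    by rewrite /u expr_div_n sqr_sqrtr.
  have -> : expR (- (s ^+ 2 / 2)) = expR (- (u ^+ 2 / 2)) ^+ n.+1.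
    rewrite -expRM_natl; congr expR; rewrite u2 mulrN; congr (- _).
    by rewrite -mulr_natl; field.
  apply: (le_trans (norm_exprB _ _ _)); first exact: cos_max.
    rewrite ger0_norm ?expR_ge0// -expR0 ler_expR lerNl oppr0.
    by rewrite divr_ge0 ?sqr_ge0.
  have h1 := cos_taylor u.
  have h2 : `|expR (- (u ^+ 2 / 2)) - (1 - u ^+ 2 / 2)| <= u ^+ 4.
    apply: (le_trans (expRN_taylor _)); first by rewrite divr_ge0 ?sqr_ge0.
    rewrite expr_div_n -exprM ler_pdivrMr// ler_peMr ?exprn_even_ge0//; lra.
  have : `|cos u - expR (- (u ^+ 2 / 2))| <= 2 * u ^+ 4.
    have := ler_distD (1 - u ^+ 2 / 2) (cos u) (expR (- (u ^+ 2 / 2))).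
    by rewrite [X in _ <= _ + X]distrC; lra.
  have u4 : u ^+ 4 = s ^+ 4 / n.+1%:R ^+ 2.
    by rewrite (exprM u 2 2) u2 expr_div_n -exprM.
  rewrite u4 -(ler_pM2l (x := n.+1%:R))// => /le_trans; apply.
  by rewrite le_eqVlt; apply/orP; left; apply/eqP; field.
apply/cvgrPdist_le => e e0; near=> n.
rewrite distrC; apply: (le_trans (b n)).
rewrite ler_pdivrMr//; near: n.
exists (Num.truncn (2 * s ^+ 4 / e)) => // n /= hn.
rewrite -ler_pdivrMl// mulrC; apply/ltW/(lt_le_trans (truncnS_gt _)).
by rewrite ler_nat ltnS.
Unshelve. all: by end_near. Qed.

End Taylor.

(** * Functions orthogonal to all plane waves *)

Section FourierInjectivity.
Variable R : realType.
Local Notation mu := (@lebesgue_measure R).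
Local Notation mT := (measurableTypeR R).
Implicit Types (f g : R * R -> R) (x y k l : R * R).

Definition dotp k x : R := k.1 * x.1 + k.2 * x.2.

Lemma pmeas_dotp k : pmeas (dotp k).
Proof.
apply: pmeasD; apply: pmeasM; try exact: cst_pmeas.
  exact: measurable_fst.
exact: measurable_snd.
Qed.

Lemma pmeas_comp (h : R -> R) f : continuous h -> pmeas f -> pmeas (fun x => h (f x)).
Proof.
move=> ch mf; apply: (@measurableT_comp _ _ _ _ _ _ (h : mT -> mT)) => //.
exact: continuous_measurable_fun.
Qed.

Lemma pmeas_wave k (t : R) : pmeas (fun x => cos (dotp k x - t)).
Proof.
apply: (pmeas_comp (@continuous_cos R)); apply: pmeasB; first exact: pmeas_dotp.
exact: cst_pmeas.
Qed.

Lemma decaying_wave f k (t : R) : decaying f ->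
  decaying (fun x => f x * cos (dotp k x - t)).
Proof.
move=> df; under eq_fun do rewrite mulrC.
apply: decayingM => //; first exact: pmeas_wave.
by exists 1 => x; exact: cos_max.
Qed.

(** Vanishing of the Fourier transform in real terms: the free phase t covers cosine and sine at
    once and makes the class stable under multiplication by waves. *)
Definition wave_free f := forall k (t : R), pint (fun x => f x * cos (dotp k x - t)) = 0.

Lemma wave_freeM f l (t : R) : decaying f -> wave_free f ->
  wave_free (fun x => f x * cos (dotp l x - t)).
Proof.
move=> df f0 k s.
transitivity (pint (fun x => 2^-1 * (f x * cos (dotp (l + k) x - (t + s))) +
  2^-1 * (f x * cos (dotp (l - k) x - (t - s))))).
  apply: eq_pint => x.
  have -> : dotp (l + k) x - (t + s) = (dotp l x - t) + (dotp k x - s).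
    by rewrite /dotp /=; ring.
  have -> : dotp (l - k) x - (t - s) = (dotp l x - t) - (dotp k x - s).
    by rewrite /dotp /=; ring.
  move: (dotp l x - t) (dotp k x - s) => a b.
  by rewrite cosD cosB; field.
rewrite pintD; try by apply: decayingZ; exact: decaying_wave.
by rewrite !pintZ ?f0 ?mulr0 ?addr0//; exact: decaying_wave.
Qed.

Definition gauss (s : R) := expR (- (s ^+ 2 / 2)).

Lemma gauss_ge0 s : 0 <= gauss s. Proof. exact: expR_ge0. Qed.

Lemma gauss_le s : gauss s <= 2 / (1 + s ^+ 2).
Proof.
rewrite /gauss expRN -[leRHS]invf_div lef_pV2 ?posrE ?expR_gt0 ?divr_gt0 ?onesqr_gt0//.
apply: (le_trans _ (expR_ge1Dx _)).
by rewrite mulrDl lerD2r mul1r invf_le1// ler1n.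
Qed.

Lemma continuous_gauss : continuous gauss.
Proof.
move=> s; apply: (@continuous_comp _ _ _ (fun s : R => - (s ^+ 2 / 2)) expR).
  apply: cvgN; apply: cvgM; [exact: exprn_continuous|exact: cvg_cst].
exact: continuous_expR.
Qed.

Lemma decaying_gauss2 : decaying (fun x => gauss x.1 * gauss x.2).
Proof.
split; first by apply: pmeasM; [exact: pmeas_fst continuous_gauss|exact: pmeas_snd continuous_gauss].
exists 4 => x; rewrite ger0_norm ?mulr_ge0 ?gauss_ge0//.
rewrite wtE invfM [leRHS](_ : _ = (2 / (1 + x.1 ^+ 2)) * (2 / (1 + x.2 ^+ 2))); last by ring.
by apply: ler_pM; rewrite ?gauss_ge0 ?gauss_le.
Qed.

(** Only the sign of the Gaussian mass matters, so the integral is bounded below on the unit square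
    instead of being computed. *)
Lemma pint_gauss2_gt0 : 0 < pint (fun x => gauss x.1 * gauss x.2).
Proof.
pose Q : set (mT * mT) := `[0 : R, 1] `*` `[0 : R, 1].
have mQ : measurable Q by apply: measurableX; exact: measurable_itv.
have Q1 : pint (\1_Q) = 1.
  rewrite /pint /Rintegral integral_indic// setIT.
  transitivity (fine (mu `[0%R : R, 1%R] * mu `[0%R : R, 1%R])%E).
    by congr fine; apply: plane_measureX; exact: measurable_itv.
  by rewrite lebesgue_measure_itv/= lte_fin ltr01 oppr0 adde0 mul1e.
have dQ : decaying (\1_Q).
  split; first exact: measurable_indic.
  exists 4 => x; rewrite indicE; case: (boolP (x \in Q)) => [|_]; last first.
    by rewrite normr0 divr_ge0// ltW ?wt_gt0.
  rewrite inE => -[/=]; rewrite !in_itv/= => /andP[a0 a1] /andP[b0 b1].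
  rewrite normr1 ler_pdivlMr ?wt_gt0// mul1r wtE.
  rewrite (_ : 4 = 2 * 2); last by rewrite -natrM.
  by apply: ler_pM; rewrite ?(ltW (onesqr_gt0 _))// -[leRHS]/(1 + 1) lerD2l exprn_ile1.
have : pint (fun x => gauss 1 * gauss 1 * (\1_Q x : R)) <=
    pint (fun x => gauss x.1 * gauss x.2).
  apply: le_pint; [exact: decayingZ|exact: decaying_gauss2|move=> x].
  rewrite indicE; case: (boolP (x \in Q)) => [|_]; last first.
    by rewrite mulr0 mulr_ge0 ?gauss_ge0.
  rewrite inE => -[/=]; rewrite !in_itv/= => /andP[a0 a1] /andP[b0 b1].
  by rewrite mulr1; apply: ler_pM; rewrite ?gauss_ge0// /gauss ler_expR lerN2 ler_pM2r ?invr_gt0// expr1n exprn_ile1.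
rewrite pintZ// Q1 mulr1; apply: lt_le_trans.
by rewrite mulr_gt0 ?expR_gt0.
Qed.

(* Products of cosines are combinations of waves, and cos (s / sqrt N) ^ N tends
   to the Gaussian, so a wave-free function is also orthogonal to Gaussians. *)
Lemma wave_free_gauss f y (c : R) : decaying f -> wave_free f ->
  pint (fun x => f x * (gauss (c * (x.1 - y.1)) * gauss (c * (x.2 - y.2)))) = 0.
Proof.
move=> df f0.
pose W (l : R) m n x := f x * (cos (dotp (l, 0) x - l * y.1) ^+ m *
  cos (dotp (0, l) x - l * y.2) ^+ n).
have W0 (l : R) (m n : nat) : decaying (W l m n) /\ wave_free (W l m n).
  elim: n m => [|n ihn]; first elim => [|m ihm].
  - rewrite (_ : W l 0%N 0%N = f)//.
    by apply/funext => x; rewrite /W !expr0 !mulr1.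
  - rewrite (_ : W l m.+1 0%N = fun x => W l m 0%N x * cos (dotp (l, 0) x - l * y.1)).
      split; first by apply: decaying_wave; case: ihm.
      by apply: wave_freeM; case: ihm.
    by apply/funext => x; rewrite /W exprSr; ring.
  - move=> m; have {}ihn := ihn m.
    rewrite (_ : W l m n.+1 = fun x => W l m n x * cos (dotp (0, l) x - l * y.2)).
      split; first by apply: decaying_wave; case: ihn.
      by apply: wave_freeM; case: ihn.
    by apply/funext => x; rewrite /W exprSr; ring.
(* Frequency and power are matched as in [cos_pow_cvg]; the phases inside [W] centre the waves at
   y. *)
pose F n := W (c / Num.sqrt n.+1%:R) n.+1 n.+1.
have F0 : pint \o F = fun=> 0.
  apply/funext => n /=; have [_ /(_ 0 0)] := W0 (c / Num.sqrt n.+1%:R) n.+1 n.+1.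
  move=> E; rewrite -[RHS]E; apply: eq_pint => x.
  by rewrite /dotp /= !mul0r addr0 subr0 cos0 mulr1.
have [mf [K hK]] := df.
have cvF : pint \o F @ \oo -->
    pint (fun x => f x * (gauss (c * (x.1 - y.1)) * gauss (c * (x.2 - y.2)))).
  apply: (@pint_cvg _ _ _ K).
  - by move=> n; have [[]] := W0 (c / Num.sqrt n.+1%:R) n.+1 n.+1.
  - move=> n x; apply: le_trans (hK x); rewrite /F /W normrM ler_piMr// normrM.
    by rewrite mulr_ile1// normrX exprn_ile1// cos_max.
  - move=> x; apply: cvgMl_tmp; apply: cvgM.
      have := @cos_pow_cvg R (c * (x.1 - y.1)).
      rewrite (_ : (fun n => _) = (fun n => cos (dotp (c / Num.sqrt n.+1%:R, 0) x -
        c / Num.sqrt n.+1%:R * y.1) ^+ n.+1))//.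
      by apply/funext => n; congr (cos _ ^+ _); rewrite /dotp /=; ring.
    have := @cos_pow_cvg R (c * (x.2 - y.2)).
    rewrite (_ : (fun n => _) = (fun n => cos (dotp (0, c / Num.sqrt n.+1%:R) x -
      c / Num.sqrt n.+1%:R * y.2) ^+ n.+1))//.
    by apply/funext => n; congr (cos _ ^+ _); rewrite /dotp /=; ring.
rewrite F0 in cvF.
exact: (cvg_unique (@Rhausdorff R) cvF (cvg_cst 0)).
Qed.

(** The Gaussians of width 1 / (n + 1) concentrate at y: after rescaling, the vanishing integrals
    are those of f(y + x / (n + 1)) against a fixed Gaussian, and by dominated convergence they tend
    to f(y) times its mass. *)
Lemma wave_free_eq0 f : continuous f -> decaying f -> wave_free f -> forall y, f y = 0.
Proof.
move=> cf df f0 y; have [mf [K hK]] := df.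
pose F (n : nat) x := f (affine y (n.+1%:R^-1, n.+1%:R^-1) x) * (gauss x.1 * gauss x.2).
have bf x : `|f x| <= `|K|.
  rewrite (le_trans (hK x))// ler_pdivrMr ?wt_gt0// (le_trans (ler_norm K))//.
  by rewrite ler_peMr// wt_ge1.
have dF n : decaying (F n).
  apply: decayingM; last exact: decaying_gauss2.
    exact: pmeas_affine.
  by exists `|K|.
have F0 : pint \o F = fun=> 0.
  apply/funext => n /=; have n0 : n.+1%:R != 0 :> R by rewrite pnatr_eq0.
  have n1 : n.+1%:R^-1 != 0 :> R by rewrite invr_eq0.
  pose H x := f x * (gauss (n.+1%:R * (x.1 - y.1)) * gauss (n.+1%:R * (x.2 - y.2))).
  have FE x : F n x = H (affine y (n.+1%:R^-1, n.+1%:R^-1) x).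
    rewrite /F /H; have aK (a b : R) : n.+1%:R * (a + n.+1%:R^-1 * b - a) = b.
      by rewrite addrAC subrr add0r mulVKf.
    by rewrite /= !aK.
  have dH : decaying H.
    rewrite /H; under eq_fun do rewrite mulrC.
    apply: decayingM => //.
      apply: pmeasM.
        apply: (@pmeas_fst _ (fun t => gauss (n.+1%:R * (t - y.1)))) => t.
        apply: (@continuous_comp _ _ _ (fun t : R => n.+1%:R * (t - y.1)) gauss); last exact: continuous_gauss.
        by apply: cvgMl_tmp; apply: cvgB; [exact: cvg_id|exact: cvg_cst].
      apply: (@pmeas_snd _ (fun t => gauss (n.+1%:R * (t - y.2)))) => t.
      apply: (@continuous_comp _ _ _ (fun t : R => n.+1%:R * (t - y.2)) gauss); last exact: continuous_gauss.
      by apply: cvgMl_tmp; apply: cvgB; [exact: cvg_id|exact: cvg_cst].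
    exists 1 => x; rewrite normrM mulr_ile1// ger0_norm ?gauss_ge0//;
    by rewrite /gauss -expR0 ler_expR lerNl oppr0 divr_ge0 ?sqr_ge0.
  rewrite (eq_pint FE) pint_affine//; last exact: decaying_affine.
  by rewrite /H wave_free_gauss// mulr0.
have cvF : pint \o F @ \oo --> pint (fun x => f y * (gauss x.1 * gauss x.2)).
  have [_ [L hL]] := decaying_gauss2.
  apply: (@pint_cvg _ _ _ (`|K| * L)) => [n|n x|x]; first by case: (dF n).
    by rewrite normrM -mulrA ler_pM.
  apply: cvgMr_tmp.
  apply: (@cvg_comp _ _ _ (fun n : nat => affine y (n.+1%:R^-1, n.+1%:R^-1) x) f); last exact: cf.
  have h (a b : R) : (fun n : nat => a + n.+1%:R^-1 * b) @ \oo --> a.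
    rewrite -[X in _ --> X]addr0; apply: cvgD; first exact: cvg_cst.
    by rewrite -(mul0r b); apply: cvgMr_tmp; exact: cvg_harmonic.
  exact: (cvg_pair (h y.1 x.1) (h y.2 x.2)).
rewrite F0 in cvF.
have /eqP : pint (fun x => f y * (gauss x.1 * gauss x.2)) = 0.
  exact: (cvg_unique (@Rhausdorff R) cvF (cvg_cst 0)).
rewrite pintZ; last exact: decaying_gauss2.
by rewrite mulf_eq0 (gt_eqF pint_gauss2_gt0) orbF => /eqP.
Qed.

End FourierInjectivity.

(** * Schwartz functions and tempered distributions *)

Section SchwartzBounds.
Variable R : realType.
Local Notation mT := (measurableTypeR R).
Implicit Types (f g : R * R -> R) (x y z : R * R) (phi : schwartz R) (w : seq bool).

Lemma schwartzP phi : smooth phi /\ rapidly_decreasing phi.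
Proof. by case: phi => f /= /schwartz_predP. Qed.

Lemma onesqr_pow_le (t : R) m : (1 + t ^+ 2) ^+ m <= 2 ^+ m * (1 + `|t| ^+ (2 * m)).
Proof.
have t2 : t ^+ 2 = `|t| ^+ 2 by rewrite real_normK ?num_real.
rewrite t2 exprM; move: (`|t| ^+ 2) (sqr_ge0 `|t|) => s s0.
have [s1|s1] := leP s 1.
  apply: (@le_trans _ _ (2 ^+ m)).
    by rewrite lerXn2r ?nnegrE ?addr_ge0//; lra.
  by rewrite ler_peMr ?exprn_ge0// lerDl exprn_ge0.
apply: (@le_trans _ _ ((2 * s) ^+ m)).
  rewrite lerXn2r ?nnegrE ?addr_ge0 ?mulr_ge0//; lra.
by rewrite exprMn ler_wpM2l ?exprn_ge0// lerDr.
Qed.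

Definition term_sup (a b : nat) w phi : R :=
  sup (range (fun x : R * R => `|x.1 ^+ a * x.2 ^+ b * partials w phi x|)).

Lemma term_sup_ub a b w phi x :
  `|x.1 ^+ a * x.2 ^+ b * partials w phi x| <= term_sup a b w phi.
Proof.
apply: ub_le_sup; last by exists x.
have [_ /(_ w a b)[C hC]] := schwartzP phi.
by exists C => _ [z _ <-].
Qed.

Lemma term_sup_ge0 a b w phi : 0 <= term_sup a b w phi.
Proof. exact: le_trans (term_sup_ub a b w phi 0). Qed.

Lemma term_sup_le_seminorm a b w N phi : (a <= N)%N -> (b <= N)%N -> (size w <= N)%N ->
  term_sup a b w phi <= schwartz_seminorm N phi.
Proof.
rewrite -!(ltnS _ N) => aN bN wN; rewrite /schwartz_seminorm.
have t0 a' b' w' := term_sup_ge0 a' b' w' phi.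
rewrite (bigD1 (Ordinal aN))//= (bigD1 (Ordinal bN))//= (bigD1 (Ordinal wN))//=.
rewrite (bigD1 (in_tuple w))//= -!addrA.
have s0 (I : finType) (P : pred I) (F : I -> R) : (forall i, 0 <= F i) -> 0 <= \sum_(i | P i) F i.
  by move=> F0; apply: sumr_ge0.
rewrite -[leLHS]addr0 lerD// !addr_ge0//.
- by apply: (s0 _ _ _) => ?; exact: t0.
- by apply: (s0 _ _ _) => ?; apply: (s0 _ _ _) => ?; exact: t0.
- by apply: (s0 _ _ _) => ?; apply: (s0 _ _ _) => ?; apply: (s0 _ _ _) => ?; exact: t0.
- by apply: (s0 _ _ _) => ?; apply: (s0 _ _ _) => ?; apply: (s0 _ _ _) => ?; apply: (s0 _ _ _) => ?; exact: t0.
Qed.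

Lemma seminorm_ge0 N phi : 0 <= schwartz_seminorm N phi.
Proof. exact: le_trans (term_sup_ge0 0 0 [::] phi) (term_sup_le_seminorm _ _ _ _). Qed.

(** The factor 4 ^ (m + 1): (1 + t ^ 2) ^ m is at most 2 ^ m * (1 + |t| ^ (2 * m)) in each
    coordinate, and the product expands into four monomials, each controlled by one term of the
    seminorm. *)
Lemma partials_le_seminorm m w N phi x : (2 * m <= N)%N -> (size w <= N)%N ->
  `|partials w phi x| <= 4 ^+ m.+1 * schwartz_seminorm N phi / wt x ^+ m.
Proof.
move=> mN wN; rewrite ler_pdivlMr ?exprn_gt0 ?wt_gt0// wtE exprMn.
set p := `|partials w phi x|; have p0 : 0 <= p := normr_ge0 _.
apply: (@le_trans _ _ (p * ((2 ^+ m * (1 + `|x.1| ^+ (2 * m))) * (2 ^+ m * (1 + `|x.2| ^+ (2 * m)))))).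
  rewrite ler_wpM2l//; apply: ler_pM; rewrite ?exprn_ge0 ?(ltW (onesqr_gt0 _)) ?onesqr_pow_le//.
have S a b : (a <= N)%N -> (b <= N)%N -> `|x.1| ^+ a * `|x.2| ^+ b * p <= schwartz_seminorm N phi.
  move=> aN bN; apply: le_trans (term_sup_le_seminorm phi aN bN wN).
  by have := term_sup_ub a b w phi x; rewrite !normrM !normrX.
have := S 0%N 0%N isT isT; have := S (2 * m)%N 0%N mN isT.
have := S 0%N (2 * m)%N isT mN; have := S (2 * m)%N (2 * m)%N mN mN.
rewrite !expr0 !mulr1 !mul1r; set s := schwartz_seminorm _ _.
set A := `|x.1| ^+ _; set B := `|x.2| ^+ _ => h1 h2 h3 h4.
have -> : p * (2 ^+ m * (1 + A) * (2 ^+ m * (1 + B))) =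
    4 ^+ m * (p + A * p + B * p + A * B * p).
  by rewrite (_ : 4 = 2 * 2 :> R) ?exprMn; [ring|rewrite -natrM].
rewrite exprSr -[X in _ <= X]mulrA ler_wpM2l ?exprn_ge0//; lra.
Qed.

Definition seminorm_terms (N : nat) : R :=
  \sum_(a < N.+1) \sum_(b < N.+1) \sum_(n < N.+1) \sum_(w : n.-tuple bool) 1.

Lemma seminorm_terms_ge0 N : 0 <= seminorm_terms N.
Proof. by do 4!(apply: sumr_ge0 => ? _). Qed.

(** Converse of [partials_le_seminorm]: as |t| <= 1 + t ^ 2, the power wt ^ N dominates every
    monomial of the seminorm, so that estimates can be made with [wt] alone. *)
Lemma seminorm_le N phi (B : R) :
  (forall w x, (size w <= N)%N -> `|partials w phi x| <= B / wt x ^+ N) ->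
  schwartz_seminorm N phi <= seminorm_terms N * B.
Proof.
move=> hB; rewrite /schwartz_seminorm /seminorm_terms.
rewrite mulr_suml; apply: ler_sum => a _; rewrite mulr_suml; apply: ler_sum => b _.
rewrite mulr_suml; apply: ler_sum => n _; rewrite mulr_suml; apply: ler_sum => w _.
rewrite mul1r; apply: ge_sup; first by exists (`|(0 : R * R).1 ^+ a * (0 : R * R).2 ^+ b * partials w phi 0|); exists 0.
move=> _ [x _ <-]; rewrite !normrM !normrX.
have wN : (size w <= N)%N by rewrite size_tuple -ltnS.
have := hB w x wN; rewrite ler_pdivlMr ?exprn_gt0 ?wt_gt0// => /(le_trans _); apply.
rewrite mulrC ler_wpM2l// wtE exprMn.
have aux (t : R) (c : 'I_N.+1) : `|t| ^+ c <= (1 + t ^+ 2) ^+ N.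
  have t1 : `|t| <= 1 + t ^+ 2.
    have -> : t ^+ 2 = `|t| ^+ 2 by rewrite real_normK ?num_real.
    by have := sqr_ge0 (`|t| - 1); have := normr_ge0 t; nra.
  apply: (@le_trans _ _ ((1 + t ^+ 2) ^+ c)).
    by rewrite lerXn2r ?nnegrE// ltW ?onesqr_gt0.
  by apply: ler_weXn2l; [exact: onesqr_ge1|rewrite -ltnS].
by apply: ler_pM; rewrite ?exprn_ge0 ?aux.
Qed.

Lemma partials_pmeas w phi : pmeas (partials w phi).
Proof. by apply: continuous_pmeas; have [sphi _] := schwartzP phi; exact: (sphi w).1. Qed.

Lemma partials_bound w phi m : exists K, 0 <= K /\ forall x, `|partials w phi x| <= K / wt x ^+ m.
Proof.
exists (4 ^+ m.+1 * schwartz_seminorm (2 * m + size w) phi); split.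
  by rewrite mulr_ge0 ?exprn_ge0 ?seminorm_ge0.
by move=> x; apply: partials_le_seminorm; rewrite ?leq_addr ?leq_addl.
Qed.

Lemma smooth_is_derive1 f w (s t : R) : smooth f ->
  is_derive s (1 : R) (fun r => partials w f (r, t)) (partials (false :: w) f (s, t)).
Proof.
move=> sf; have /derivableP dh := (sf w).2 false (s, t).
have E : (fun h => h^-1 *: (((fun r => partials w f (r, t)) \o shift s) (h *: (1 : R)) - partials w f (s, t))) =
  (fun h => h^-1 *: ((partials w f \o shift (s, t)) (h *: axis R false) - partials w f (s, t))).
  apply/funext => h /=; congr (_ *: (partials w f _ - _)).
  by congr pair; rewrite /= ?scaler0 ?add0r.
apply: DeriveDef; first by rewrite /derivable E; exact: (sf w).2.
by rewrite /derive E.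
Qed.

Lemma smooth_is_derive2 f w (s t : R) : smooth f ->
  is_derive t (1 : R) (fun r => partials w f (s, r)) (partials (true :: w) f (s, t)).
Proof.
move=> sf.
have E : (fun h => h^-1 *: (((fun r => partials w f (s, r)) \o shift t) (h *: (1 : R)) - partials w f (s, t))) =
  (fun h => h^-1 *: ((partials w f \o shift (s, t)) (h *: axis R true) - partials w f (s, t))).
  apply/funext => h /=; congr (_ *: (partials w f _ - _)).
  by congr pair; rewrite /= ?scaler0 ?add0r.
apply: DeriveDef; first by rewrite /derivable E; exact: (sf w).2.
by rewrite /derive E.
Qed.

(** The path from x to y is horizontal at height x.2, then vertical at abscissa y.1. Derivatives are
    bounded on these two segments only, so that L can reflect their decay there. *)
Lemma smooth_lipschitz f w x y (L : R) : smooth f ->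
  (forall s, Num.min x.1 y.1 <= s <= Num.max x.1 y.1 -> `|partials (false :: w) f (s, x.2)| <= L) ->
  (forall s, Num.min x.2 y.2 <= s <= Num.max x.2 y.2 -> `|partials (true :: w) f (y.1, s)| <= L) ->
  `|partials w f x - partials w f y| <= L * (`|x.1 - y.1| + `|x.2 - y.2|).
Proof.
case: x y => [x1 x2] [y1 y2] sf /= h1 h2.
have [c [hc E1]] := mvt_between x1 y1 (fun t => smooth_is_derive1 w t x2 sf).
have [d [hd E2]] := mvt_between x2 y2 (fun t => smooth_is_derive2 w y1 t sf).
rewrite -opprB normrN [X in `|X|](_ : _ = (partials w f (y1, x2) - partials w f (x1, x2)) +
  (partials w f (y1, y2) - partials w f (y1, x2))); last by ring.
rewrite E1 E2 (le_trans (ler_normD _ _))// !normrM mulrDr.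
by apply: lerD; [rewrite (distrC x1)|rewrite (distrC x2)]; apply: ler_wpM2r => //; [exact: h1|exact: h2].
Qed.

Lemma lipschitz_continuous g (L : R) :
  (forall x y, `|g x - g y| <= L * (`|x.1 - y.1| + `|x.2 - y.2|)) -> continuous g.
Proof.
move=> hL x; apply/cvgrPdist_le => e e0.
have M0 : 0 < `|L| + 1 by rewrite ltr_wpDl.
have d0 : 0 < e / (2 * (`|L| + 1)) by rewrite divr_gt0 ?mulr_gt0.
apply: filterS (nbhsx_ballx x _ d0) => y [h1 h2].
rewrite /ball /= in h1 h2.
apply: (le_trans (hL _ _)).
apply: (@le_trans _ _ ((`|L| + 1) * (`|x.1 - y.1| + `|x.2 - y.2|))).
  by rewrite ler_wpM2r ?addr_ge0// (le_trans (ler_norm L))// lerDl.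
rewrite -ler_pdivlMl// -(mulrC e).
have -> : e / (`|L| + 1) = e / (2 * (`|L| + 1)) + e / (2 * (`|L| + 1)).
  by field; rewrite gt_eqF.
by rewrite lerD// ltW.
Qed.

(** Origin of 100: on the rectangle spanned by y and a, each 1 + r ^ 2 is at most 5 * wt y ^ 2,
    hence the weight is at most 25 * wt y ^ 4, and Peetre's inequality contributes 4. *)
Lemma wt_between y (a : R * R) z (e s t : R) : e <= 1 ->
  `|y.1 - a.1| <= e * wt y -> `|y.2 - a.2| <= e * wt y ->
  Num.min y.1 a.1 <= s <= Num.max y.1 a.1 -> Num.min y.2 a.2 <= t <= Num.max y.2 a.2 ->
  wt z <= 100 * wt y ^+ 4 * wt ((s, t) - z).
Proof.
move=> e1 h1 h2 hs ht; have [w1 w2] := onesqr_le_wt y.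
have aux (p q r : R) : `|p - q| <= e * wt y -> 1 + p ^+ 2 <= wt y ->
    Num.min p q <= r <= Num.max p q -> 1 + r ^+ 2 <= 5 * wt y ^+ 2.
  move=> hpq hp hr; have wy := wt_ge1 y.
  have pq : `|p - q| <= wt y by rewrite (le_trans hpq)// ler_piMl// ltW ?wt_gt0.
  have pw : `|p| <= wt y.
    apply: le_trans hp; have -> : p ^+ 2 = `|p| ^+ 2 by rewrite real_normK ?num_real.
    by have := sqr_ge0 (`|p| - 1); have := normr_ge0 p; nra.
  have : `|r| <= 2 * wt y.
    move: pq pw hr; rewrite !ler_norml /Num.min /Num.max.
    by case: ltP => _ /andP[? ?] /andP[? ?] /andP[? ?]; apply/andP; split; lra.
  move=> rw; have -> : r ^+ 2 = `|r| ^+ 2 by rewrite real_normK ?num_real.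
  have : `|r| ^+ 2 <= (2 * wt y) ^+ 2 by rewrite lerXn2r ?nnegrE ?mulr_ge0 ?(ltW (wt_gt0 _)).
  by rewrite exprMn; nra.
have hw : wt (s, t) <= 25 * wt y ^+ 4.
  rewrite wtE /= [leRHS](_ : _ = (5 * wt y ^+ 2) * (5 * wt y ^+ 2)); last by ring.
  by apply: ler_pM; rewrite ?(ltW (onesqr_gt0 _))// ?(aux _ _ _ h1 w1 hs) ?(aux _ _ _ h2 w2 ht).
have := wt_peetre z (s, t); rewrite -[wt (z - _)]wtN opprB => /le_trans; apply.
rewrite ler_wpM2r ?(ltW (wt_gt0 _))//.
by rewrite [leRHS](_ : _ = 4 * (25 * wt y ^+ 4)) ?ler_wpM2l//; ring.
Qed.

(** In use, a is the tag of the grid cell of y. The gain e is paid for by a power of [wt y], which a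
    rapidly decreasing factor in y later absorbs, while the decay in z is kept in full. *)
Lemma partials_shift_bound phi w N y (a : R * R) z (e L : R) : 0 <= L -> 0 <= e <= 1 ->
  `|y.1 - a.1| <= e * wt y -> `|y.2 - a.2| <= e * wt y ->
  (forall i x, `|partials (i :: w) phi x| <= L / wt x ^+ N) ->
  `|partials w phi (y - z) - partials w phi (a - z)| <=
    e * (2 * L * 100 ^+ N * wt y ^+ (4 * N).+1) / wt z ^+ N.
Proof.
move=> L0 /andP[e0 e1] h1 h2 hL; have [sphi _] := schwartzP phi.
have wz := wt_gt0 z; have wy := wt_gt0 y.
pose M := L * (100 * wt y ^+ 4 / wt z) ^+ N.
have hM i s t : Num.min y.1 a.1 <= s <= Num.max y.1 a.1 ->
    Num.min y.2 a.2 <= t <= Num.max y.2 a.2 ->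
    `|partials (i :: w) phi ((s, t) - z)| <= M.
  move=> hs ht; apply: (le_trans (hL _ _)); rewrite ler_wpM2l// -exprVn.
  rewrite lerXn2r ?nnegrE ?invr_ge0 ?divr_ge0 ?mulr_ge0 ?exprn_ge0 ?(ltW (wt_gt0 _))//.
  rewrite ler_pdivlMr// [_^-1 * _]mulrC ler_pdivrMr ?wt_gt0//.
  exact: (wt_between z e1 h1 h2 hs ht).
have min_l (p q : R) : Num.min p q <= p <= Num.max p q by rewrite ge_min le_max lexx.
have min_r (p q : R) : Num.min p q <= q <= Num.max p q by rewrite ge_min le_max lexx !orbT.
have shmm (p q r s : R) : Num.min (p - r) (q - r) <= s <= Num.max (p - r) (q - r) ->
    Num.min p q <= s + r <= Num.max p q.
  by rewrite -!(rwP andP) /Num.min /Num.max ltrD2r; case: ltP => _ [? ?]; split; lra.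
have := @smooth_lipschitz phi w (y - z) (a - z) M sphi.
move=> /(_ _ _)/le_trans; apply.
- move=> s hs; have -> : (s, (y - z).2) = (s + z.1, y.2) - z.
    by rewrite [RHS]surjective_pairing /= addrK.
  exact: (hM false _ _ (shmm _ _ _ _ hs) (min_l y.2 a.2)).
- move=> s hs; have -> : ((a - z).1, s) = (a.1, s + z.2) - z.
    by rewrite [RHS]surjective_pairing /= addrK.
  exact: (hM true _ _ (min_r y.1 a.1) (shmm _ _ _ _ hs)).
have -> : e * (2 * L * 100 ^+ N * wt y ^+ (4 * N).+1) / wt z ^+ N = M * (e * wt y + e * wt y).
  by rewrite /M expr_div_n exprMn -exprM exprS; ring.
rewrite ler_wpM2l ?mulr_ge0 ?exprn_ge0 ?divr_ge0 ?mulr_ge0 ?exprn_ge0 ?(ltW wz) ?(ltW wy)//.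
rewrite /= [y.1 - _ - _](_ : _ = y.1 - a.1); last by ring.
rewrite [y.2 - _ - _](_ : _ = y.2 - a.2); last by ring.
exact: lerD.
Qed.

End SchwartzBounds.

(** * Correlation of a Schwartz function with a rapidly decreasing kernel *)

Section Convolution.
Variable R : realType.
Local Notation mT := (measurableTypeR R).
Implicit Types (f g k : R * R -> R) (x y z : R * R) (phi psi : schwartz R) (w : seq bool).

(** Decay as for Schwartz functions, without smoothness, so that absolute values and products with
    functions of polynomial growth stay in the class. *)
Definition rapid k := pmeas k /\
  forall m, exists K, 0 <= K /\ forall x, `|k x| <= K / wt x ^+ m.

Lemma rapid_decaying k : rapid k -> decaying k.
Proof. by move=> [mk /(_ 1%N)[K [_ hK]]]; split=> //; exists K. Qed.

Lemma rapidM k g (C : R) M : rapid k -> pmeas g -> (forall x, `|g x| <= C * wt x ^+ M) ->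
  rapid (fun x => k x * g x).
Proof.
move=> [mk hk] mg hg; split; first exact: pmeasM.
move=> m; have [K [K0 hK]] := hk (m + M)%N.
have C0 : 0 <= `|C| by [].
exists (K * `|C|); split=> [|x]; first exact: mulr_ge0.
have w0 := wt_gt0 x.
have wm0 : 0 < wt x ^+ m by rewrite exprn_gt0.
have wM0 : 0 < wt x ^+ M by rewrite exprn_gt0.
apply: (@le_trans _ _ ((K / wt x ^+ (m + M)) * (`|C| * wt x ^+ M))).
  rewrite normrM; apply: ler_pM => //; apply: (le_trans (hg x)).
  by rewrite ler_wpM2r ?(ltW wM0)// ler_norm.
by rewrite exprD le_eqVlt; apply/orP; left; apply/eqP; field; rewrite ?gt_eqF.
Qed.

Lemma rapid_norm k : rapid k -> rapid (fun x => `|k x|).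
Proof.
move=> [mk hk]; split; first exact: pmeas_norm.
by move=> m; have [K [K0 hK]] := hk m; exists K; split=> // x; rewrite normr_id.
Qed.

Lemma partials_rapid w phi : rapid (partials w phi).
Proof. by split; [exact: partials_pmeas|move=> m; exact: partials_bound]. Qed.

Lemma schwartz_rapid phi : rapid phi.
Proof. exact: partials_rapid [::] phi. Qed.

Lemma pmeas_reflect k x : pmeas k -> pmeas (fun y => k (x - y)).
Proof.
move=> mk; rewrite (_ : (fun _ => _) = (fun y => k (affine x (-1, -1) y))).
  exact: pmeas_affine.
by apply/funext => y; rewrite /affine /= !mulN1r; case: x y => ? ? [].
Qed.

Lemma pmeas_shift k x : pmeas k -> pmeas (fun y => k (y + x)).
Proof.
move=> mk; rewrite (_ : (fun _ => _) = (fun y => k (affine x (1, 1) y))).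
  exact: pmeas_affine.
by apply/funext => y; rewrite addrC /affine /= !mul1r; case: x y => ? ? [].
Qed.

Lemma wtV_peetre x y m : (wt (x - y) ^+ m)^-1 <= 4 ^+ m * wt x ^+ m / wt y ^+ m.
Proof.
rewrite -exprMn -expr_div_n -exprVn lerXn2r ?nnegrE ?divr_ge0 ?invr_ge0 ?mulr_ge0 ?(ltW (wt_gt0 _))//.
rewrite ler_pdivlMr ?wt_gt0// [_^-1 * _]mulrC ler_pdivrMr ?wt_gt0//.
by have := wt_peetre y x; rewrite -[wt (y - x)]wtN opprB.
Qed.

Lemma rapid_reflect k x : rapid k -> rapid (fun y => k (x - y)).
Proof.
move=> [mk hk]; split; first exact: pmeas_reflect.
move=> m; have [K [K0 hK]] := hk m.
exists (K * (4 ^+ m * wt x ^+ m)); split=> [|y].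
  by rewrite !mulr_ge0 ?exprn_ge0 ?(ltW (wt_gt0 _)).
rewrite (le_trans (hK _))// -[X in _ <= X]mulrA ler_wpM2l//; exact: wtV_peetre.
Qed.

Lemma decaying_boundedM k f (C : R) : decaying k -> pmeas f -> (forall x, `|f x| <= C) ->
  decaying (fun y => k y * f y).
Proof.
move=> dk mf hf; under eq_fun do rewrite mulrC.
by apply: decayingM => //; exists C.
Qed.

(** A correlation; a convolution is recovered by reflecting k. In this form y is a displacement from
    z, ready for Taylor expansion. *)
Definition cv k f z := pint (fun y => k y * f (y + z)).

Lemma smooth_is_derive_line f w i x (t : R) : smooth f ->
  is_derive t (1 : R) (fun r : R => partials w f (x + r *: axis R i))
    (partials (i :: w) f (x + t *: axis R i)).
Proof.
move=> sf.
have E : (fun h : R => h^-1 *: (((fun r : R => partials w f (x + r *: axis R i)) \o shift t) (h *: (1 : R)) -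
     partials w f (x + t *: axis R i))) =
  (fun h => h^-1 *: ((partials w f \o shift (x + t *: axis R i)) (h *: axis R i)
     - partials w f (x + t *: axis R i))).
  apply/funext => h /=; congr (_ *: (partials w f _ - _)).
  by rewrite [h *: 1]mulr1 scalerDl addrCA.
apply: DeriveDef; first by rewrite /derivable E; exact: (sf w).2.
by rewrite /derive E.
Qed.

Lemma partials_integrand_decaying k phi w z : decaying k ->
  decaying (fun y => k y * partials w phi (y + z)).
Proof.
move=> dk; have [K [K0 hK]] := partials_bound w phi 0.
apply: (decaying_boundedM (C := K)) => //.
  by apply: pmeas_shift; exact: partials_pmeas.
by move=> y; rewrite (le_trans (hK _))// expr0 divr1.
Qed.

(** Differentiation under the integral by a second-order Taylor bound: the remainder is at most K *
    h ^ 2 times the integral of |k|, with K a bound on the second derivative. *)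
Lemma cv_is_derive k phi w i z : decaying k ->
  is_derive z (axis R i) (cv k (partials w phi)) (cv k (partials (i :: w) phi) z).
Proof.
move=> dk; have [sphi _] := schwartzP phi.
have [K [K0 hK]] := partials_bound [:: i, i & w] phi 0.
have dI w' z' := partials_integrand_decaying phi w' z' dk.
pose G := cv k (partials w phi).
have bnd (h : R) : `|G (z + h *: axis R i) - G z - h * cv k (partials (i :: w) phi) z| <=
    K * pint (fun y => `|k y|) * h ^+ 2.
  rewrite /G /cv -pintB// -pintZ// -pintB; last exact: decayingZ.
    have -> : K * pint (fun y => `|k y|) * h ^+ 2 = pint (fun y => `|k y| * (K * h ^+ 2)).
      by rewrite pintZr; [ring|exact: decaying_norm].
    apply: norm_pint_le.
    - apply: pmeasB; first apply: pmeasB; try by case: (dI w (z + h *: axis R i)); try by case: (dI w z).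
      by case: (decayingZ h (dI (i :: w) z)).
    - by apply: decayingZr; exact: decaying_norm.
    move=> y; set p := y + z.
    rewrite [X in `|X|](_ : _ = k y * (partials w phi (p + h *: axis R i) - partials w phi p
      - h * partials (i :: w) phi p)); last by rewrite addrA -/p; ring.
    rewrite normrM ler_wpM2l//.
    pose F j t := partials (nseq j i ++ w) phi (p + t *: axis R i).
    have := @taylor_bound R 2 F K h.
    move=> /(_ _ _); rewrite !big_ord_recl big_ord0 /F /= !scale0r !addr0 expr0 expr1 !divr1 mulr1.
    rewrite opprD addrA [_ * h]mulrC => H.
    apply: (le_trans (H _ _)).
    - by move=> j t _; exact: smooth_is_derive_line.
    - by move=> t _; rewrite (le_trans (hK _))// expr0 divr1.
    by rewrite -normrX [X in _ * X]ger0_norm ?sqr_ge0// mulrC.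
  exact: decayingB.
have cvG : h^-1 *: ((G \o shift z) (h *: axis R i) - G z) @[h --> (0 : R)^'] -->
    (cv k (partials (i :: w) phi) z : R).
  apply/cvgrPdist_le => e e0.
  pose c := K * pint (fun y => `|k y|) + 1.
  have c0 : 0 < c by rewrite ltr_wpDl// mulr_ge0// pint_ge0.
  exists (e / c); first by rewrite /= divr_gt0.
  move=> h /=; rewrite sub0r normrN => he h0.
  set D := cv k (partials (i :: w) phi) z.
  rewrite distrC [X in `|X|](_ : _ = h^-1 * (G (z + h *: axis R i) - G z - h * D)); last first.
    by rewrite /= (addrC z) [RHS]mulrBr mulKf.
  rewrite normrM normfV mulrC ler_pdivrMr ?normr_gt0//.
  apply: (le_trans (bnd h)).
  have -> : h ^+ 2 = `|h| * `|h| by rewrite -expr2 real_normK ?num_real.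
  rewrite mulrA ler_wpM2r//.
  apply: (@le_trans _ _ (c * `|h|)); first by rewrite ler_wpM2r// lerDl.
  by rewrite mulrC -ler_pdivlMr// ltW.
by apply: DeriveDef; [apply/cvg_ex; eexists; exact: cvG|exact: (cvg_lim _ cvG)].
Qed.

Lemma cv_continuous k phi w : decaying k -> continuous (cv k (partials w phi)).
Proof.
move=> dk; have [sphi _] := schwartzP phi.
have [K1 [K10 h1]] := partials_bound (false :: w) phi 0.
have [K2 [K20 h2]] := partials_bound (true :: w) phi 0.
have dI w' z' := partials_integrand_decaying phi w' z' dk.
apply: (@lipschitz_continuous _ _ (pint (fun y => `|k y|) * (K1 + K2))) => x y.
rewrite /cv -pintB// -mulrA -pintZr; last exact: decaying_norm.
apply: norm_pint_le.
- by case: (decayingB (dI w x) (dI w y)).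
- by apply: decayingZr; exact: decaying_norm.
move=> z; rewrite -mulrBr normrM ler_wpM2l//.
apply: (le_trans (smooth_lipschitz (L := K1 + K2) sphi _ _)).
- by move=> s _; rewrite (le_trans (h1 _))// expr0 divr1 lerDl.
- by move=> s _; rewrite (le_trans (h2 _))// expr0 divr1 lerDr.
by rewrite /= !opprD !addrA ![z.1 + _ - z.1]addrAC ![z.2 + _ - z.2]addrAC !subrr !add0r.
Qed.

Lemma partials_cv k phi w : decaying k -> partials w (cv k phi) = cv k (partials w phi).
Proof.
move=> dk; elim: w => [//|i w ih] /=; rewrite ih; apply/funext => z.
by have dz := cv_is_derive phi w i z dk; rewrite derive_val.
Qed.

(** Of the m + 1 powers of the weight in k, m carry the decay of f over from y + z to z by Peetre's
    inequality, and the last one makes the integral converge. *)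
Lemma cv_decay k f m (K L : R) z : pmeas f -> rapid k ->
  (forall x, `|k x| <= K / wt x ^+ m.+1) -> (forall x, `|f x| <= L / wt x ^+ m) ->
  `|cv k f z| <= K * L * 4 ^+ m * wt_mass R / wt z ^+ m.
Proof.
move=> mf rk hK hL.
have K0 : 0 <= K.
  by have := le_trans (normr_ge0 _) (hK 0); rewrite pmulr_lge0// invr_gt0 exprn_gt0 ?wt_gt0.
have L0 : 0 <= L.
  by have := le_trans (normr_ge0 _) (hL 0); rewrite pmulr_lge0// invr_gt0 exprn_gt0 ?wt_gt0.
rewrite mulrAC; apply: norm_pint_wt.
  by apply: pmeasM; [case: rk|exact: pmeas_shift].
move=> y; rewrite normrM; have wy := wt_gt0 y; have wz := wt_gt0 z.
apply: (@le_trans _ _ ((K / wt y ^+ m.+1) * (L * (4 ^+ m * wt y ^+ m / wt z ^+ m)))).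
  apply: ler_pM => //; rewrite (le_trans (hL _))// ler_wpM2l//.
  have := wtV_peetre (- y) z m; rewrite wtN -opprD wtN.
  by move=> /le_trans; apply.
by rewrite exprS le_eqVlt; apply/orP; left; apply/eqP; field; rewrite !gt_eqF ?exprn_gt0.
Qed.

Lemma conv_subproof k phi : rapid k -> cv k phi \in @schwartz_pred R.
Proof.
move=> rk; have dk := rapid_decaying rk; apply/schwartz_predP; split=> w.
  rewrite partials_cv//; split=> [|i z]; first exact: cv_continuous.
  exact: (@ex_derive _ _ _ _ _ _ _ (cv_is_derive phi w i z dk)).
move=> a b; rewrite partials_cv//; pose m := (a + b)%N.
have [K [K0 hK]] := rk.2 m.+1; have [L [L0 hL]] := partials_bound w phi m.
exists (K * L * 4 ^+ m * wt_mass R) => x.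
have := cv_decay x (partials_pmeas w phi) rk hK hL.
rewrite ler_pdivlMr ?exprn_gt0 ?wt_gt0// mulrC normrM; apply: le_trans.
rewrite ler_wpM2r// normrM !normrX.
have [w1 w2] := onesqr_le_wt x.
have aux (t : R) c : 1 + t ^+ 2 <= wt x -> `|t| ^+ c <= wt x ^+ c.
  move=> tw; rewrite lerXn2r ?nnegrE ?(ltW (wt_gt0 _))// (le_trans _ tw)//.
  have -> : t ^+ 2 = `|t| ^+ 2 by rewrite real_normK ?num_real.
  by have := sqr_ge0 (`|t| - 1); have := normr_ge0 t; nra.
by rewrite /m exprD ler_pM ?exprn_ge0 ?aux.
Qed.

Definition conv_schwartz k (rk : rapid k) phi : schwartz R := Schwartz (conv_subproof phi rk).

End Convolution.

(** * Smearing of tempered distributions *)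

Section Distributions.
Variable R : realType.
Local Notation mT := (measurableTypeR R).
Implicit Types (f g k : R * R -> R) (x y z : R * R) (phi psi chi : schwartz R) (w : seq bool).

Lemma partials_scaleD w (c : R) phi psi z :
  partials w (c *: phi + psi : schwartz R) z = c * partials w phi z + partials w psi z.
Proof.
have [sphi _] := schwartzP phi; have [spsi _] := schwartzP psi.
rewrite (_ : schwartz_fun (c *: phi + psi) = c *: (phi : R * R -> R) + (psi : R * R -> R))//.
by rewrite partialsD.
Qed.

Lemma partialsB w phi psi z :
  partials w (phi - psi : schwartz R) z = partials w phi z - partials w psi z.
Proof.
by rewrite addrC -scaleN1r partials_scaleD mulN1r addrC.
Qed.

Lemma partials_sum w (I : finType) (c : I -> R) (F : I -> schwartz R) z :
  partials w (\sum_i c i *: F i : schwartz R) z = \sum_i c i * partials w (F i) z.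
Proof.
elim: (index_enum I) => [|i s ih].
  rewrite !big_nil (_ : schwartz_fun 0 = 0)//.
  by rewrite partials0.
by rewrite !big_cons partials_scaleD ih.
Qed.

Lemma partials_reflectE w phi x z :
  partials w (schwartz_reflect phi x) z = (-1) ^+ size w * partials w phi (x - z).
Proof.
have [sphi _] := schwartzP phi.
by rewrite [LHS](_ : _ = partials w (fun y => phi (x - y)) z)// partials_reflect.
Qed.

(** Two forms of one estimate for the translates of psi to y and to its grid tag a: the pointwise
    form controls the derivatives of Riemann sums, the seminorm form controls the smear of a
    distribution. *)
Lemma reflect_modulus psi N : exists C, 0 <= C /\ forall y (a : R * R) (e : R), 0 <= e <= 1 ->
  `|y.1 - a.1| <= e * wt y -> `|y.2 - a.2| <= e * wt y ->
  (forall w z, (size w <= N)%N -> `|partials w psi (y - z) - partials w psi (a - z)| <=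
      e * (C * wt y ^+ (4 * N).+1) / wt z ^+ N) /\
  schwartz_seminorm N (schwartz_reflect psi y - schwartz_reflect psi a) <=
  e * (seminorm_terms R N * C * wt y ^+ (4 * N).+1).
Proof.
pose L := 4 ^+ N.+1 * schwartz_seminorm (2 * N).+1 psi.
have L0 : 0 <= L by rewrite mulr_ge0 ?exprn_ge0 ?seminorm_ge0.
exists (2 * L * 100 ^+ N); split; first by rewrite mulr_ge0 ?exprn_ge0// mulr_ge0.
move=> y a e e01 h1 h2.
have H w z : (size w <= N)%N -> `|partials w psi (y - z) - partials w psi (a - z)| <=
      e * (2 * L * 100 ^+ N * wt y ^+ (4 * N).+1) / wt z ^+ N.
  move=> wN; apply: partials_shift_bound => // i x.
  apply: partials_le_seminorm => //=; rewrite ltnS (leq_trans wN)//.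
  by rewrite leq_pmull.
split=> //.
rewrite [X in _ <= X](_ : _ = seminorm_terms R N * (e * (2 * L * 100 ^+ N * wt y ^+ (4 * N).+1))); last by ring.
apply: seminorm_le => w z wN; rewrite partialsB !partials_reflectE -mulrBr normrMsign.
exact: H.
Qed.

Lemma smear_modulus (X : normedModType R) (u : tempered_distribution X) psi :
  exists C M, 0 <= C /\ forall y (a : R * R) (e : R), 0 <= e <= 1 ->
  `|y.1 - a.1| <= e * wt y -> `|y.2 - a.2| <= e * wt y ->
  `|smear u psi y - smear u psi a| <= e * (C * wt y ^+ M).
Proof.
have [N [C0 hu]] := td_continuous u.
have [C [C1 hC]] := reflect_modulus psi N.
exists (`|C0| * (seminorm_terms R N * C)), (4 * N).+1; split.
  by rewrite !mulr_ge0 ?seminorm_terms_ge0.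
move=> y a e e01 h1 h2; rewrite /smear -raddfB.
apply: (le_trans (hu _)); have [_ h] := hC y a e e01 h1 h2.
apply: (@le_trans _ _ (`|C0| * schwartz_seminorm N (schwartz_reflect psi y - schwartz_reflect psi a))).
  by rewrite ler_wpM2r ?seminorm_ge0// ler_norm.
rewrite [X in _ <= X](_ : _ = `|C0| * (e * (seminorm_terms R N * C * wt y ^+ (4 * N).+1))); last by ring.
by rewrite ler_wpM2l.
Qed.

(** The modulus with a = 0 and e = 1: both coordinates of y are bounded by [wt y], so a single
    comparison reaches the origin. *)
Lemma smear_growth (X : normedModType R) (u : tempered_distribution X) psi :
  exists C M, 0 <= C /\ forall y, `|smear u psi y| <= C * wt y ^+ M.
Proof.
have [C [M [C0 hC]]] := smear_modulus u psi.
exists (`|smear u psi 0| + C), M; split=> [|y]; first by rewrite addr_ge0.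
have le_wt (t : R) : 1 + t ^+ 2 <= wt y -> `|t - 0| <= 1 * wt y.
  rewrite subr0 mul1r; apply: le_trans.
  have -> : t ^+ 2 = `|t| ^+ 2 by rewrite real_normK ?num_real.
  by have := sqr_ge0 (`|t| - 1); have := normr_ge0 t; nra.
have [w1 w2] := onesqr_le_wt y.
have := hC y 0 1; rewrite ler01 lexx => /(_ isT (le_wt _ w1) (le_wt _ w2)).
rewrite mul1r => h; have := ler_normD (smear u psi y - smear u psi 0) (smear u psi 0).
rewrite subrK => /le_trans; apply.
have wM : 1 <= wt y ^+ M by rewrite exprn_ege1 ?wt_ge1.
by rewrite mulrDl addrC lerD// ler_peMr.
Qed.

Lemma smear_continuous (X : normedModType R) (u : tempered_distribution X) psi :
  continuous (smear u psi).
Proof.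
move=> y; apply/cvgrPdist_le => e e0.
have [C [M [C0 hC]]] := smear_modulus u psi.
have wy := wt_gt0 y.
pose c := C * wt y ^+ M + 1.
have c0 : 0 < c by rewrite ltr_wpDl// mulr_ge0 ?exprn_ge0 ?(ltW wy).
pose d := Num.min 1 (e / c).
have d0 : 0 < d by rewrite lt_min ltr01 divr_gt0.
have d1 : d <= 1 by rewrite ge_min lexx.
apply: filterS (nbhsx_ballx y _ d0) => a [h1 h2].
rewrite /ball /= in h1 h2.
have dw t : `|t| < d -> `|t : R| <= d * wt y.
  by move=> /ltW/le_trans; apply; rewrite ler_peMr ?wt_ge1// ltW.
apply: (le_trans (hC y a d _ (dw _ h1) (dw _ h2))); first by rewrite ltW.
apply: (@le_trans _ _ (d * c)); first by rewrite ler_wpM2l ?(ltW d0)// lerDl.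
by rewrite -ler_pdivlMr// ge_min lexx orbT.
Qed.

Lemma wt_exp_pmeas M : pmeas (fun x : R * R => wt x ^+ M).
Proof.
have c1 : continuous (fun t : R => 1 + t ^+ 2).
  by move=> t; apply: cvgD; [exact: cvg_cst|exact: exprn_continuous].
apply: (@measurable_funX _ _ _ _ (fun x : mT * mT => wt x)).
under eq_fun do rewrite wtE.
by apply: pmeasM; [exact: pmeas_fst c1|exact: pmeas_snd c1].
Qed.

(** Error of a Riemann sum whose mesh grows with y: the cell functions have values 0 and 1 and sum
    1, so the error at y is that of its own cell, and the growth wt y ^ M is integrable against
    k. *)
Lemma grid_approx k g (J : finType) (a : J -> R * R) (c : J -> R * R -> R) (e D C : R) M M' :
  rapid k -> pmeas g -> (forall y, `|g y| <= C * wt y ^+ M') ->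
  (forall j, pmeas (c j)) -> (forall y, \sum_j c j y = 1) ->
  (forall j y, c j y = 0 \/ c j y = 1) ->
  (forall j y, c j y != 0 -> `|g y - g (a j)| <= e * (D * wt y ^+ M)) ->
  `|pint (fun y => k y * g y) - \sum_j pint (fun y => k y * c j y) * g (a j)| <=
  e * (D * pint (fun y => `|k y| * wt y ^+ M)).
Proof.
move=> rk mg hg mc c1 c01 ca; have dk := rapid_decaying rk.
have dkg : decaying (fun y => k y * g y) by apply: rapid_decaying; exact: rapidM hg.
have dkc j : decaying (fun y => k y * c j y).
  apply: (decaying_boundedM (C := 1)) => // y.
  by have [->|->] := c01 j y; rewrite ?normr0 ?normr1.
have mwt : pmeas (fun y => wt y ^+ M) := wt_exp_pmeas M.
have dkw : decaying (fun y => `|k y| * wt y ^+ M).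
  apply: rapid_decaying; apply: (rapidM (C := 1) (M := M) (rapid_norm rk) mwt) => y.
  by rewrite mul1r ger0_norm// exprn_ge0 ?(ltW (wt_gt0 _)).
have ds : decaying (fun y => \sum_j k y * c j y * g (a j)).
  by apply: decaying_sum => j; apply: decayingZr.
have -> : \sum_j pint (fun y => k y * c j y) * g (a j) =
    pint (fun y => \sum_j k y * c j y * g (a j)).
  rewrite pint_sum; last by move=> j; apply: decayingZr.
  by apply: eq_bigr => j _; rewrite pintZr.
rewrite -pintB// mulrA -pintZ//; apply: norm_pint_le.
- by case: (decayingB dkg ds).
- exact: decayingZ.
move=> y; rewrite -[g y]mul1r -(c1 y) mulr_suml mulr_sumr -sumrB.
apply: (@le_trans _ _ (\sum_j c j y * (`|k y| * (e * (D * wt y ^+ M))))); last first.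
  by rewrite -mulr_suml c1 mul1r le_eqVlt; apply/orP; left; apply/eqP; ring.
apply: (le_trans (ler_norm_sum _ _ _)); apply: ler_sum => j _.
rewrite [X in `|X|](_ : _ = c j y * (k y * (g y - g (a j)))); last by ring.
have [E|E] := eqVneq (c j y) 0; first by rewrite E !mul0r normr0.
have [/eqP|->] := c01 j y; first by rewrite (negbTE E).
by rewrite !mul1r normrM ler_wpM2l// ca.
Qed.

(* The integral is replaced by Riemann sums over finer and finer finite grids, for
   which the identity is linearity of u; the remainder is controlled in the
   Schwartz seminorm for which u is continuous. *)
Lemma td_fubini (u : tempered_distribution R^o) k psi chi : rapid k ->
  (forall z, chi z = pint (fun y => k y * psi (y - z))) ->
  u chi = pint (fun y => k y * smear u psi y).
Proof.
move=> rk hchi; have [N [C0 hu]] := td_continuous u.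
have [C [C1 hC]] := reflect_modulus psi N.
have dk := rapid_decaying rk.
(* Reflecting k presents chi as a correlation, whose derivatives are already known. *)
pose k' y := k (0 - y); have rk' : rapid k' := rapid_reflect 0 rk.
have dk' := rapid_decaying rk'.
pose psi' := schwartz_reflect psi 0.
have dI w z : decaying (fun y => k y * partials w psi (y - z)).
  exact: partials_integrand_decaying psi w (- z) dk.
have chiE : chi = conv_schwartz rk' psi'.
  apply: val_inj; apply/funext => z /=; rewrite hchi /cv -(pint_reflect 0 (dI [::] z)).
  by apply: eq_pint => y; rewrite /k' /= opprD addrA.
have pchi w z : partials w chi z =
    pint (fun y => k y * ((-1) ^+ size w * partials w psi (y - z))).
  have ds : decaying (fun y => k y * ((-1) ^+ size w * partials w psi (y - z))).
    by under eq_fun do rewrite mulrCA; exact: decayingZ.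
  rewrite chiE [LHS](_ : _ = cv k' (partials w psi') z); last first.
    by rewrite -partials_cv.
  rewrite /cv -(pint_reflect 0 ds).
  by apply: eq_pint => y; rewrite partials_reflectE opprD addrA.
pose I := pint (fun y => `|k y| * wt y ^+ (4 * N).+1).
have I0 : 0 <= I.
  by apply: pint_ge0 => y; rewrite mulr_ge0// exprn_ge0// ltW ?wt_gt0.
pose B := seminorm_terms R N * (C * I).
have B0 : 0 <= B by rewrite !mulr_ge0 ?seminorm_terms_ge0.
have key (e : R) : 0 < e -> e <= 1 -> `|u chi - pint (fun y => k y * smear u psi y)| <= e * (`|C0| * B + `|C0| * B).
  move=> e0 e1; have [J [a [c [mc c1 c01 ca]]]] := grid2 e0.
  have e01 : 0 <= e <= 1 by rewrite ltW.
  pose s : schwartz R := \sum_j pint (fun y => k y * c j y) *: schwartz_reflect psi (a j).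
  have us : u s = \sum_j pint (fun y => k y * c j y) * smear u psi (a j).
    by rewrite /s linear_sum; apply: eq_bigr => j _; rewrite linearZ.
  have h1 : `|u chi - u s| <= e * (`|C0| * B).
    rewrite -raddfB; apply: (le_trans (hu _)).
    apply: (@le_trans _ _ (`|C0| * schwartz_seminorm N (chi - s))).
      by rewrite ler_wpM2r ?seminorm_ge0// ler_norm.
    rewrite mulrCA ler_wpM2l// /B mulrCA; apply: seminorm_le => w z wN.
    have [K [K0 hK]] := partials_bound w psi 0.
    rewrite partialsB pchi /s partials_sum.
    under eq_bigr do rewrite partials_reflectE.
    rewrite [X in _ <= X](_ : _ = e * ((C / wt z ^+ N) * I)); last by ring.
    apply: (grid_approx (C := K) (M' := 0) rk _ _ mc c1 c01).
    - apply: pmeasM; first exact: cst_pmeas.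
      exact: pmeas_shift (partials_pmeas w psi).
    - by move=> y; rewrite normrMsign expr0 mulr1 (le_trans (hK _))// expr0 divr1.
    move=> j y cj; rewrite -mulrBr normrMsign; have [ca1 ca2] := ca j y cj.
    have [H _] := hC y (a j) e e01 ca1 ca2.
    by rewrite (le_trans (H w z wN))// le_eqVlt; apply/orP; left; apply/eqP; ring.
  have h2 : `|pint (fun y => k y * smear u psi y) - u s| <= e * (`|C0| * B).
    rewrite us [X in _ <= X](_ : _ = e * ((`|C0| * (seminorm_terms R N * C)) * I)); last by rewrite /B; ring.
    have [K [M [K0 hK]]] := smear_growth u psi.
    apply: (grid_approx (C := K) (M' := M) rk _ hK mc c1 c01).
      by apply: continuous_pmeas; exact: smear_continuous.
    move=> j y cj; have [ca1 ca2] := ca j y cj.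
    have [_ H] := hC y (a j) e e01 ca1 ca2.
    rewrite /smear -raddfB; apply: (le_trans (hu _)).
    apply: (@le_trans _ _ (`|C0| * schwartz_seminorm N (schwartz_reflect psi y - schwartz_reflect psi (a j)))).
      by rewrite ler_wpM2r ?seminorm_ge0// ler_norm.
    rewrite [X in _ <= X](_ : _ = `|C0| * (e * (seminorm_terms R N * C * wt y ^+ (4 * N).+1))); last by ring.
    by rewrite ler_wpM2l.
  rewrite (le_trans (ler_distD (u s) _ _))// mulrDr lerD//.
  by rewrite distrC.
apply/eqP; rewrite -subr_eq0 -normr_eq0 eq_le normr_ge0 andbT.
apply/ler_addgt0Pr => e e0; rewrite add0r.
pose D := `|C0| * B + `|C0| * B + 1.
have CB : 0 <= `|C0| * B := mulr_ge0 (normr_ge0 _) B0.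
have D0 : 0 < D by rewrite ltr_wpDl// addr_ge0.
pose d := Num.min 1 (e / D).
have d0 : 0 < d by rewrite lt_min ltr01 divr_gt0.
have d1 : d <= 1 by rewrite ge_min lexx.
apply: (le_trans (key d d0 d1)).
apply: (@le_trans _ _ (d * D)); first by rewrite ler_wpM2l ?(ltW d0)// lerDl.
by rewrite -ler_pdivlMr// ge_min lexx orbT.
Qed.

End Distributions.

(** * The kernel of the anisotropic semigroup *)

Lemma powR_fourthK (R : realType) (t : R) : 0 <= t -> (t `^ 4^-1) ^+ 4 = t.
Proof. by move=> t0; rewrite -powR_mulrn ?powR_ge0// -powRrM mulVf// powRr1. Qed.

Section SemigroupKernel.
Variable R : realType.
Local Notation mT := (measurableTypeR R).
Variables (psi : R -> schwartz R) (psiP : semigroup_kernel psi).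
Implicit Types (f g h k : R * R -> R) (x y z l : R * R) (phi : schwartz R) (w : seq bool) (s t : R).

Definition symbol t (k : R * R) : R := expR (- (t * (k.1 ^+ 4 + k.2 ^+ 2))).

(** The symbol is real, so the sine integral vanishes and the addition formula leaves the cosine
    part alone. *)
Lemma kernel_wave t (k : R * R) (a : R) : 0 < t ->
  pint (fun x => psi t x * cos (dotp k x - a)) = symbol t k * cos a.
Proof.
move=> t0; have [c1 s1] := psiP t0 k.
have dpsi := rapid_decaying (schwartz_rapid (psi t)).
have dc : decaying (fun x => psi t x * cos (dotp k x)).
  by move: (decaying_wave k 0 dpsi); under eq_fun do rewrite subr0.
have ds : decaying (fun x => psi t x * sin (dotp k x)).
  move: (decaying_wave k (pi / 2) dpsi).
  by under eq_fun do rewrite cosBpihalf.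
have C1 : pint (fun x => psi t x * cos (dotp k x)) = symbol t k := c1.
have S1 : pint (fun x => psi t x * sin (dotp k x)) = 0.
  by apply/eqP; rewrite -oppr_eq0; apply/eqP; exact: s1.
transitivity (pint (fun x => psi t x * cos (dotp k x) * cos a + psi t x * sin (dotp k x) * sin a)).
  by apply: eq_pint => z; rewrite cosB mulrDr !mulrA.
by rewrite pintD ?pintZr ?C1 ?S1 ?mul0r ?addr0//; exact: decayingZr.
Qed.

(** The difference is wave-free, hence zero. The semigroup law, the scaling and the evenness of psi
    all pass through this criterion. *)
Lemma kernel_unique t f : 0 < t -> continuous f -> decaying f ->
  (forall (k : R * R) (a : R), pint (fun x => f x * cos (dotp k x - a)) = symbol t k * cos a) ->
  forall x, f x = psi t x.
Proof.
move=> t0 cf df hf x; apply/eqP; rewrite -subr_eq0; apply/eqP.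
have dpsi := rapid_decaying (schwartz_rapid (psi t)).
apply: (@wave_free_eq0 _ (fun x => f x - psi t x)).
- move=> z; apply: cvgB; first exact: cf.
  by have [spsi _] := schwartzP (psi t); exact: (spsi [::]).1.
- exact: decayingB.
move=> k a; transitivity (pint (fun x => f x * cos (dotp k x - a)) -
    pint (fun x => psi t x * cos (dotp k x - a))).
  by rewrite -pintB; try exact: decaying_wave; apply: eq_pint => z; rewrite mulrBl.
by rewrite hf kernel_wave// subrr.
Qed.

Lemma measurable_diff2 :
  measurable_fun setT ((fun u => u.1 - u.2) : (mT * mT) * (mT * mT) -> mT * mT).
Proof.
rewrite (_ : (fun _ => _) = (fun u : (R * R) * (R * R) => (u.1.1 - u.2.1, u.1.2 - u.2.2))); last first.
  by apply/funext => -[[? ?] [? ?]].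
have m1 : measurable_fun setT (fst : (mT * mT) * (mT * mT) -> mT * mT) := measurable_fst.
have m2 : measurable_fun setT (snd : (mT * mT) * (mT * mT) -> mT * mT) := measurable_snd.
have f1 : measurable_fun setT (fst : mT * mT -> mT) := measurable_fst.
have f2 : measurable_fun setT (snd : mT * mT -> mT) := measurable_snd.
apply: measurable_map2; apply: measurable_funB.
- exact: (measurableT_comp f1 m1).
- exact: (measurableT_comp f1 m2).
- exact: (measurableT_comp f2 m1).
- exact: (measurableT_comp f2 m2).
Qed.

Lemma pmeas2_fst f : pmeas f -> pmeas2 (fun x y => f x).
Proof. by move=> mf; apply: (measurableT_comp mf); exact: measurable_fst. Qed.

Lemma pmeas2_snd f : pmeas f -> pmeas2 (fun x y => f y).
Proof. by move=> mf; apply: (measurableT_comp mf); exact: measurable_snd. Qed.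

Lemma pmeas2_diff f : pmeas f -> pmeas2 (fun x y => f (x - y)).
Proof. by move=> mf; apply: (measurableT_comp mf); exact: measurable_diff2. Qed.

Lemma pmeas2M (h1 h2 : R * R -> R * R -> R) : pmeas2 h1 -> pmeas2 h2 ->
  pmeas2 (fun x y => h1 x y * h2 x y).
Proof. by move=> m1 m2; apply: measurable_funM. Qed.

Section FubiniProduct.
Variables (f g h : R * R -> R) (B : R).
Hypotheses (df : decaying f) (dg : decaying g) (mh : pmeas h).
Hypothesis hB : forall y, `|h y| <= B.

Let H x y := f x * g (x - y) * h y.

Let mH : pmeas2 H.
Proof.
case: df dg => [mf _] [mg _]; apply: pmeas2M; last exact: pmeas2_snd.
by apply: pmeas2M; [exact: pmeas2_fst|exact: pmeas2_diff].
Qed.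

Let HK : exists C, forall x y, `|H x y| <= C / (wt x * wt (x - y)).
Proof.
case: df dg => [_ [K hK]] [_ [L hL]]; exists (K * L * B) => x y.
rewrite /H !normrM [X in _ <= X](_ : _ = (K / wt x) * (L / wt (x - y)) * B); last first.
  by rewrite invfM; ring.
by rewrite ler_pM ?mulr_ge0// ler_pM.
Qed.

Let pintH x : pint (H x) = f x * pint (fun y => g (x - y) * h y).
Proof.
rewrite -pintZ; first by apply: eq_pint => y; rewrite /H mulrA.
under eq_fun do rewrite mulrC.
by apply: (decayingM mh); [exists B|exact: decaying_reflect].
Qed.

Lemma decaying_fubini_product : decaying (fun x => f x * pint (fun y => g (x - y) * h y)).
Proof.
have [C hC] := HK; under eq_fun do rewrite -pintH.
exact: (fubini_decaying_pint mH hC).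
Qed.

Lemma fubini_product :
  pint (fun x => f x * pint (fun y => g (x - y) * h y)) =
  pint (fun y => pint (fun x => f x * g (x - y)) * h y).
Proof.
have [C hC] := HK; case: (dg) => [mg [L hL]].
have L0 : 0 <= L by have := le_trans (normr_ge0 _) (hL 0); rewrite pmulr_lge0// invr_gt0 wt_gt0.
transitivity (pint (fun x => pint (H x))); first by apply: eq_pint => x; rewrite pintH.
rewrite (pint_fubini mH hC); apply: eq_pint => y.
rewrite -pintZr//; apply: (decaying_boundedM (C := L)) => //.
  exact: (pmeas_shift (- y) mg).
by move=> x; apply: (le_trans (hL _)); rewrite ler_pdivrMr ?wt_gt0// ler_peMr ?wt_ge1.
Qed.

End FubiniProduct.

(** Translating a wave only changes its phase, so by Fubini the symbols multiply. Built as a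
    [conv_schwartz], the candidate is continuous and decaying at once. *)
Lemma kernel_semigroup s t z : 0 < s -> 0 < t ->
  psi (s + t) z = pint (fun y => psi s y * psi t (z - y)).
Proof.
move=> s0 t0.
have rs := schwartz_rapid (psi s); have rt := schwartz_rapid (psi t).
have ds := rapid_decaying rs; have dt := rapid_decaying rt.
pose g := conv_schwartz (rapid_reflect 0 rs) (psi t).
have gE x : g x = pint (fun y => psi t (x - y) * psi s y).
  rewrite /g /= /cv -(pint_reflect 0); last first.
    by rewrite -[X in decaying X]/(fun y => _ ) ; exact: (partials_integrand_decaying (psi t) [::] x (decaying_reflect 0 ds)).
  by apply: eq_pint => y; rewrite subKr sub0r addrC mulrC.
rewrite (_ : pint _ = g z); last by rewrite gE; apply: eq_pint => y; rewrite mulrC.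
symmetry; apply: kernel_unique.
- exact: addr_gt0.
- by have [sg _] := schwartzP g; exact: (sg [::]).1.
- exact: rapid_decaying (schwartz_rapid g).
move=> k a.
pose h x := cos (dotp k x - a).
have h1 x : `|h x| <= 1 := cos_max _.
have drt : decaying (fun x => psi t (0 - x)) := decaying_reflect 0 dt.
transitivity (pint (fun x => pint (fun y => psi s y * psi t (0 - (y - x))) * h x)).
  apply: eq_pint => x; rewrite gE; congr (_ * _); apply: eq_pint => y.
  by rewrite mulrC sub0r opprB.
rewrite -(fubini_product ds drt (pmeas_wave k a) h1).
transitivity (pint (fun y => psi s y * cos (dotp k y - a) * symbol t k)); last first.
  by rewrite pintZr; [rewrite kernel_wave// mulrAC /symbol -expRD; congr (expR _ * _); ring|exact: decaying_wave].
apply: eq_pint => y; rewrite -mulrA; congr (_ * _).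
have dF : decaying (fun x => psi t (0 - (y - x)) * h x).
  under eq_fun do rewrite mulrC.
  by apply: (decayingM (pmeas_wave k a)); [exists 1|exact: (decaying_reflect y drt)].
rewrite -(pint_shift y dF) mulrC -cosN opprB -(kernel_wave _ _ t0).
apply: eq_pint => x; congr (_ * cos _).
  by congr (psi t _); rewrite sub0r opprB addrAC subrr add0r.
by rewrite /dotp /=; ring.
Qed.

(** The two equations say that the symbol at time s and frequency (k.1 / l.1, k.2 / l.2) is the
    symbol at time t and frequency k. Negative entries of l are allowed, so reflections are covered
    along with dilations. *)
Lemma kernel_dilate s t l x : 0 < s -> 0 < t -> l.1 != 0 -> l.2 != 0 ->
  s = t * l.1 ^+ 4 -> s = t * l.2 ^+ 2 ->
  psi t x = `|l.1 * l.2| * psi s (l.1 * x.1, l.2 * x.2).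
Proof.
move=> s0 t0 l1 l2 E1 E2.
have ds := rapid_decaying (schwartz_rapid (psi s)).
have l12 : `|l.1 * l.2| != 0 by rewrite normr_eq0 mulf_neq0.
have aE y : affine 0 l y = (l.1 * y.1, l.2 * y.2) by rewrite /affine /= !add0r.
symmetry.
apply: (kernel_unique (f := fun x => `|l.1 * l.2| * psi s (l.1 * x.1, l.2 * x.2))) => //.
- move=> y; apply: cvgMl_tmp.
  apply: (@cvg_comp _ _ _ (fun y : R * R => (l.1 * y.1, l.2 * y.2)) (psi s)).
    have c1 : (fun z : R * R => l.1 * z.1) @ y --> l.1 * y.1.
      by apply: cvgM; [exact: cvg_cst|exact: cvg_fst].
    have c2 : (fun z : R * R => l.2 * z.2) @ y --> l.2 * y.2.
      by apply: cvgM; [exact: cvg_cst|exact: cvg_snd].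
    exact: (cvg_pair c1 c2).
  by have [spsi _] := schwartzP (psi s); exact: (spsi [::]).1.
- apply: decayingZ; under eq_fun do rewrite -aE.
  exact: decaying_affine.
move=> k a; pose k' := (k.1 / l.1, k.2 / l.2).
pose F y := psi s y * cos (dotp k' y - a).
have dF : decaying F by exact: decaying_wave.
transitivity (`|l.1 * l.2| * pint (fun y => F (affine 0 l y))).
  rewrite -pintZ; last exact: decaying_affine.
  apply: eq_pint => y; rewrite /F aE mulrA; congr (_ * cos (_ - _)).
  by rewrite /dotp /=; field; apply/andP.
rewrite pint_affine//; last exact: decaying_affine.
rewrite mulVKf// kernel_wave// /symbol; congr (expR (- _) * _).
rewrite [LHS]mulrDr [RHS]mulrDr /=; congr (_ + _).
  by rewrite E1; field.
by rewrite E2; field.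
Qed.

Lemma kernel_even1 t x : 0 < t -> psi t (- x.1, x.2) = psi t x.
Proof.
move=> t0; have n1 : -1 != 0 :> R by rewrite oppr_eq0 oner_eq0.
rewrite [RHS](kernel_dilate (s := t) (l := (-1, 1))) ?oner_eq0//=.
- by rewrite mulr1 normrN normr1 !mul1r mulN1r.
- by rewrite -signr_odd /= expr0 mulr1.
- by rewrite expr1n mulr1.
Qed.

Lemma kernel_even2 t x : 0 < t -> psi t (x.1, - x.2) = psi t x.
Proof.
move=> t0; have n1 : -1 != 0 :> R by rewrite oppr_eq0 oner_eq0.
rewrite [RHS](kernel_dilate (s := t) (l := (1, -1))) ?oner_eq0//=.
- by rewrite mul1r normrN normr1 !mul1r mulN1r.
- by rewrite expr1n mulr1.
- by rewrite -signr_odd /= expr0 mulr1.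
Qed.

(** The time r ^ 4 belongs to the parabolic dilation (r, r ^ 2), whose Jacobian is r ^ 3. *)
Lemma kernel_scaling (r : R) x : 0 < r ->
  psi (r ^+ 4) x = r^-1 ^+ 3 * psi 1 (r^-1 * x.1, r^-1 ^+ 2 * x.2).
Proof.
move=> r0; have r0' : r != 0 by rewrite gt_eqF.
rewrite (kernel_dilate (s := 1) (l := (r^-1, r^-1 ^+ 2))) ?exprn_gt0//=.
- by rewrite -exprS ger0_norm// exprn_ge0// invr_ge0 ltW.
- by rewrite invr_eq0.
- by rewrite expf_neq0// invr_eq0.
- by rewrite exprVn divff// expf_neq0.
- by rewrite -exprM exprVn divff// expf_neq0.
Qed.

(** * Moments of the kernel *)

Lemma kernel_mass t : 0 < t -> pint (psi t) = 1.
Proof.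
move=> t0; have := kernel_wave 0 0 t0.
rewrite cos0 mulr1 /symbol /= !expr0n /= addr0 mulr0 oppr0 expR0 => <-.
by apply: eq_pint => x; rewrite /dotp /= !(mul0r, addr0) cos0 mulr1.
Qed.

Lemma pint_antisymmetric g l : decaying g -> `|l.1 * l.2| = 1 ->
  (forall x, g (affine 0 l x) = - g x) -> pint g = 0.
Proof.
move=> dg l12 gN.
have [l1 l2] : l.1 != 0 /\ l.2 != 0.
  by apply/andP; rewrite -negb_or -mulf_eq0 -normr_eq0 l12 oner_eq0.
have : pint (fun x => g (affine 0 l x)) = pint g.
  by rewrite pint_affine ?l12 ?invr1 ?mul1r//; exact: decaying_affine.
rewrite (eq_pint gN) (_ : pint (fun x => - g x) = - pint g); first by lra.
by rewrite -mulN1r -pintZ//; apply: eq_pint => x; rewrite mulN1r.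
Qed.

Lemma decaying_poly k g (C : R) M : rapid k -> pmeas g ->
  (forall x, `|g x| <= C * wt x ^+ M) -> decaying (fun x => k x * g x).
Proof. by move=> rk mg hg; apply: rapid_decaying; exact: rapidM hg. Qed.

Lemma norm_le_onesqr (a : R) : `|a| <= 1 + a ^+ 2.
Proof.
have -> : a ^+ 2 = `|a| ^+ 2 by rewrite real_normK ?num_real.
by have := sqr_ge0 (`|a| - 1); have := normr_ge0 a; nra.
Qed.

Lemma coord1_exp_le x n : `|x.1 ^+ n| <= 1 * wt x ^+ n.
Proof.
have [w1 _] := onesqr_le_wt x; rewrite mul1r normrX lerXn2r ?nnegrE ?(ltW (wt_gt0 _))//.
exact: le_trans (norm_le_onesqr _) w1.
Qed.

Lemma coord2_exp_le x n : `|x.2 ^+ n| <= 1 * wt x ^+ n.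
Proof.
have [_ w2] := onesqr_le_wt x; rewrite mul1r normrX lerXn2r ?nnegrE ?(ltW (wt_gt0 _))//.
exact: le_trans (norm_le_onesqr _) w2.
Qed.

Lemma pmeas_coord1 n : pmeas (fun x : R * R => x.1 ^+ n).
Proof. by apply: (pmeas_fst (h := fun s => s ^+ n)); exact: exprn_continuous. Qed.

Lemma pmeas_coord2 n : pmeas (fun x : R * R => x.2 ^+ n).
Proof. by apply: (pmeas_snd (h := fun s => s ^+ n)); exact: exprn_continuous. Qed.

(* The symbol has no second order term in k.1, hence the vanishing second moment. *)
Lemma kernel_moment1 t n : 0 < t -> (0 < n < 4)%N -> pint (fun x => psi t x * x.1 ^+ n) = 0.
Proof.
move=> t0 n4; have rt := schwartz_rapid (psi t).
have dn m : decaying (fun x => psi t x * x.1 ^+ m).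
  exact: (decaying_poly rt (pmeas_coord1 m) (coord1_exp_le ^~ m)).
have odd_case m : odd m -> pint (fun x => psi t x * x.1 ^+ m) = 0.
  move=> om; apply: (@pint_antisymmetric _ (-1, 1)) => //=.
    by rewrite mulr1 normrN normr1.
  move=> x; rewrite /affine /= !add0r mul1r mulN1r.
  by rewrite (kernel_even1 x t0) exprNn -signr_odd om expr1 mulN1r mulrN.
case: n n4 => [|[|[|[|]]]]// _; [exact: odd_case| |exact: odd_case].
pose m2 := pint (fun x => psi t x * x.1 ^+ 2).
pose m4 := pint (fun x => `|psi t x| * x.1 ^+ 4).
have d4 : decaying (fun x => `|psi t x| * x.1 ^+ 4).
  exact: (decaying_poly (rapid_norm rt) (pmeas_coord1 4) (coord1_exp_le ^~ 4)).
have dpsi := rapid_decaying rt.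
(* At frequency (k, 0) the expansion of the cosine gives 1 - k ^ 2 * m2 / 2 up to k ^ 4 * m4, while
   the symbol is 1 up to t * k ^ 4; dividing by k ^ 2 / 2 leaves a bound of order k ^ 2 for m2. *)
have key (k : R) : 0 < k -> `|m2| <= 2 * (m4 + t) * k ^+ 2.
  move=> k0.
  have dw : decaying (fun x => psi t x * cos (dotp (k, 0) x - 0)) := decaying_wave _ _ dpsi.
  have E0 := kernel_wave (k, 0) 0 t0.
  rewrite cos0 mulr1 in E0.
  have d2 := dn 2%N; have d2k := decayingZ (k ^+ 2 / 2) d2.
  have dd := decayingB dpsi d2k.
  have h : `|pint (fun x => psi t x * cos (dotp (k, 0) x - 0)) -
      (pint (psi t) - pint (fun x => k ^+ 2 / 2 * (psi t x * x.1 ^+ 2)))| <=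
      pint (fun x => k ^+ 4 * (`|psi t x| * x.1 ^+ 4)).
    rewrite -(pintB dpsi d2k) -(pintB dw dd); apply: norm_pint_le.
    - by case: (decayingB dw dd).
    - exact: decayingZ.
    move=> x; rewrite [X in `|X|](_ : _ = psi t x * (cos (k * x.1) - (1 - (k * x.1) ^+ 2 / 2))); last first.
      by rewrite /dotp /= mul0r addr0 subr0; ring.
    by rewrite normrM mulrCA ler_wpM2l// (le_trans (cos_taylor _))// exprMn.
  rewrite E0 (kernel_mass t0) (pintZ _ d2) (pintZ _ d4) -/m2 -/m4 in h.
  have e1 : symbol t (k, 0) <= 1.
    by rewrite /symbol -expR0 ler_expR lerNl oppr0 /= expr0n addr0 mulr_ge0 ?exprn_ge0 ?ltW.
  have e2 : 1 - t * k ^+ 4 <= symbol t (k, 0).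
    apply: le_trans (expR_ge1Dx _); rewrite /= expr0n addr0; lra.
  rewrite -(ler_pM2l (x := k ^+ 2 / 2)) ?divr_gt0 ?exprn_gt0//.
  have k2 : 0 <= k ^+ 2 / 2 by rewrite divr_ge0 ?sqr_ge0.
  rewrite -{1}(ger0_norm k2) -normrM.
  have -> : k ^+ 2 / 2 * (2 * (m4 + t) * k ^+ 2) = k ^+ 4 * m4 + t * k ^+ 4 by field.
  move: h; rewrite !ler_norml => /andP[? ?]; apply/andP; split; lra.
apply/eqP; rewrite -normr_eq0 eq_le normr_ge0 andbT -/m2.
have m40 : 0 <= m4 by apply: pint_ge0 => x; rewrite mulr_ge0// exprn_even_ge0.
apply/ler_addgt0Pr => e e0; rewrite add0r.
pose c := 2 * (m4 + t); have c0 : 0 < c by rewrite mulr_gt0// ltr_wpDl.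
(* For this k the bound equals e. *)
have := key (Num.sqrt (e / c)); rewrite sqrtr_gt0 divr_gt0// => /(_ isT).
by rewrite sqr_sqrtr ?(ltW (divr_gt0 _ _))// -/c mulrCA divff ?mulr1// gt_eqF.
Qed.

(** The parabolic substitution cancels the prefactor in [kernel_scaling]; the homogeneity of h turns
    into the factor c, so moments at scale r reduce to moments at scale 1. *)
Lemma kernel_dilate_bound (r : R) h g (c : R) : 0 < r ->
  decaying (fun x => psi (r ^+ 4) x * h x) -> decaying (fun x => `|psi 1 x| * g x) ->
  (forall x, `|h (affine 0 (r, r ^+ 2) x)| <= c * g x) ->
  pint (fun x => `|psi (r ^+ 4) x * h x|) <= c * pint (fun x => `|psi 1 x| * g x).
Proof.
move=> r0 dh dg hg; have r0' : r != 0 by rewrite gt_eqF.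
pose F x := `|psi (r ^+ 4) x * h x|.
have dF : decaying F := decaying_norm dh.
have dF' : decaying (fun x => F (affine 0 (r, r ^+ 2) x)).
  by apply: decaying_affine => //=; rewrite expf_neq0.
have := @pint_affine _ 0 (r, r ^+ 2) F r0' (expf_neq0 2 r0') dF dF'.
rewrite /= -exprS ger0_norm ?exprn_ge0 ?(ltW r0)// => E.
have r3 : r ^+ 3 != 0 by rewrite expf_neq0.
have -> : pint F = pint (fun x => r ^+ 3 * F (affine 0 (r, r ^+ 2) x)).
  by rewrite pintZ// E mulVKf.
rewrite -pintZ//; apply: le_pint; [exact: decayingZ|exact: decayingZ|move=> x].
have hx := hg x; rewrite /affine /= !add0r in hx.
rewrite /F kernel_scaling// /affine /= !add0r !exprVn !mulKf ?expf_neq0//.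
rewrite -surjective_pairing !normrM ger0_norm ?invr_ge0 ?exprn_ge0 ?(ltW r0)//.
by rewrite -mulrA mulVKf// mulrCA ler_wpM2l.
Qed.

(** [dist x y] is [hdist (x - y)]; as a function of one point it is homogeneous of degree 1 under
    parabolic dilations. *)
Definition hdist x : R := `|x.1| + Num.sqrt `|x.2|.

Lemma hdist_ge0 x : 0 <= hdist x.
Proof. by rewrite addr_ge0 ?sqrtr_ge0. Qed.

Lemma hdist_dilate (r : R) x : 0 < r -> hdist (affine 0 (r, r ^+ 2) x) = r * hdist x.
Proof.
move=> r0; rewrite /hdist /affine /= !add0r (normrM r) (normrM (r ^+ 2)) (gtr0_norm r0) mulrDr.
by rewrite normrX sqrtrM ?sqr_ge0// sqrtr_sqr normr_id (gtr0_norm r0).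
Qed.

Lemma hdist_le x : hdist x <= 2 * wt x.
Proof.
have [w1 w2] := onesqr_le_wt x.
have h1 := le_trans (norm_le_onesqr x.1) w1; have h2 := le_trans (norm_le_onesqr x.2) w2.
have : Num.sqrt `|x.2| <= wt x.
  rewrite -[leRHS](ger0_norm (ltW (wt_gt0 x))) -(sqrtr_sqr (wt x)) ler_sqrt ?sqr_ge0//.
  by have := wt_ge1 x; nra.
by rewrite /hdist; lra.
Qed.

Lemma pmeas_hdist : pmeas hdist.
Proof.
apply: pmeasD; first exact: (pmeas_fst (h := fun s => `|s|) (@norm_continuous _ _)).
apply: (pmeas_snd (h := fun s => Num.sqrt `|s|)) => s.
apply: (@continuous_comp _ _ _ (fun s : R => `|s|) Num.sqrt); first exact: norm_continuous.
exact: sqrt_continuous.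
Qed.

(** Bounds, uniformly in the scale, the integral of the kernel against the growth factor 1 + (d / r)
    ^ n that chaining leaves behind. *)
Definition kernel_moment n : R := pint (fun x => `|psi 1 x| * (1 + hdist x ^+ n)).

Lemma hdist_poly (c : R) n : 0 <= c -> exists C M,
  forall x, `|1 + (c * hdist x) ^+ n| <= C * wt x ^+ M.
Proof.
move=> c0; exists (1 + (c * 2) ^+ n), n => x.
have w1 : 1 <= wt x ^+ n by rewrite exprn_ege1 ?wt_ge1.
rewrite ger0_norm ?addr_ge0 ?exprn_ge0 ?mulr_ge0 ?hdist_ge0// mulrDl mul1r lerD//.
rewrite -exprMn lerXn2r ?nnegrE ?mulr_ge0 ?hdist_ge0 ?(ltW (wt_gt0 _))//.
by rewrite -mulrA ler_wpM2l ?hdist_le.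
Qed.

Lemma pmeas_hdist_poly (c : R) n : pmeas (fun x => 1 + (c * hdist x) ^+ n).
Proof.
apply: pmeasD; first exact: cst_pmeas.
apply: (@measurable_funX _ _ _ _ (fun x : mT * mT => c * hdist x)).
by apply: pmeasM; [exact: cst_pmeas|exact: pmeas_hdist].
Qed.

Lemma kernel_moment_decaying k (c : R) n : 0 <= c -> rapid k ->
  decaying (fun x => k x * (1 + (c * hdist x) ^+ n)).
Proof.
move=> c0 rk; have [C [M h]] := hdist_poly n c0.
exact: (decaying_poly rk (pmeas_hdist_poly c n) h).
Qed.

Lemma kernel_moment_bound (r : R) n : 0 < r ->
  pint (fun x => `|psi (r ^+ 4) x| * (1 + (r^-1 * hdist x) ^+ n)) <= kernel_moment n.
Proof.
move=> r0; have r0' : r != 0 by rewrite gt_eqF.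
have ri : 0 <= r^-1 by rewrite invr_ge0 ltW.
rewrite (_ : pint _ = pint (fun x => `|psi (r ^+ 4) x * (1 + (r^-1 * hdist x) ^+ n)|)); last first.
  apply: eq_pint => x; rewrite normrM; congr (_ * _).
  by rewrite ger0_norm// addr_ge0 ?exprn_ge0 ?mulr_ge0 ?hdist_ge0.
rewrite -[leRHS]mul1r; apply: kernel_dilate_bound => //.
- exact: kernel_moment_decaying (schwartz_rapid _).
- have := kernel_moment_decaying n ler01 (rapid_norm (schwartz_rapid (psi 1))).
  by under eq_fun do rewrite mul1r.
- move=> x; rewrite hdist_dilate// mulKf// mul1r ger0_norm//.
  by rewrite addr_ge0 ?exprn_ge0 ?hdist_ge0.
Qed.

Definition kernel_norm : R := pint (fun x => `|psi 1 x|).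

Lemma kernel_norm_bound t : 0 < t -> pint (fun x => `|psi t x|) <= kernel_norm.
Proof.
move=> t0; pose r := t `^ 4^-1; have r0 : 0 < r by rewrite powR_gt0.
have -> : t = r ^+ 4 by rewrite /r powR_fourthK// ltW.
have d1 u : decaying (fun x => psi u x * 1).
  by under eq_fun do rewrite mulr1; exact: rapid_decaying (schwartz_rapid _).
rewrite (_ : pint _ = pint (fun x => `|psi (r ^+ 4) x * 1|)); last first.
  by apply: eq_pint => x; rewrite mulr1.
rewrite (_ : kernel_norm = 1 * pint (fun x => `|psi 1 x| * 1)); last first.
  by rewrite mul1r; apply: eq_pint => x; rewrite mulr1.
apply: kernel_dilate_bound => //.
  by under eq_fun do rewrite mulr1; exact: decaying_norm (rapid_decaying (schwartz_rapid _)).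
by move=> x; rewrite normr1 mulr1.
Qed.

Lemma add_axis1 (a b : R) y : y + (a, b) = y + (0, b) + a *: axis R false.
Proof.
rewrite -addrA; congr (_ + _); transitivity ((0 + a * 1, b + a * 0) : R * R) => //.
by rewrite mulr0 mulr1 addr0 add0r.
Qed.

Lemma add_axis2 (a b : R) y : y + (a, b) = y + (a, 0) + b *: axis R true.
Proof.
rewrite -addrA; congr (_ + _); transitivity ((a + b * 0, 0 + b * 1) : R * R) => //.
by rewrite mulr0 mulr1 addr0 add0r.
Qed.

(** The displacement (a, b) ranges over a rectangle determined by x, so one bound covers all
    intermediate points of a Taylor expansion along the axes. *)
Lemma weight_shift_bound g m (L : R) x y (a b : R) :
  0 <= L -> (forall z, `|g z| <= L / wt z ^+ m) -> `|a| <= `|x.1| -> `|b| <= `|x.2| ->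
  `|g (y + (a, b))| <= L * (4 ^+ m * wt x ^+ m / wt y ^+ m).
Proof.
move=> L0 hg a1 b2; apply: (le_trans (hg _)); rewrite ler_wpM2l//.
have := wtV_peetre (a, b) (- y) m; rewrite opprK wtN addrC => /le_trans; apply.
rewrite ler_wpM2r ?invr_ge0 ?exprn_ge0 ?(ltW (wt_gt0 _))// ler_wpM2l ?exprn_ge0//.
rewrite lerXn2r ?nnegrE ?(ltW (wt_gt0 _))// !wtE /=.
have sq (c d : R) : `|c| <= `|d| -> 1 + c ^+ 2 <= 1 + d ^+ 2.
  by move=> cd; rewrite lerD2l -(real_normK (num_real c)) -(real_normK (num_real d)) lerXn2r ?nnegrE.
by apply: ler_pM; rewrite ?(ltW (onesqr_gt0 _))// sq.
Qed.

(* Taylor expansion of order 4 in the first variable and 2 in the second: all the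
   lower moments of the kernel vanish, and the remainder has parabolic order 4. *)
Lemma kernel_approx m : exists C, 0 <= C /\ forall phi w (L : R), 0 <= L ->
  (forall w' x, (size w' <= 4)%N -> `|partials (w' ++ w) phi x| <= L / wt x ^+ m) ->
  forall (r : R), 0 < r <= 1 -> forall y,
  `|cv (psi (r ^+ 4)) (partials w phi) y - partials w phi y| <= C * L * r ^+ 4 / wt y ^+ m.
Proof.
pose h x := wt x ^+ m * (x.2 ^+ 2 + x.1 ^+ 4).
have h0 x : 0 <= h x.
  by rewrite mulr_ge0 ?exprn_ge0 ?(ltW (wt_gt0 _))// addr_ge0 ?sqr_ge0 ?exprn_even_ge0.
have mh : pmeas h.
  apply: pmeasM; first exact: wt_exp_pmeas.
  by apply: pmeasD; [exact: pmeas_coord2|exact: pmeas_coord1].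
have hC x : `|h x| <= 2 * wt x ^+ (m + 4).
  rewrite ger0_norm// /h exprD mulrCA ler_wpM2l ?exprn_ge0 ?(ltW (wt_gt0 _))//.
  have := ler_norm (x.1 ^+ 4); have := ler_norm (x.2 ^+ 2).
  have := coord1_exp_le x 4; have := coord2_exp_le x 2; rewrite !mul1r.
  have : wt x ^+ 2 <= wt x ^+ 4 by rewrite ler_weXn2l ?wt_ge1.
  by lra.
pose C := 4 ^+ m * pint (fun x => `|psi 1 x| * h x).
have C0 : 0 <= C by rewrite mulr_ge0 ?exprn_ge0// pint_ge0// => x; rewrite mulr_ge0.
exists C; split=> // phi w L L0 hL r /andP[r0 r1] y.
set k := psi (r ^+ 4); have rk : rapid k := schwartz_rapid k.
have r40 : 0 < r ^+ 4 by rewrite exprn_gt0.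
have dk := rapid_decaying rk.
have [sphi _] := schwartzP phi.
pose f := partials w phi; pose f2 := partials (true :: w) phi.
pose q (j : nat) : R := partials (nseq j false ++ w) phi y / j`!%:R.
(* The linear term in z.2, taken at (y.1 + z.1, y.2): it is odd in z.2, so it integrates to 0
   against the even kernel. [P] is the cubic Taylor polynomial in z.1, of which only the constant
   term survives. *)
pose T z := z.2 * f2 (affine y (1, 0) z).
pose P z : R := \sum_(j < 4) q j * z.1 ^+ j.
have [K [K0 hK]] := partials_bound (true :: w) phi 0.
have dT : decaying (fun z => k z * T z).
  apply: (decaying_poly (C := K) (M := 1) rk).
    apply: pmeasM; first by have := pmeas_coord2 1; under eq_fun do rewrite expr1.
    exact: pmeas_affine (partials_pmeas _ _).
  move=> z; rewrite normrM mulrC ler_pM//.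
    by rewrite (le_trans (hK _))// expr0 divr1.
  by have := coord2_exp_le z 1; rewrite !expr1 mul1r.
have T0 : pint (fun z => k z * T z) = 0.
  apply: (@pint_antisymmetric _ (1, -1)) => //=; first by rewrite mul1r normrN normr1.
  move=> z; rewrite /T /affine /= !add0r !mul1r !mul0r mulN1r.
  by rewrite (kernel_even2 z r40) mulNr mulrN.
have dP1 j : decaying (fun z => k z * z.1 ^+ j).
  exact: (decaying_poly rk (pmeas_coord1 j) (coord1_exp_le ^~ j)).
have PE z : k z * P z = \sum_(j < 4) q j * (k z * z.1 ^+ j).
  by rewrite mulr_sumr; apply: eq_bigr => j _; rewrite mulrCA.
have dP : decaying (fun z => k z * P z).
  under eq_fun do rewrite PE.
  by apply: decaying_sum => j; exact: decayingZ.
have P0 : pint (fun z => k z * P z) = f y.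
  rewrite (eq_pint PE) pint_sum; last by move=> j; exact: decayingZ.
  rewrite (bigD1 ord0)//= big1 => [|j j0].
    rewrite addr0 pintZ// (_ : pint _ = pint k); last by apply: eq_pint => z; rewrite expr0 mulr1.
    by rewrite kernel_mass// mulr1 /q fact0 divr1.
  by rewrite pintZ// kernel_moment1 ?mulr0// ltn_ord andbT lt0n.
have df := partials_integrand_decaying phi w y dk.
have -> : cv k f y - f y = pint (fun z => k z * f (z + y) - k z * T z - k z * P z).
  by rewrite pintB ?pintB ?T0 ?P0 ?subr0//; exact: decayingB.
pose c := L * 4 ^+ m / wt y ^+ m.
have c0 : 0 <= c by rewrite divr_ge0 ?mulr_ge0 ?exprn_ge0 ?(ltW (wt_gt0 _)).
have dkh : decaying (fun z => k z * h z) := decaying_poly rk mh hC.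
apply: (@le_trans _ _ (pint (fun z => c * `|k z * h z|))).
  apply: norm_pint_le.
  - by case: (decayingB (decayingB df dT) dP).
  - exact: decayingZ (decaying_norm dkh).
  move=> z; rewrite -!mulrBr (normrM (k z)) (normrM (k z)) (ger0_norm (h0 z)).
  rewrite [leRHS]mulrCA ler_wpM2l//.
  pose p := affine y (1, 0) z.
  have pE : p = y + (z.1, 0).
    by rewrite /p /affine /= mul1r mul0r; case: (y).
  (* Two one-dimensional remainders: order 2 along the vertical segment from p to y + z, order 4
     along the horizontal one from y to p. *)
  rewrite [X in `|X|](_ : _ = (f (z + y) - f p - z.2 * f2 p) + (f p - P z)); last by rewrite /T; ring.
  have B w' a b : (size w' <= 4)%N -> `|a| <= `|z.1| -> `|b| <= `|z.2| ->
      `|partials (w' ++ w) phi (y + (a, b))| <= c * wt z ^+ m.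
    move=> w4 az bz; have := weight_shift_bound y L0 (fun x => hL w' x w4) az bz.
    by move=> /le_trans; apply; rewrite le_eqVlt; apply/orP; left; apply/eqP; rewrite /c; ring.
  rewrite /h [leRHS](_ : _ = c * wt z ^+ m * `|z.2| ^+ 2 + c * wt z ^+ m * `|z.1| ^+ 4); last first.
    have a2 : `|z.2| ^+ 2 = z.2 ^+ 2 by rewrite real_normK ?num_real.
    have a4 : `|z.1| ^+ 4 = z.1 ^+ 4 by rewrite -normrX ger0_norm ?exprn_even_ge0.
    by rewrite a2 a4; ring.
  rewrite (le_trans (ler_normD _ _))// lerD//.
    pose F j (s : R) := partials (nseq j true ++ w) phi (p + s *: axis R true).
    have dF j (s : R) : (j < 2)%N -> is_derive s (1 : R) (F j) (F j.+1 s).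
      by move=> _; exact: (smooth_is_derive_line (nseq j true ++ w) true p s sphi).
    have bF s : `|s| <= `|z.2| -> `|F 2%N s| <= c * wt z ^+ m.
      by move=> sz; rewrite /F pE -add_axis2; exact: (B [:: true; true]).
    have F0 : F 0%N z.2 = f (z + y).
      by rewrite /F pE -add_axis2 addrC -surjective_pairing.
    have F00 j : F j 0 = partials (nseq j true ++ w) phi p.
      by rewrite /F scale0r addr0.
    have := taylor_bound dF bF.
    rewrite F0 2!big_ord_recl big_ord0 !F00 expr0 expr1 !divr1 mulr1 addr0.
    by rewrite opprD addrA [_ * z.2]mulrC.
  pose F j (s : R) := partials (nseq j false ++ w) phi (y + s *: axis R false).
  have dF j (s : R) : (j < 4)%N -> is_derive s (1 : R) (F j) (F j.+1 s).
    by move=> _; exact: (smooth_is_derive_line (nseq j false ++ w) false y s sphi).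
  have z0 : (0, 0) = 0 :> R * R by [].
  have bF s : `|s| <= `|z.1| -> `|F 4%N s| <= c * wt z ^+ m.
    move=> sz; have := B [:: false; false; false; false] s 0 isT sz.
    by rewrite normr0 => /(_ (normr_ge0 _)); rewrite add_axis1 z0 addr0.
  have F0 : F 0%N z.1 = f p by rewrite /F pE (add_axis1 z.1 0) z0 addr0.
  have PF : P z = \sum_(j < 4) F j 0 / j`!%:R * z.1 ^+ j.
    by apply: eq_bigr => j _; rewrite /F scale0r addr0.
  by have := taylor_bound dF bF; rewrite F0 -PF.
rewrite pintZ; last exact: decaying_norm dkh.
(* The dilation multiplies x.2 ^ 2 + x.1 ^ 4 by exactly r ^ 4, and it does not increase the weight
   because r <= 1. *)
have := @kernel_dilate_bound r h h (r ^+ 4) r0 dkh.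
have dgh : decaying (fun x => `|psi 1 x| * h x).
  exact: (decaying_poly (rapid_norm (schwartz_rapid (psi 1))) mh hC).
move=> /(_ dgh) H.
rewrite [leRHS](_ : _ = c * (r ^+ 4 * pint (fun x => `|psi 1 x| * h x))); last by rewrite /c /C; ring.
rewrite ler_wpM2l// H// => x; rewrite ger0_norm//.
have wr : wt (affine 0 (r, r ^+ 2) x) <= wt x.
  have sq (s t : R) : 0 <= s <= 1 -> 1 + (0 + s * t) ^+ 2 <= 1 + t ^+ 2.
    move=> /andP[s0 s1]; rewrite lerD2l add0r exprMn ler_piMl ?sqr_ge0//.
    by rewrite exprn_ile1.
  rewrite !wtE /=; apply: ler_pM; rewrite ?(ltW (onesqr_gt0 _))// sq// ?(ltW r0)//.
  by rewrite exprn_ge0 ?exprn_ile1 ?(ltW r0).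
rewrite /h [X in _ * X <= _](_ : _ = r ^+ 4 * (x.2 ^+ 2 + x.1 ^+ 4)); last by rewrite /affine /=; ring.
rewrite [leRHS]mulrCA ler_wpM2r//.
  by rewrite mulr_ge0 ?exprn_ge0 ?(ltW r0)// addr_ge0 ?sqr_ge0 ?exprn_even_ge0.
by rewrite lerXn2r ?nnegrE ?(ltW (wt_gt0 _)).
Qed.

End SemigroupKernel.

(** * Modelled distributions along chains of points *)

Section Chaining.
Variables (R : realType) (A : {fset R}) (T : A -> completeNormedModType R).
Variable Gamma : R * R -> bounded_operator (dsum T) (dsum T).
Variables (alpha : R) (V : R * R -> bounded_operator (dsum T) R^o).
Variables (G : R) (skG : skeleton_const Gamma G).
Variables (M : R) (modM : modelled_const Gamma alpha V M).

Let n := #|{: A}|.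

(** The degree of growth of the component b along a chain; it is at most n - 1, whence the power in
    the final estimate. *)
Definition rank (b : A) : nat := #|[pred g : A | fsval g < fsval b]|.

Lemma rank_lt (g b : A) : fsval g < fsval b -> (rank g < rank b)%N.
Proof.
move=> gb; apply: proper_card; apply/properP; split.
  by apply/fintype.subsetP => h; rewrite !inE => /lt_trans; apply.
by exists g; rewrite !inE ?ltxx.
Qed.

Lemma dist_ge0 (x y : R * R) : 0 <= dist x y.
Proof. by rewrite addr_ge0 ?sqrtr_ge0. Qed.

Lemma powR_le1_01 (d p : R) : 0 <= d <= 1 -> 0 <= p -> d `^ p <= 1.
Proof.
move=> /andP[d0 d1] p0; have -> : 1 = 1 `^ p :> R by rewrite powR1.
by apply: ge0_ler_powR; rewrite ?nnegrE.
Qed.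

Variables (z : nat -> R * R) (N : nat).
Hypothesis dz : forall i, (i < N)%N -> dist (z i.+1) (z i) <= 1.
Variables (v : dsum T) (S : R).
Hypothesis S0 : forall b, `|Gamma (z 0%N) v b| <= S.

Let a i b : R := `|Gamma (z i) v b|.
(** Growth per unit of rank after i steps: the two sums of [chain_sum] run over at most i steps and
    n indices. *)
Let X i : R := (1 + G) * (n%:R * (1 + i%:R)).

Lemma chain_step i b : (i < N)%N ->
  a i.+1 b <= a i b + G * \sum_(g : A | fsval g < fsval b) a i g.
Proof.
move=> iN; have [G0 hG] := skG; have d1 := dz iN.
rewrite -lerBlDl; apply: le_trans (lerB_dist _ _) _.
apply: (le_trans (hG b v (z i) (z i.+1) d1)); rewrite ler_wpM2l//.
apply: ler_sum => g gb; rewrite ler_piMl// powR_le1_01 ?dist_ge0//.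
by rewrite subr_ge0 ltW.
Qed.

Lemma chain_sum i b : (i <= N)%N ->
  a i b <= S + G * \sum_(j < i) \sum_(g : A | fsval g < fsval b) a j g.
Proof.
elim: i => [|i ih] iN; first by rewrite big_ord0 mulr0 addr0 S0.
rewrite big_ord_recr /= mulrDr addrA (le_trans (chain_step b iN))// lerD2r.
exact: ih (ltnW iN).
Qed.

(* Triangularity of the skeleton bound turns the discrete Gronwall inequality into
   polynomial growth, of degree the number of smaller homogeneities. *)
Lemma chain_Gamma i b : (i <= N)%N -> a i b <= S * X i ^+ rank b.
Proof.
have [G0 _] := skG.
have n0 : (0 < n)%N by apply/card_gt0P; exists b.
have S_ge0 : 0 <= S := le_trans (normr_ge0 _) (S0 b).
have X1 j : 1 <= X j.
  rewrite mulr_ege1 ?lerDl// mulr_ege1 ?ler1n// lerDl//.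
have X_mono j l : (j <= l)%N -> X j <= X l.
  by move=> jl; rewrite ler_wpM2l ?addr_ge0// ler_wpM2l// lerD2l ler_nat.
have [k] := ubnP (rank b); elim: k b i => // k ih b i bk iN.
apply: (le_trans (chain_sum b iN)).
have [b0|b_gt0] := posnP (rank b).
  rewrite b0 expr0 mulr1 big1 ?mulr0 ?addr0// => j _; apply: big1 => g gb.
  by move/rank_lt: gb; rewrite b0.
have H (j : 'I_i) : \sum_(g : A | fsval g < fsval b) a j g <= n%:R * (S * X i ^+ (rank b).-1).
  apply: (@le_trans _ _ (\sum_(g : A) S * X i ^+ (rank b).-1)); last first.
    by rewrite sumr_const -[leLHS]mulr_natl.
  rewrite big_mkcond /=; apply: ler_sum => g _; case: ifPn => [gb|_]; last first.
    by rewrite mulr_ge0// exprn_ge0// (le_trans ler01).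
  have gb' := rank_lt gb.
  apply: (le_trans (ih g j (leq_trans gb' _) (leq_trans (ltnW (ltn_ord j)) iN))).
    by rewrite -ltnS.
  rewrite ler_wpM2l//; apply: (@le_trans _ _ (X i ^+ rank g)).
    by rewrite lerXn2r ?nnegrE ?(le_trans ler01 (X1 _))// X_mono// ltnW.
  by rewrite ler_weXn2l// -ltnS prednK.
apply: (@le_trans _ _ (S + G * (i%:R * (n%:R * (S * X i ^+ (rank b).-1))))).
  rewrite lerD2l ler_wpM2l//; apply: (le_trans (ler_sum _ (fun j _ => H j))).
  by rewrite sumr_const card_ord -[leLHS]mulr_natl.
rewrite -{2}(prednK b_gt0) exprS.
set Y := X i ^+ _; have Y1 : 1 <= Y by rewrite exprn_ege1.
have SY : S <= S * Y by rewrite ler_peMr.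
(* S is absorbed into S * Y since Y >= 1; it remains to see that 1 + G * i * n <= X i. *)
apply: (@le_trans _ _ (S * Y * (1 + G * (i%:R * n%:R)))).
  by rewrite mulrDr mulr1 [X in _ <= _ + X](_ : _ = G * (i%:R * (n%:R * (S * Y)))) ?lerD2r//; ring.
rewrite [leRHS](_ : _ = S * Y * X i); last by ring.
rewrite ler_wpM2l ?mulr_ge0 ?(le_trans ler01 Y1)// /X.
have n1 : 1 <= n%:R :> R by rewrite ler1n.
have i0 : 0 <= i%:R :> R by [].
have := mulr_ge0 G0 i0; nra.
Qed.

(** On steps of length at most 1 the powers of the distance are bounded by 1. This gives up
    smallness, but far apart only polynomial growth in N counts. The exponent n - 1 is the largest
    possible rank. *)
Lemma chain_V : `|V (z N) v - V (z 0%N) v| <= N%:R * (M * (n%:R * (S * X N ^+ n.-1))).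
Proof.
have [G0 _] := skG; have [M0 hM] := modM.
have X1 j : (0 < n)%N -> 1 <= X j.
  by move=> n0; rewrite mulr_ege1 ?lerDl// mulr_ege1 ?ler1n// lerDl.
have X_mono j l : (j <= l)%N -> X j <= X l.
  by move=> jl; rewrite ler_wpM2l ?addr_ge0// ler_wpM2l// lerD2l ler_nat.
have step i : (i < N)%N -> `|V (z i.+1) v - V (z i) v| <= M * (n%:R * (S * X N ^+ n.-1)).
  move=> iN; apply: (le_trans (hM v (z i) (z i.+1) (dz iN))); rewrite ler_wpM2l//.
  apply: (@le_trans _ _ (\sum_(b : A) S * X N ^+ n.-1)); last first.
    by rewrite sumr_const -[leLHS]mulr_natl.
  apply: ler_sum => b _.
  have n0 : (0 < n)%N by apply/card_gt0P; exists b.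
  have S_ge0 : 0 <= S := le_trans (normr_ge0 _) (S0 b).
  apply: (@le_trans _ _ (1 * a i b)).
    by rewrite ler_wpM2r// powR_le1_01 ?dist_ge0 ?dz// le_max lexx orbT.
  rewrite mul1r (le_trans (chain_Gamma b (ltnW iN)))// ler_wpM2l//.
  apply: (@le_trans _ _ (X N ^+ rank b)).
    by rewrite lerXn2r ?nnegrE ?(le_trans ler01 (X1 _ _))// X_mono// ltnW.
  rewrite ler_weXn2l ?X1//.
  rewrite -ltnS prednK//; apply: proper_card; apply/properP; split.
    exact: subset_predT.
  by exists b; rewrite // inE ltxx.
have telescope : V (z N) v - V (z 0%N) v = \sum_(i < N) (V (z i.+1) v - V (z i) v).
  by rewrite -(big_mkord xpredT (fun i => V (z i.+1) v - V (z i) v)) telescope_sumr.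
rewrite telescope (le_trans (ler_norm_sum _ _ _))//.
apply: (@le_trans _ _ (\sum_(i < N) M * (n%:R * (S * X N ^+ n.-1)))).
  by apply: ler_sum => i _; exact: step.
by rewrite sumr_const card_ord -[leLHS]mulr_natl.
Qed.

End Chaining.

(** * Increments of V at all distances, relative to a scale *)

Section LocalBound.
Variables (R : realType) (A : {fset R}) (bmin : A).
Hypothesis bminP : forall b : A, fsval bmin <= fsval b.
Variable alpha : R.

Let n := #|{: A}|.
Let p (b : A) : R := Num.max (alpha - fsval b) 0.
(** One exponent for all polynomial factors: 2 * n serves chains of about d ^ 2 steps, whose bound
    has degree n in their number, and the rounded sum dominates every [p b], in particular alpha
    minus the lowest homogeneity. *)
Let K : nat := (2 * n + (Num.truncn (\sum_b p b)).+1)%N.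

Lemma exponent_ge0 b : 0 <= p b.
Proof. by rewrite le_max lexx orbT. Qed.

Lemma exponent_le b : p b <= K%:R.
Proof.
apply: (@le_trans _ _ (\sum_b p b)).
  by rewrite (bigD1 b)//= lerDl sumr_ge0// => c _; exact: exponent_ge0.
by rewrite (le_trans (ltW (truncnS_gt _)))// ler_nat leq_addl.
Qed.

Lemma powR_le_poly (u q : R) : 0 <= u -> 0 <= q <= K%:R -> u `^ q <= 1 + u ^+ K.
Proof.
move=> u0 /andP[q0 qK]; have [u1|u1] := leP u 1.
  by rewrite (le_trans (powR_le1_01 _ q0)) ?u0// lerDl exprn_ge0.
rewrite -powR_mulrn// (@le_trans _ _ (u `^ K%:R))//; first by rewrite ler_powR// ltW.
by rewrite lerDr.
Qed.

Definition near_const : R := \sum_b 2 `^ p b.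
(** The number N of steps is at most 5 * d ^ 2 and 1 + N at most 6 * d ^ 2; the powers of 2, here
    and in [near_const], come from r <= 2 * rho. *)
Definition far_const : R := 5 * n%:R * (6 * n%:R) ^+ n.-1 * 2 ^+ K.
Definition growth_exponent : nat := K.

Variables (T : A -> completeNormedModType R).
Variable Gamma : R * R -> bounded_operator (dsum T) (dsum T).
Variable V : R * R -> bounded_operator (dsum T) R^o.
Variables (G : R) (skG : skeleton_const Gamma G).
Variables (M : R) (modM : modelled_const Gamma alpha V M).
Variables (x y : R * R) (v : dsum T) (rho r : R).
Hypothesis rho01 : 0 < rho <= 1.
Hypothesis rrho : rho <= r <= 2 * rho.
Hypothesis v_le : forall b, `|Gamma y v b| <= rho `^ fsval b.

Let d := dist x y.
Let u := r^-1 * d.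

Let rho0 : 0 < rho. Proof. by case/andP: rho01. Qed.
Let r0 : 0 < r. Proof. by case/andP: rrho => /(lt_le_trans rho0). Qed.
Let u0 : 0 <= u. Proof. by rewrite mulr_ge0 ?dist_ge0// invr_ge0 ltW. Qed.
Let dE : d = r * u. Proof. by rewrite /u mulVKf// gt_eqF. Qed.
Let M0 : 0 <= M. Proof. by case: modM. Qed.
Let G0 : 0 <= G. Proof. by case: skG. Qed.

(** Since d = r * u and r <= 2 * rho, the term of index b is at most 2 ^ p b * u ^ p b * rho ^ (p b
    + b), where p b + b >= alpha and rho <= 1. *)
Lemma near_bound : d <= 1 ->
  `|V x v - V y v| <= near_const * M * rho `^ alpha * (1 + u ^+ K).
Proof.
move=> d1; have [_ hM] := modM; apply: (le_trans (hM v y x d1)).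
rewrite [leRHS](_ : _ = M * (near_const * (rho `^ alpha * (1 + u ^+ K)))); last by ring.
rewrite ler_wpM2l// /near_const mulr_suml; apply: ler_sum => b _.
apply: (@le_trans _ _ ((2 `^ p b * rho `^ p b * (1 + u ^+ K)) * rho `^ fsval b)).
  apply: ler_pM; rewrite ?powR_ge0//.
  rewrite -[X in X `^ _]/d dE powRM ?(ltW r0)//; apply: ler_pM; rewrite ?powR_ge0//.
    rewrite -powRM ?(ltW rho0)//; apply: ge0_ler_powR; rewrite ?exponent_ge0 ?nnegrE ?mulr_ge0 ?(ltW r0) ?(ltW rho0)//.
    by case/andP: rrho.
  by apply: powR_le_poly => //; rewrite exponent_ge0 exponent_le.
rewrite [leLHS](_ : _ = 2 `^ p b * ((rho `^ p b * rho `^ fsval b) * (1 + u ^+ K))); last by ring.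
rewrite ler_wpM2l ?powR_ge0// ler_wpM2r ?addr_ge0 ?exprn_ge0//.
rewrite -powRD; last by apply/implyP => _; rewrite gt_eqF.
by apply: ger_powR => //; rewrite -lerBlDr le_max lexx.
Qed.

(* Points at distance d > 1 are joined by O(d ^ 2) steps of length at most 1; the
   square comes from the parabolic square root in the second coordinate. *)
Lemma far_bound : 1 < d ->
  `|V x v - V y v| <= far_const * (1 + G) ^+ n.-1 * M * rho `^ alpha * (1 + u ^+ K).
Proof.
move=> d1; have d0 := lt_trans ltr01 d1.
(* With N >= 4 * d ^ 2 both terms in the distance of neighbours are at most 1 / 2; for the second
   one, sqrt (1 / N) <= 1 / (2 * d). *)
pose N := (Num.truncn (4 * d ^+ 2)).+1.
have N4 : 4 * d ^+ 2 <= N%:R by apply/ltW/truncnS_gt.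
have d2 : 1 <= d ^+ 2 by rewrite exprn_ege1// ltW.
have N5 : N%:R <= 5 * d ^+ 2.
  have : (Num.truncn (4 * d ^+ 2))%:R <= 4 * d ^+ 2.
    by rewrite truncn_le// mulr_ge0// sqr_ge0.
  by rewrite /N -natr1; lra.
have N0 : 0 < N%:R :> R by rewrite ltr0n.
pose z (i : nat) : R * R :=
  (y.1 + i%:R / N%:R * (x.1 - y.1), y.2 + i%:R / N%:R * (x.2 - y.2)).
have z0 : z 0%N = y by rewrite /z !mul0r !addr0 -surjective_pairing.
have zN : z N = x.
  by rewrite /z divff ?gt_eqF// !mul1r ![y.1 + _]addrC ![y.2 + _]addrC !subrK -surjective_pairing.
have [a1 a2] : `|x.1 - y.1| <= d /\ Num.sqrt `|x.2 - y.2| <= d.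
  by rewrite /d /dist; split; rewrite ?lerDl ?lerDr ?sqrtr_ge0.
have dz i : (i < N)%N -> dist (z i.+1) (z i) <= 1.
  move=> _; rewrite /dist /z /=.
  have E (c e : R) : c + i.+1%:R / N%:R * e - (c + i%:R / N%:R * e) = e / N%:R.
    by rewrite -natr1; ring.
  rewrite !E !normrM normfV (gtr0_norm N0) sqrtrM//.
  have s0 := sqrtr_ge0 `|x.2 - y.2|.
  have h1 : `|x.1 - y.1| / N%:R <= 2^-1.
    rewrite ler_pdivrMr//; apply: (le_trans a1); nra.
  have h2 : Num.sqrt `|x.2 - y.2| * Num.sqrt N%:R^-1 <= 2^-1.
    rewrite sqrtrV ?(ltW N0)// ler_pdivrMr ?sqrtr_gt0//.
    have : 2 * d <= Num.sqrt N%:R.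
      rewrite -[leLHS]ger0_norm ?mulr_ge0 ?(ltW d0)// -(sqrtr_sqr (2 * d)) ler_sqrt ?(ltW N0)//.
      by apply: le_trans N4; rewrite exprMn; lra.
    by lra.
  by lra.
have S0 b : `|Gamma (z 0%N) v b| <= rho `^ fsval bmin.
  by rewrite z0; apply: (le_trans (v_le b)); exact: ger_powR.
have := chain_V skG modM dz S0; rewrite z0 zN => /le_trans; apply.
set S := rho `^ fsval bmin; have S_ge0 : 0 <= S := powR_ge0 _ _.
have n0 : (0 < n)%N by apply/card_gt0P; exists bmin.
have X_le : (1 + G) * (n%:R * (1 + N%:R)) <= (1 + G) * (6 * n%:R * d ^+ 2).
  rewrite ler_wpM2l ?addr_ge0// mulrC -mulrA [leRHS]mulrCA [leRHS]mulrC ler_wpM2r//.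
  by rewrite mulrC; lra.
apply: (@le_trans _ _ (5 * d ^+ 2 * (M * (n%:R * (S * ((1 + G) * (6 * n%:R * d ^+ 2)) ^+ n.-1))))).
  have X0 : 0 <= (1 + G) * (n%:R * (1 + N%:R)) by rewrite !mulr_ge0 ?addr_ge0.
  rewrite ler_pM ?mulr_ge0 ?exprn_ge0//; rewrite ler_wpM2l// ler_wpM2l// ler_wpM2l//.
  by rewrite lerXn2r ?nnegrE// (le_trans X0).
rewrite [leLHS](_ : _ = 5 * n%:R * (6 * n%:R) ^+ n.-1 * (1 + G) ^+ n.-1 * M * (d ^+ (2 * n) * S)); last first.
  have -> : d ^+ (2 * n) = d ^+ 2 * (d ^+ 2) ^+ n.-1 by rewrite exprM -exprS prednK.
  by move: (d ^+ 2) => D; rewrite (exprMn _ (1 + G)) (exprMn _ (6 * n%:R)); ring.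
(* As d > 1, its power may be raised to K; then d <= 2 * rho * u trades it for rho ^ K, and K >=
   alpha - bmin turns the factor rho ^ bmin into rho ^ alpha. *)
have key : d ^+ (2 * n) * S <= 2 ^+ K * rho `^ alpha * (1 + u ^+ K).
  apply: (@le_trans _ _ (d ^+ K * S)).
    by rewrite ler_wpM2r// ler_weXn2l ?(ltW d1)// leq_addr.
  apply: (@le_trans _ _ ((2 * rho * u) ^+ K * S)).
    rewrite ler_wpM2r// lerXn2r ?nnegrE ?(ltW d0)//; first by rewrite mulr_ge0 ?(mulr_ge0 _ (ltW rho0)).
    rewrite {1}dE ler_wpM2r//; by case/andP: rrho.
  rewrite (exprMn _ (2 * rho) u) (exprMn _ 2 rho) [leLHS](_ : _ = 2 ^+ K * ((rho ^+ K * S) * u ^+ K)); last by ring.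
  rewrite -[leRHS]mulrA ler_wpM2l ?exprn_ge0//; apply: ler_pM; rewrite ?mulr_ge0 ?exprn_ge0 ?(ltW rho0)//.
    rewrite -powR_mulrn ?(ltW rho0)// -powRD; last by apply/implyP => _; rewrite gt_eqF.
    apply: ger_powR => //; rewrite -lerBlDr.
    by apply: le_trans (exponent_le bmin); rewrite le_max lexx.
  by rewrite lerDr.
rewrite [leRHS](_ : _ = 5 * n%:R * (6 * n%:R) ^+ n.-1 * (1 + G) ^+ n.-1 * M *
  (2 ^+ K * rho `^ alpha * (1 + u ^+ K))); last by rewrite /far_const; ring.
by rewrite ler_wpM2l// !mulr_ge0 ?exprn_ge0 ?mulr_ge0 ?addr_ge0.
Qed.

Definition local_const : R := near_const + far_const.

Lemma local_const_ge0 : 0 <= local_const.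
Proof.
by rewrite addr_ge0 ?mulr_ge0 ?exprn_ge0 ?mulr_ge0// sumr_ge0// => b _; exact: powR_ge0.
Qed.

Lemma local_bound : `|V x v - V y v| <=
  local_const * (1 + G) ^+ n.-1 * M * rho `^ alpha * (1 + u ^+ growth_exponent).
Proof.
have Y0 : 0 <= M * rho `^ alpha * (1 + u ^+ K).
  by rewrite !mulr_ge0 ?powR_ge0// addr_ge0 ?exprn_ge0.
have near0 : 0 <= near_const by apply: sumr_ge0 => b _; exact: powR_ge0.
have far0 : 0 <= far_const by rewrite ?mulr_ge0 ?exprn_ge0 ?mulr_ge0.
have G1 : 1 <= (1 + G) ^+ n.-1 by rewrite exprn_ege1// lerDl.
rewrite -!mulrA [M * _]mulrA /local_const.
have [d1|d1] := leP d 1.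
  apply: (le_trans (near_bound d1)); rewrite -!mulrA [M * _]mulrA.
  apply: ler_pM => //; first by rewrite lerDl.
  by rewrite ler_peMl.
apply: (le_trans (far_bound d1)).
rewrite [leLHS](_ : _ = far_const * ((1 + G) ^+ n.-1 * (M * rho `^ alpha * (1 + u ^+ K)))); last by ring.
by apply: ler_wpM2r; [apply: mulr_ge0 => //; exact: le_trans G1|rewrite lerDr].
Qed.

End LocalBound.

(** * Reconstruction *)

Section Smoothing.
Variables (R : realType) (psi : R -> schwartz R).
Hypothesis psiP : semigroup_kernel psi.
Implicit Types (f : R * R -> R) (x y z : R * R) (phi : schwartz R) (w : seq bool) (s t : R).

Lemma fourth_root t : 0 < t <= 1 -> exists2 r, 0 < r <= 1 & t = r ^+ 4.
Proof.
move=> /andP[t0 t1]; have r0 : 0 < t `^ 4^-1 by rewrite powR_gt0.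
exists (t `^ 4^-1); first by rewrite r0 powR_le1_01// ?invr_ge0// (ltW t0) t1.
by rewrite powR_fourthK// ltW.
Qed.

Definition smoothed t phi : schwartz R := conv_schwartz (schwartz_rapid (psi t)) phi.

Lemma smoothedE t phi z : smoothed t phi z = pint (fun y => phi y * psi t (y - z)).
Proof.
have dp : decaying phi by apply: rapid_decaying; exact: schwartz_rapid.
have [K [K0 hK]] := partials_bound [::] (psi t) 0.
have ms : pmeas (fun y => psi t (y - z)) by apply: pmeas_shift; exact: (partials_pmeas [::]).
have bs x : `|psi t (x - z)| <= K by have := hK (x - z); rewrite expr0 divr1.
rewrite -(pint_shift z (decaying_boundedM dp ms bs)).
by apply: eq_pint => y; rewrite mulrC addrC (addrC z) addrK addrC.
Qed.

Lemma smoothed_kernel s t x : 0 < s -> 0 < t ->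
  smoothed s (schwartz_reflect (psi t) x) = schwartz_reflect (psi (s + t)) x.
Proof.
move=> s0 t0; apply/val_inj/funext => z /=.
by rewrite (kernel_semigroup psiP)//; apply: eq_pint => y; rewrite opprD addrA addrAC.
Qed.

Lemma kernel_semigroup_shift s t x z : 0 < s -> 0 < t ->
  pint (fun y => psi s (x - y) * psi t (y - z)) = psi (s + t) (x - z).
Proof.
move=> s0 t0; rewrite (kernel_semigroup psiP)//.
have ds : decaying (psi s) by apply: rapid_decaying; exact: schwartz_rapid.
have dk : decaying (fun y => psi s y * psi t (x - z - y)).
  have [K [K0 hK]] := partials_bound [::] (psi t) 0.
  apply: (decaying_boundedM (C := K)) => //.
    by apply: pmeas_reflect; exact: (partials_pmeas [::]).
  by move=> y; have := hK (x - z - y); rewrite expr0 divr1.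
rewrite -(pint_reflect x dk); apply: eq_pint => y; congr (_ * psi t _).
by rewrite opprB [RHS]addrC addrA subrK.
Qed.

(** In the index of the seminorm, 2 * m pays for the weight wt ^ m, n for the derivatives in w, and
    4 for those of the Taylor remainder. *)
Lemma smoothed_approx m n : exists C, 0 <= C /\ forall phi w t y, (size w <= n)%N -> 0 < t <= 1 ->
  `|partials w (smoothed t phi - phi : schwartz R) y| <=
  C * schwartz_seminorm (2 * m + n + 4) phi * t / wt y ^+ m.
Proof.
have [C [C0 hC]] := kernel_approx psiP m; exists (C * 4 ^+ m.+1).
split=> [|phi w t y wn /fourth_root[r r01 ->]]; first by rewrite mulr_ge0 ?exprn_ge0.
rewrite partialsB (_ : partials w (smoothed _ _) y = cv (psi (r ^+ 4)) (partials w phi) y); last first.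
  rewrite -partials_cv//; exact: rapid_decaying (schwartz_rapid _).
rewrite -[C * _ * _]mulrA; apply: hC => //; first by rewrite mulr_ge0 ?exprn_ge0 ?seminorm_ge0.
move=> w' x w4; apply: partials_le_seminorm; first by rewrite -addnA leq_addr.
by rewrite size_cat addnC -addnA (leq_trans _ (leq_addl _ _))// leq_add.
Qed.

Lemma smoothed_td (X : normedModType R) (u : tempered_distribution X) phi :
  exists C, 0 <= C /\ forall t, 0 < t <= 1 -> `|u (smoothed t phi) - u phi| <= C * t.
Proof.
have [N [c hu]] := td_continuous u; have [C [C0 hC]] := smoothed_approx N N.
pose S := schwartz_seminorm (2 * N + N + 4) phi.
have S0 : 0 <= S := seminorm_ge0 _ _.
exists (`|c| * (seminorm_terms R N * (C * S))); split=> [|t t01].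
  by rewrite !mulr_ge0 ?seminorm_terms_ge0.
rewrite -linearB (le_trans (hu _))//.
rewrite (le_trans (ler_wpM2r (seminorm_ge0 _ _) (ler_norm c)))// -!mulrA ler_wpM2l//.
rewrite (le_trans (@seminorm_le _ _ _ (C * S * t) _)) ?mulrA// => w x wN.
exact: hC.
Qed.

End Smoothing.

Lemma geometric_cvg (R : realType) (u : nat -> R) (c q : R) : 0 <= q < 1 ->
  (forall n, `|u n.+1 - u n| <= c * q ^+ n) ->
  cvgn u /\ `|limn u - u 0%N| <= c / (1 - q).
Proof.
move=> /andP[q0 q1] hu; have p0 : 0 < 1 - q by rewrite subr_gt0.
have c0 : 0 <= c by have := le_trans (normr_ge0 _) (hu 0%N); rewrite expr0 mulr1.
have cu : cvgn u.
  have cs : cvgn (series (telescope u)).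
    apply: normed_cvg; apply: (series_le_cvg _ _ hu) => [n|n|] //=.
      by rewrite mulr_ge0 ?exprn_ge0.
    by apply: (is_cvg_geometric_series (a := c)); rewrite ger0_norm.
  rewrite (_ : u = fun n => u 0%N + series (telescope u) n); last first.
    by apply/funext => n; exact: eq_sum_telescope.
  by apply: is_cvgD => //; exact: is_cvg_cst.
split=> //.
have bound n : `|u n - u 0%N| <= c / (1 - q).
  (* The induction closes with the exact partial sum of the geometric series, not with its limit. *)
  apply: (@le_trans _ _ (c * (1 - q ^+ n) / (1 - q))).
    elim: n => [|n ih]; first by rewrite subrr normr0 expr0 subrr mulr0 mul0r.
    rewrite (le_trans (ler_distD (u n) _ _))// (le_trans (lerD (hu n) ih))//.
    rewrite exprS le_eqVlt; apply/orP; left; apply/eqP; field; by rewrite gt_eqF.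
  by rewrite ler_wpM2r ?invr_ge0 ?(ltW p0)// ler_piMr// gerBl exprn_ge0.
have cd : (fun n => `|u n - u 0%N|) @ \oo --> `|limn u - u 0%N|.
  by apply: cvg_norm; apply: cvgB => //; exact: cvg_cst.
rewrite -(cvg_lim (@Rhausdorff R) cd); apply: limr_le; first by apply/cvg_ex; eexists; exact: cd.
by apply: nearW => n; exact: bound.
Qed.

(** * From an approximately consistent family of functions to a distribution *)

Section Reconstruction.
Variables (R : realType) (psi : R -> schwartz R).
Hypothesis psiP : semigroup_kernel psi.
Implicit Types (f g h : R * R -> R) (x y z : R * R) (phi : schwartz R) (w : seq bool) (s t tau : R).

(* F t x stands for V(x).v_t(x), with q = min A / 4 and p = alpha / 4. *)
Variables (F : R -> R * R -> R) (B q E p : R).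
Hypothesis q_gt : -1 < q.
Hypothesis p_gt0 : 0 < p.
Hypothesis F_meas : forall t, 0 < t <= 1 -> pmeas (F t).
Hypothesis F_le : forall t x, 0 < t <= 1 -> `|F t x| <= B * t `^ q.
Hypothesis F_step : forall tau s x, 0 < tau <= 1 -> tau <= s <= 3 * tau ->
  `|pint (fun y => psi s (x - y) * F tau y) - F (tau + s) x| <= E * tau `^ p.
Hypothesis F_cvg : forall t x, 0 < t <= 1 -> exists C, forall tau, 0 < tau <= 1 ->
  `|F (t + tau) x - F t x| <= C * tau.

Let in01 tau : 0 < tau -> tau + tau <= 1 -> 0 < tau <= 1.
Proof. by move=> t0 t1; rewrite t0 (le_trans _ t1)// lerDl ltW. Qed.

Lemma step_bound_ge0 : 0 <= E.
Proof.
have h1 : 0 < (1 : R) <= 1 by apply/andP; split; lra.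
have h3 : (1 : R) <= (1 : R) <= 3 * 1 by apply/andP; split; lra.
by have := le_trans (normr_ge0 _) (F_step 0 h1 h3); rewrite powR1 mulr1.
Qed.

Lemma bound_ge0 : 0 <= B.
Proof.
have h1 : 0 < (1 : R) <= 1 by apply/andP; split; lra.
by have := le_trans (normr_ge0 _) (F_le 0 h1); rewrite powR1 mulr1.
Qed.

Definition pairing tau phi : R := pint (fun x => F tau x * phi x).

Let dphi phi : decaying phi. Proof. exact: rapid_decaying (schwartz_rapid _). Qed.

Lemma pairing_decaying tau phi : 0 < tau <= 1 -> decaying (fun x => F tau x * phi x).
Proof.
by move=> t01; apply: decayingM => //; [exact: F_meas|exists (B * tau `^ q) => x; exact: F_le].
Qed.

Lemma pairing_linear tau (c : R) phi chi : 0 < tau <= 1 ->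
  pairing tau (c *: phi + chi) = c * pairing tau phi + pairing tau chi.
Proof.
move=> t01; have dF phi' := pairing_decaying phi' t01.
rewrite /pairing -pintZ// -pintD//; last exact: decayingZ.
by apply: eq_pint => x; rewrite [LHS](_ : _ = F tau x * (c * phi x + chi x))//; ring.
Qed.

Lemma pairing_smoothed s tau phi : 0 < s -> 0 < tau <= 1 ->
  pairing tau (smoothed psi s phi) = pint (fun x => phi x * pint (fun y => psi s (x - y) * F tau y)).
Proof.
move=> s0 t01; rewrite (fubini_product (dphi phi) (dphi (psi s)) (F_meas t01) (fun x => F_le x t01)).
by apply: eq_pint => y; rewrite mulrC smoothedE.
Qed.

Lemma pairing_diff tau phi chi : 0 < tau <= 1 ->
  pairing tau phi - pairing tau chi = pairing tau (phi - chi).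
Proof.
move=> t01; rewrite (_ : phi - chi = (-1) *: chi + phi); last by rewrite scaleN1r addrC.
by rewrite pairing_linear// mulN1r addrC.
Qed.

Lemma pairing_smoothing_error : exists C, 0 <= C /\ forall s tau phi, 0 < s <= 1 -> 0 < tau <= 1 ->
  `|pairing tau (smoothed psi s phi) - pairing tau phi| <=
  C * schwartz_seminorm 6 phi * (s * tau `^ q).
Proof.
(* One power of the weight makes the integral converge and no outer derivative occurs; 6 is 2 * 1 +
   0 + 4. *)
have [C [C0 hC]] := smoothed_approx psiP 1 0.
exists (B * C * wt_mass R); split=> [|s tau phi s01 t01].
  by rewrite !mulr_ge0 ?bound_ge0 ?wt_mass_ge0.
rewrite pairing_diff// [leRHS](_ : _ = (B * tau `^ q) * (C * schwartz_seminorm 6 phi * s) * wt_mass R); last by ring.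
apply: norm_pint_wt; first by case: (pairing_decaying (smoothed psi s phi - phi) t01).
move=> x; rewrite normrM -[leRHS]mulrA; apply: ler_pM => //; first exact: F_le.
by have := hC phi [::] s x isT s01; rewrite expr1.
Qed.

(** The test function smoothed at scale tau is inserted in between: removing the smoothing costs tau
    * tau ^ q, and moving it onto [F tau] produces [F (tau + tau)] up to the one-step error. *)
Lemma pairing_step : exists D, 0 <= D /\ forall tau phi, 0 < tau -> tau + tau <= 1 ->
  `|pairing tau phi - pairing (tau + tau) phi| <=
  D * schwartz_seminorm 6 phi * (tau `^ (1 + q) + tau `^ p).
Proof.
have [C [C0 hC]] := pairing_smoothing_error; have E0 := step_bound_ge0.
have W0 := wt_mass_ge0 R.
exists (C + E * (4 ^+ 2 * wt_mass R)); split=> [|tau phi t0 tt1].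
  by rewrite addr_ge0 ?mulr_ge0 ?exprn_ge0.
have t01 := in01 t0 tt1; have tt01 : 0 < tau + tau <= 1 by rewrite addr_gt0.
set S := schwartz_seminorm 6 phi; have S0 : 0 <= S := seminorm_ge0 _ _.
have dsm := decaying_fubini_product (dphi phi) (dphi (psi tau)) (F_meas t01) (fun x => F_le x t01).
have h1 : `|pairing tau phi - pairing tau (smoothed psi tau phi)| <= C * S * tau `^ (1 + q).
  rewrite distrC (le_trans (hC _ _ _ t01 t01))// powRD; last by apply/implyP => _; rewrite gt_eqF.
  by rewrite powRr1 ?(ltW t0).
have h2 : `|pairing tau (smoothed psi tau phi) - pairing (tau + tau) phi| <=
    E * (4 ^+ 2 * wt_mass R) * S * tau `^ p.
  have dtt := pairing_decaying phi tt01.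
  rewrite pairing_smoothed// /pairing -pintB//.
  rewrite [leRHS](_ : _ = (4 ^+ 2 * S) * (E * tau `^ p) * wt_mass R); last by ring.
  apply: norm_pint_wt => [|x]; first by case: (decayingB dsm dtt).
  rewrite [F _ x * _]mulrC -mulrBr normrM mulrAC; apply: ler_pM => //.
    have /= := @partials_le_seminorm R 1 [::] 6 phi x isT isT; rewrite expr1; exact.
  by apply: F_step => //; rewrite lexx; lra.
rewrite -(subrKA (pairing tau (smoothed psi tau phi))) (le_trans (ler_normD _ _))//.
apply: (le_trans (lerD h1 h2)); rewrite [D in _ <= D]mulrDr !mulrDl.
have a0 : 0 <= C * S * tau `^ p by rewrite !mulr_ge0 ?powR_ge0.
have b0 : 0 <= E * (4 ^+ 2 * wt_mass R) * S * tau `^ (1 + q).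
  by rewrite !mulr_ge0 ?exprn_ge0 ?powR_ge0.
by lra.
Qed.

Let half : R := 2^-1.
Let half01 : 0 < half < 1. Proof. by apply/andP; rewrite /half; split; lra. Qed.
Let half_gt0 : 0 < half. Proof. by case/andP: half01. Qed.
Let halfn n : 0 < half ^+ n <= 1.
Proof. by case/andP: half01 => h0 h1; rewrite exprn_gt0// exprn_ile1// ltW. Qed.

Lemma half_powR_lt1 (a : R) : 0 < a -> half `^ a < 1.
Proof.
move=> a0; case/andP: half01 => h0 h1.
have <- : 1 `^ a = 1 by rewrite powR1.
by apply: gt0_ltr_powR; rewrite ?nnegrE ?ltW.
Qed.

(** Both rates are summable over dyadic scales because 1 + q and p are positive. The limit is
    compared with scale 1, where F is bounded by B and the pairing is continuous. *)
Lemma pairing_cvg : exists D, 0 <= D /\ forall phi,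
  cvgn (fun n => pairing (half ^+ n) phi) /\
  `|limn (fun n => pairing (half ^+ n) phi) - pairing 1 phi| <= D * schwartz_seminorm 6 phi.
Proof.
have [D [D0 hD]] := pairing_step.
have q1 : 0 < 1 + q by rewrite -ltrBlDl sub0r.
pose c := Num.max (half `^ (1 + q)) (half `^ p).
have c0 : 0 <= c by rewrite le_max powR_ge0.
have c1 : c < 1 by rewrite gt_max !half_powR_lt1.
have le_c (a : R) n : half `^ a <= c -> (half ^+ n.+1) `^ a <= c ^+ n.
  move=> ac; have -> : (half ^+ n.+1) `^ a = (half `^ a) ^+ n.+1.
    rewrite -(powR_mulrn n.+1 (ltW half_gt0)) -(powR_mulrn n.+1 (powR_ge0 half a)).
    exact: powRAC.
  apply: (@le_trans _ _ (c ^+ n.+1)); first by rewrite lerXn2r// nnegrE ?powR_ge0.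
  by rewrite exprS ler_piMl ?exprn_ge0// ltW.
exists (D * 2 / (1 - c)); split=> [|phi]; first by rewrite !mulr_ge0// invr_ge0 subr_ge0 ltW.
have c01 : 0 <= c < 1 by rewrite c0.
have := @geometric_cvg R (fun n => pairing (half ^+ n) phi) (D * schwartz_seminorm 6 phi * 2) c c01.
rewrite expr0 [D * 2 / _ * _](_ : _ = D * schwartz_seminorm 6 phi * 2 / (1 - c)); last by ring.
apply=> n; have e : half ^+ n = half ^+ n.+1 + half ^+ n.+1.
  by rewrite exprS; move: (half ^+ n) => X; rewrite /half; lra.
have h0 : 0 < half ^+ n.+1 by case/andP: (halfn n.+1).
have h1 : half ^+ n.+1 + half ^+ n.+1 <= 1 by rewrite -e; case/andP: (halfn n).
rewrite e (le_trans (hD _ _ h0 h1))// -[leRHS]mulrA.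
rewrite ler_wpM2l ?mulr_ge0 ?seminorm_ge0// mulr_natl mulr2n.
by apply: lerD; apply: le_c; rewrite le_max lexx ?orbT.
Qed.

Lemma reconstruction : exists RV : tempered_distribution R^o,
  forall phi, (fun n => pairing (half ^+ n) phi) @ \oo --> (RV phi : R).
Proof.
have [D [D0 hD]] := pairing_cvg.
pose L phi : R^o := limn (fun n => pairing (half ^+ n) phi).
have cL phi : (fun n => pairing (half ^+ n) phi) @ \oo --> (L phi : R) by case: (hD phi).
have linL : linear L.
  move=> c phi chi; apply: (cvg_unique (@Rhausdorff R) (cL _)).
  have -> : (fun n => pairing (half ^+ n) (c *: phi + chi)) =
      (fun n => c * pairing (half ^+ n) phi + pairing (half ^+ n) chi).
    by apply/funext => n; exact: pairing_linear.
  by apply: cvgD (cL chi); apply: cvgMr; exact: cL.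
pose Ll : {linear schwartz R -> R^o} :=
  HB.pack L (GRing.isLinear.Build R (schwartz R) R^o *:%R L linL).
have bL : exists N C, forall phi, `|Ll phi| <= C * schwartz_seminorm N phi.
  exists 6, (D + B * 4 ^+ 2 * wt_mass R) => phi.
  have h1 : `|pairing 1 phi| <= B * (4 ^+ 2 * schwartz_seminorm 6 phi) * wt_mass R.
    have h01 : 0 < (1 : R) <= 1 by apply/andP; split; lra.
    apply: norm_pint_wt => [|x]; first by case: (pairing_decaying phi h01).
    rewrite normrM -mulrA; apply: ler_pM => //.
      by have := F_le x h01; rewrite powR1 mulr1.
    by have /= := @partials_le_seminorm R 1 [::] 6 phi x isT isT; rewrite expr1; exact.
  have := lerD (proj2 (hD phi)) h1; rewrite -/(L phi) => /(le_trans _); have := ler_normD (L phi - pairing 1 phi) (pairing 1 phi).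
  rewrite subrK => h2 h3; apply: (le_trans (h3 _ h2)).
  by rewrite le_eqVlt; apply/orP; left; apply/eqP; ring.
by exists (TemperedDistribution bL).
Qed.

Lemma smoothing_semigroup s tau x : 0 < s -> 0 < tau <= 1 ->
  pint (fun z => psi s (x - z) * pint (fun y => psi tau (z - y) * F tau y)) =
  pint (fun y => psi (s + tau) (x - y) * F tau y).
Proof.
move=> s0 t01; have dr : decaying (fun z => psi s (x - z)) by exact: decaying_reflect.
rewrite (fubini_product dr (dphi (psi tau)) (F_meas t01) (fun x => F_le x t01)).
apply: eq_pint => y; congr (_ * _).
by rewrite kernel_semigroup_shift// (andP t01).1.
Qed.

(* The constant b solving 1 + b = b * 2 `^ p: the error at scale tau is then absorbed
   when passing from scale tau to scale 2 * tau in [telescoping]. *)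
Definition telescoping_const : R := (2 `^ p - 1)^-1.

Lemma telescoping_const_gt0 : 0 < telescoping_const.
Proof.
have e : 1 `^ p = 1 by rewrite powR1.
rewrite invr_gt0 subr_gt0 -[ltLHS]e; apply: gt0_ltr_powR; rewrite ?nnegrE//.
by rewrite ltr1n.
Qed.

(** The total tau + s stays fixed while (tau, s) becomes (2 * tau, s - tau), at most n times. If s >
    3 * tau, then s - tau >= 2 * tau, so tau <= s persists; otherwise the one-step estimate applies
    directly. The negative term in the bound pays for each doubling. *)
Lemma telescoping n tau s x : 0 < tau -> tau <= s -> tau + s <= 2 ^+ n.+2 * tau -> tau + s <= 2 ->
  `|pint (fun y => psi s (x - y) * F tau y) - F (tau + s) x| <=
  (1 + kernel_norm psi) * E *
  ((1 + telescoping_const) * (tau + s) `^ p - telescoping_const * tau `^ p).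
Proof.
have E0 := step_bound_ge0; have b0 := telescoping_const_gt0; set b := telescoping_const in b0 *.
have kn0 : 0 <= kernel_norm psi by apply: pint_ge0.
have small tau' s' : 0 < tau' -> tau' <= s' -> s' <= 3 * tau' -> tau' + s' <= 2 ->
  `|pint (fun y => psi s' (x - y) * F tau' y) - F (tau' + s') x| <=
  (1 + kernel_norm psi) * E * ((1 + b) * (tau' + s') `^ p - b * tau' `^ p).
  move=> t0 ts s3 ts2; have t01 : 0 < tau' <= 1 by rewrite t0; lra.
  apply: (le_trans (F_step x t01 _)); first by rewrite ts.
  have tp : tau' `^ p <= (tau' + s') `^ p.
    by apply: ge0_ler_powR; rewrite ?nnegrE ?(ltW p_gt0)//; lra.
  have tp0 := powR_ge0 tau' p.
  rewrite -mulrA; apply: (@le_trans _ _ (1 * (E * ((1 + b) * tau' `^ p - b * tau' `^ p)))).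
    by rewrite mul1r mulrDl mul1r addrK.
  apply: ler_pM; rewrite ?ler01// ?lerDl//.
    by rewrite mulr_ge0// mulrDl mul1r addrK.
  by rewrite ler_wpM2l// lerB// ler_wpM2l// addr_ge0// ltW.
elim: n tau s => [|n ih] tau s t0 ts tn t2.
  by apply: small => //; rewrite -subr_ge0; move: tn; rewrite expr2; lra.
have [s3|s3] := leP s (3 * tau); first exact: small.
have t01 : 0 < tau <= 1 by rewrite t0; lra.
have tt01 : 0 < tau + tau <= 1 by apply/andP; split; lra.
pose s' := s - tau; have s'0 : 0 < s' by rewrite /s'; lra.
have es : s = s' + tau by rewrite /s' subrK.
have ets : tau + s = (tau + tau) + s' by rewrite /s'; ring.
have := ih (tau + tau) s'; rewrite -ets => {}ih.
have {ih} : `|pint (fun y => psi s' (x - y) * F (tau + tau) y) - F (tau + s) x| <=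
  (1 + kernel_norm psi) * E * ((1 + b) * (tau + s) `^ p - b * (tau + tau) `^ p).
  apply: ih => //; rewrite ?/s'; try lra.
  by move: tn; rewrite exprS; move: (2 ^+ n.+2) => X; lra.
have dr : decaying (fun z => psi s' (x - z)) by exact: decaying_reflect.
have dsm := decaying_fubini_product dr (dphi (psi tau)) (F_meas t01) (fun x => F_le x t01).
have dF := decaying_boundedM dr (F_meas tt01) (fun x => F_le x tt01).
have h1 : `|pint (fun y => psi s (x - y) * F tau y) - pint (fun y => psi s' (x - y) * F (tau + tau) y)|
   <= kernel_norm psi * (E * tau `^ p).
  rewrite es -smoothing_semigroup// -pintB//.
  apply: (@le_trans _ _ (pint (fun z => `|psi s' (x - z)| * (E * tau `^ p)))).
    apply: norm_pint_le; [by case: (decayingB dsm dF)|by apply/decayingZr/decaying_norm|move=> z].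
    by rewrite -mulrBr normrM ler_wpM2l//; apply: F_step => //; apply/andP; split; lra.
  rewrite pintZr; last exact: decaying_norm.
  rewrite ler_wpM2r ?mulr_ge0 ?powR_ge0//.
  by rewrite (pint_reflect x (decaying_norm (dphi (psi s')))) kernel_norm_bound.
move=> h2; have e2 : (tau + tau) `^ p = 2 `^ p * tau `^ p.
  by rewrite (_ : tau + tau = 2 * tau) ?powRM ?(ltW t0)//; lra.
have := ler_normD (pint (fun y => psi s (x - y) * F tau y) - pint (fun y => psi s' (x - y) * F (tau + tau) y))
   (pint (fun y => psi s' (x - y) * F (tau + tau) y) - F (tau + s) x).
rewrite subrKA => /le_trans; apply; apply: (le_trans (lerD h1 h2)); rewrite e2.
have bE : b * (2 `^ p - 1) = 1.
  by rewrite mulVf// gt_eqF// -invr_gt0.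
have tp0 := powR_ge0 tau p; rewrite -subr_ge0.
rewrite [leRHS](_ : _ = E * tau `^ p * ((1 + kernel_norm psi) * (b * (2 `^ p - 1)) - kernel_norm psi)); last by ring.
by rewrite bE mulr1 addrK mulr_ge0 ?mulr_ge0.
Qed.

Definition reconstruction_const : R := (1 + kernel_norm psi) * (1 + telescoping_const) * 2 `^ p.

(** [telescoping] is applied with tau = 2 ^ -n and s = t, and n tends to infinity. Once 2 ^ -n <= t
    the total is at most 2 * t, which gives the factor 2 ^ p. *)
Lemma reconstruction_bound (RV : tempered_distribution R^o) :
  (forall phi, (fun n => pairing (half ^+ n) phi) @ \oo --> (RV phi : R)) ->
  forall t x, 0 < t <= 1 ->
  `|smear RV (psi t) x - F t x| <= reconstruction_const * E * t `^ p.
Proof.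
move=> hRV t x t01; case/andP: (t01) => t0 t1.
have ch : (fun n => half ^+ n) @ \oo --> (0 : R).
  by apply: cvg_expr; rewrite ger0_norm ?(ltW half_gt0)//; case/andP: half01.
have cF : (fun n => F (t + half ^+ n) x) @ \oo --> F t x.
  have [C hC] := F_cvg x t01; apply/cvgrPdist_le => e e0.
  have C1 : 0 < `|C| + 1 by rewrite ltr_wpDl.
  have := (cvgrPdist_le _ _).1 ch (e / (`|C| + 1)) (divr_gt0 e0 C1).
  case=> N _ hN; exists N => // n /hN /=; rewrite sub0r normrN ger0_norm ?exprn_ge0 ?(ltW half_gt0)// => hn.
  rewrite distrC (le_trans (hC _ (halfn n)))// (@le_trans _ _ ((`|C| + 1) * half ^+ n))//.
    by rewrite ler_wpM2r ?exprn_ge0 ?(ltW half_gt0)// (le_trans (ler_norm _))// lerDl.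
  by rewrite mulrC -ler_pdivlMr.
have cd : (fun n => `|pairing (half ^+ n) (schwartz_reflect (psi t) x) - F (t + half ^+ n) x|) @ \oo -->
    `|smear RV (psi t) x - F t x|.
  by apply: cvg_norm; apply: cvgB => //; exact: hRV.
rewrite -(cvg_lim (@Rhausdorff R) cd); apply: limr_le; first by apply/cvg_ex; eexists; exact: cd.
have [N _ hN] := (cvgrPdist_le _ _).1 ch t t0; exists N => // n /hN /=.
rewrite sub0r normrN ger0_norm ?exprn_ge0 ?(ltW half_gt0)// => hn.
have h0 : 0 < half ^+ n by rewrite exprn_gt0.
rewrite [t + _]addrC (_ : pairing _ _ = pint (fun y => psi t (x - y) * F (half ^+ n) y)); last first.
  by apply: eq_pint => y; rewrite mulrC.
have h1 : half ^+ n + t <= 2 by lra.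
(* The right-hand side equals 4, so n doublings are enough. *)
have h2 : half ^+ n + t <= 2 ^+ n.+2 * half ^+ n.
  rewrite !exprS -mulrA -mulrA -exprMn /half divff// expr1n; lra.
apply: (le_trans (telescoping x h0 hn h2 h1)).
have b0 := ltW telescoping_const_gt0.
have kn0 : 0 <= kernel_norm psi by apply: pint_ge0.
rewrite [leRHS](_ : _ = (1 + kernel_norm psi) * E * ((1 + telescoping_const) * (2 `^ p * t `^ p))); last first.
  by rewrite /reconstruction_const; ring.
rewrite ler_wpM2l ?mulr_ge0 ?addr_ge0 ?step_bound_ge0//.
rewrite lerBlDr (@le_trans _ _ ((1 + telescoping_const) * (2 `^ p * t `^ p)))//; last first.
  by rewrite lerDl mulr_ge0 ?powR_ge0.
rewrite ler_wpM2l ?addr_ge0// -powRM ?(ltW t0)//.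
by apply: ge0_ler_powR; rewrite ?nnegrE ?(ltW p_gt0)//; lra.
Qed.

End Reconstruction.

Lemma bounded_operator_bound (R : realType) (X Y : normedModType R) (L : bounded_operator X Y) :
  exists C, 0 <= C /\ forall w, `|L w| <= C * `|w|.
Proof.
have /linear_bounded_continuous/linear_boundedP/pinfty_ex_gt0[r r0 h] := @bop_continuous _ _ _ L.
by exists r; split=> //; exact: ltW.
Qed.

Section Composite.
Variables (R : realType) (X Y : normedModType R).
Variables (L : bounded_operator X Y) (u : tempered_distribution X).

Lemma composite_subproof : exists N C, forall phi,
  `|(bop_fun L \o td_fun u) phi| <= C * schwartz_seminorm N phi.
Proof.
have [C [C0 hC]] := bounded_operator_bound L; have [N [D hD]] := td_continuous u.
exists N, (C * D) => phi; rewrite -mulrA (le_trans (hC _))// ler_wpM2l//.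
Qed.

(** Freezing V at one point turns v into a real distribution, to which [td_fubini] applies. *)
Definition composite : tempered_distribution Y := TemperedDistribution composite_subproof.

End Composite.

(** If c > 0, the t with t ^ a = c / (D + c) gives D * t ^ a < c, a contradiction. *)
Lemma le_powR_eq0 (R : realType) (c D a : R) : 0 <= c -> 0 <= D -> 0 < a ->
  (forall t, 0 < t <= 1 -> c <= D * t `^ a) -> c = 0.
Proof.
move=> c0 D0 a0 h; apply/eqP; rewrite -[_ == _]negbK; apply/negP => cn0.
have {cn0}c0 : 0 < c by rewrite lt_neqAle eq_sym cn0.
have Dc : 0 < D + c by rewrite ltr_wpDl.
have z0 : 0 < c / (D + c) by rewrite divr_gt0.
pose t := (c / (D + c)) `^ a^-1.
have t01 : 0 < t <= 1.
  rewrite powR_gt0//= powR_le1_01//; last by rewrite invr_ge0 ltW.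
  by rewrite (ltW z0) ler_pdivrMr// mul1r lerDr.
have := h t t01; rewrite /t -powRrM mulVf ?gt_eqF// powRr1 ?(ltW z0)//.
rewrite mulrA ler_pdivlMr// mulrDr mulrC gerDl leNgt => /negP; apply; exact: mulr_gt0.
Qed.

(** * A distribution is determined by its smears at small scales *)

Section Uniqueness.
Variables (R : realType) (psi : R -> schwartz R).
Hypothesis psiP : semigroup_kernel psi.
Implicit Types (u : tempered_distribution R^o) (x y : R * R) (s t : R) (phi : schwartz R).

Lemma smear_decaying u psi' k : rapid k -> decaying (fun y => k y * smear u psi' y).
Proof.
move=> rk; have [C [M [C0 hC]]] := smear_growth u psi'.
apply: rapid_decaying; apply: (rapidM rk _ hC).
by apply: continuous_pmeas; exact: smear_continuous.
Qed.

Lemma smear_semigroup u s t x : 0 < s -> 0 < t ->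
  smear u (psi (s + t)) x = pint (fun y => psi s (x - y) * smear u (psi t) y).
Proof.
move=> s0 t0; apply: td_fubini; first by apply: rapid_reflect; exact: schwartz_rapid.
by move=> z; rewrite kernel_semigroup_shift.
Qed.

(* Testing u_i with phi smoothed at scale t only involves u_i smeared at scale t. *)
Lemma smeared_td_inj u1 u2 (K p : R) : 0 < p ->
  (forall t x, 0 < t <= 1 -> `|smear u1 (psi t) x - smear u2 (psi t) x| <= K * t `^ p) -> u1 = u2.
Proof.
move=> p0 hK; apply: tempered_distribution_ext => phi; apply/eqP; rewrite -subr_eq0 -normr_eq0.
apply/eqP.
have K0 : 0 <= K.
  have h1 : 0 < (1 : R) <= 1 by apply/andP; split; lra.
  by have := le_trans (normr_ge0 _) (hK 1 0 h1); rewrite powR1 mulr1.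
have [C1 [C10 h1]] := smoothed_td psiP u1 phi; have [C2 [C20 h2]] := smoothed_td psiP u2 phi.
pose m := pint (fun y => `|phi y|).
have m0 : 0 <= m by exact: pint_ge0.
(* The smoothing errors are of order t and the difference of the smears is of order t ^ p; for t <=
   1 the power t ^ a dominates both. *)
pose a := Num.min 1 p; have a0 : 0 < a by rewrite lt_min ltr01.
apply: (@le_powR_eq0 _ _ (C1 + C2 + m * K) a) => //.
  by rewrite !addr_ge0 ?mulr_ge0.
move=> t t01; case/andP: (t01) => t0 t1.
have rphi := schwartz_rapid phi.
have h3 : `|u1 (smoothed psi t phi) - u2 (smoothed psi t phi)| <= m * (K * t `^ p).
  rewrite !(td_fubini _ rphi (smoothedE psi t phi)) -pintB; [|exact: smear_decaying..].
  have dB := decayingB (smear_decaying u1 (psi t) rphi) (smear_decaying u2 (psi t) rphi).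
  have dphi := decaying_norm (rapid_decaying rphi).
  rewrite /m -pintZr//; apply: norm_pint_le; [by case: dB|exact: decayingZr|move=> y].
  by rewrite -mulrBr normrM ler_wpM2l// hK.
have ta : t <= t `^ a by rewrite -[leLHS]powRr1 ?(ltW t0)// ger_powR ?t01// ge_min lexx.
have tp : t `^ p <= t `^ a by rewrite ger_powR ?t01// ge_min lexx orbT.
have e : u1 phi - u2 phi = - (u1 (smoothed psi t phi) - u1 phi) +
  (u2 (smoothed psi t phi) - u2 phi) + (u1 (smoothed psi t phi) - u2 (smoothed psi t phi)).
  by move: (u1 _) (u1 _) (u2 _) (u2 _) => a1 a2 a3 a4; ring.
rewrite e (le_trans (ler_normD _ _))// !mulrDl lerD//.
  rewrite (le_trans (ler_normD _ _))// normrN lerD//.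
    by rewrite (le_trans (h1 t t01))// ler_wpM2l.
  by rewrite (le_trans (h2 t t01))// ler_wpM2l.
by rewrite (le_trans h3)// mulrA ler_wpM2l ?mulr_ge0.
Qed.

End Uniqueness.

(** * The family V(x).v_t(x) satisfies the hypotheses of the reconstruction *)

Section Germ.
Variables (R : realType) (psi : R -> schwartz R).
Hypothesis psiP : semigroup_kernel psi.
Variables (A : {fset R}) (bmin : A) (alpha : R).
Hypothesis bminP : forall b : A, fsval bmin <= fsval b.
Variable T : A -> completeNormedModType R.
Variable Gamma : R * R -> bounded_operator (dsum T) (dsum T).
Variable v : tempered_distribution (dsum T).
Hypothesis v_le : forall (b : A) (x : R * R) (t : R), 0 < t <= 1 ->
  `|Gamma x (smear v (psi t) x) b| <= (t `^ 4^-1) `^ fsval b.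
Variable V : R * R -> bounded_operator (dsum T) R^o.
Variables (N : A -> R) (modN : modelled_bound Gamma V N).
Variables (G : R) (skG : skeleton_const Gamma G).
Variables (M : R) (modM : modelled_const Gamma alpha V M).
Implicit Types (x y : R * R) (s t tau : R).

Definition germ t x : R := V x (smear v (psi t) x).

(** The modelled bound with base point fixed at x makes the operators bounded uniformly near x; with
    strong continuity this yields continuity of y -> V y (w y) for continuous w. *)
Lemma modelled_locally_bounded x : exists C, 0 <= C /\ forall y w,
  dist y x <= 1 -> `|V y w| <= C * `|w|.
Proof.
have [C1 [C10 h1]] := bounded_operator_bound (V x).
have [C2 [C20 h2]] := bounded_operator_bound (Gamma x).
have [M0 hM] := modM; exists (M * C2 + C1); split=> [|y w d1].
  by rewrite addr_ge0 ?mulr_ge0.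
rewrite -[V y w](subrK (V x w)) (le_trans (ler_normD _ _))// mulrDl lerD//.
rewrite (le_trans (hM w x y d1))// -mulrA ler_wpM2l// (le_trans _ (h2 w))//.
apply: ler_sum => b _; rewrite ler_piMl// powR_le1_01 ?dist_ge0 ?d1//.
by rewrite le_max lexx orbT.
Qed.

Lemma dist_near x : \forall y \near x, dist y x <= 1.
Proof.
have e0 : (0 : R) < 4^-1 by rewrite invr_gt0.
apply: filterS (nbhsx_ballx x _ e0) => y [h1 h2].
have a1 : `|y.1 - x.1| <= 4^-1 by rewrite distrC ltW.
have a2 : Num.sqrt `|y.2 - x.2| <= 2^-1.
  rewrite -[leRHS]ger0_norm// -(sqrtr_sqr 2^-1) ler_sqrt ?sqr_ge0//.
  by rewrite distrC (le_trans (ltW h2))// expr2; lra.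
by rewrite /dist; lra.
Qed.

Lemma germ_pmeas t : strongly_continuous V -> pmeas (germ t).
Proof.
move=> cV; apply: continuous_pmeas => x; rewrite /germ.
have [C [C0 hC]] := modelled_locally_bounded x.
set w := smear v (psi t).
have cw : w y @[y --> x] --> w x by exact: smear_continuous.
have c1 : (fun y => V y (w x)) y @[y --> x] --> V x (w x) by exact: cV.
have c2 : (fun y => V y (w y - w x) : R) y @[y --> x] --> (0 : R).
  apply/cvgrPdist_le => e e0; have C1 : 0 < C + 1 by rewrite ltr_wpDl.
  have hw : \forall y \near x, `|w x - w y| <= e / (C + 1).
    by apply: (cvgrPdist_le _ _).1 cw _ (divr_gt0 e0 C1).
  apply: filterS2 hw (dist_near x) => y hy dy.
  rewrite sub0r normrN (le_trans (hC _ _ dy))// (@le_trans _ _ ((C + 1) * `|w y - w x|))//.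
    by rewrite ler_wpM2r// lerDl.
  by rewrite distrC mulrC -ler_pdivlMr.
rewrite (_ : (fun y => _) = fun y => V y (w y - w x) + V y (w x)); last first.
  by apply/funext => y; rewrite linearB subrK.
by rewrite /continuous_at subrr linear0; exact: cvgD.
Qed.

Lemma germ_le t x : 0 < t <= 1 -> `|germ t x| <= (\sum_b N b) * t `^ (fsval bmin / 4).
Proof.
move=> t01; have [N0 hN] := modN; rewrite mulr_suml (le_trans (hN _ _))//.
apply: ler_sum => b _; rewrite ler_wpM2l// (le_trans (v_le b x t01))// -powRrM.
by apply: ger_powR => //; rewrite [leRHS]mulrC ler_wpM2r// invr_ge0.
Qed.

(** With V x frozen, raising t by tau smooths the test function at scale tau. The constant may
    depend on t and x, since it only serves to pass to a limit. *)
Lemma germ_cvg t x : 0 < t <= 1 -> exists C, forall tau, 0 < tau <= 1 ->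
  `|germ (t + tau) x - germ t x| <= C * tau.
Proof.
case/andP=> t0 _; have [C [C0 hC]] := smoothed_td psiP (composite (V x) v) (schwartz_reflect (psi t) x).
exists C => tau tau01; have := hC tau tau01; case/andP: tau01 => tau0 _.
by rewrite smoothed_kernel// [tau + t]addrC.
Qed.

Definition germ_const : R :=
  local_const A alpha * kernel_moment psi (growth_exponent A alpha).

(** V x commutes with smearing, so both terms are averages of the same smears at y, and
    [local_bound] based at y compares V y with V x. The growth in d / r is integrated against psi s
    uniformly in s. *)
Lemma germ_step tau s x : strongly_continuous V -> 0 < tau <= 1 -> tau <= s <= 3 * tau ->
  `|pint (fun y => psi s (x - y) * germ tau y) - germ (tau + s) x| <=
  germ_const * (1 + G) ^+ #|{: A}|.-1 * M * tau `^ (alpha / 4).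
Proof.
move=> cV t01 /andP[ts s3]; case/andP: (t01) => t0 t1.
have s0 := lt_le_trans t0 ts.
pose rho := tau `^ 4^-1; pose r := s `^ 4^-1.
have rho0 : 0 < rho by rewrite powR_gt0.
have r0 : 0 < r by rewrite powR_gt0.
have rho01 : 0 < rho <= 1 by rewrite rho0 powR_le1_01 ?invr_ge0 ?(ltW t0).
(* The upper bound holds because s <= 3 * tau and 3 <= 2 ^ 4. *)
have rr : rho <= r <= 2 * rho.
  apply/andP; split; rewrite -(@ler_pXn2r _ 4) ?nnegrE ?mulr_ge0 ?(ltW r0) ?(ltW rho0)//.
    by rewrite !powR_fourthK ?(ltW s0) ?(ltW t0).
  rewrite (exprMn _ 2) !powR_fourthK ?(ltW s0) ?(ltW t0)// (le_trans s3)// ler_wpM2r ?(ltW t0)//.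
  by rewrite -natrX ler_nat.
set K := growth_exponent A alpha; set X := local_const A alpha * (1 + G) ^+ #|{: A}|.-1 * M * rho `^ alpha.
have X0 : 0 <= X.
  rewrite !mulr_ge0 ?local_const_ge0 ?powR_ge0 ?exprn_ge0 ?addr_ge0//; first by case: skG.
  by case: modM.
have rs := schwartz_rapid (psi s); have rrs := rapid_reflect x rs.
have dg := decaying_boundedM (rapid_decaying rrs) (germ_pmeas tau cV) (fun y => germ_le y t01).
have ds := smear_decaying (composite (V x) v) (psi tau) rrs.
have -> : germ (tau + s) x = pint (fun y => psi s (x - y) * smear (composite (V x) v) (psi tau) y).
  by rewrite -(smear_semigroup psiP)// [s + tau]addrC.
have r1 : 0 <= r^-1 by rewrite invr_ge0 ltW.
have dm := kernel_moment_decaying K r1 (rapid_norm rs).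
rewrite -pintB//; apply: (@le_trans _ _ (pint (fun y => X * (`|psi s (x - y)| * (1 + (r^-1 * hdist (x - y)) ^+ K))))).
  apply: norm_pint_le; [by case: (decayingB dg ds)|apply: decayingZ; exact: (decaying_reflect x dm)|].
  move=> y; rewrite -mulrBr normrM mulrCA ler_wpM2l// distrC.
  exact: (local_bound bminP skG modM x rho01 rr (fun b => v_le b y t01)).
rewrite pintZ; last exact: (decaying_reflect x dm).
rewrite (pint_reflect x dm) -[X in psi X](powR_fourthK (ltW s0)).
rewrite (le_trans (ler_wpM2l X0 (kernel_moment_bound psiP K r0)))//.
by rewrite /X /germ_const /rho -powRrM [4^-1 * _]mulrC le_eqVlt; apply/orP; left; apply/eqP; ring.
Qed.

End Germ.

(** Passes from all admissible constants to the least one; c = 0 is separate because the argument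
    divides by c. *)
Lemma le_mul_inf (R : realType) (S : set R) (a c : R) : 0 <= c -> S !=set0 ->
  (forall z, S z -> a <= z * c) -> a <= inf S * c.
Proof.
move=> c0 S0 h; have [c_eq0|cn0] := eqVneq c 0.
  by have [z Sz] := S0; have := h z Sz; rewrite c_eq0 !mulr0.
have {cn0}c0 : 0 < c by rewrite lt_neqAle eq_sym cn0.
rewrite -ler_pdivrMr//; apply: lb_le_inf => // z /h.
by rewrite ler_pdivrMr.
Qed.

(* The infimum in [skeleton_norm] is attained. *)
Lemma skeleton_norm_const (R : realType) (A : {fset R}) (T : A -> completeNormedModType R)
    (Gamma : R * R -> bounded_operator (dsum T) (dsum T)) :
  (exists G, skeleton_const Gamma G) -> skeleton_const Gamma (skeleton_norm Gamma).
Proof.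
move=> S0; split=> [|b v x y d1].
  by apply: lb_le_inf => // G [].
apply: le_mul_inf => // [|G [_]]; last exact.
by apply: sumr_ge0 => g _; rewrite mulr_ge0 ?powR_ge0.
Qed.

Lemma modelled_seminorm_const (R : realType) (A : {fset R}) (T : A -> completeNormedModType R)
    (Gamma : R * R -> bounded_operator (dsum T) (dsum T)) (alpha : R)
    (V : R * R -> bounded_operator (dsum T) R^o) :
  (exists M, modelled_const Gamma alpha V M) ->
  modelled_const Gamma alpha V (modelled_seminorm Gamma alpha V).
Proof.
move=> S0; split=> [|v x y d1].
  by apply: lb_le_inf => // M [].
apply: le_mul_inf => // [|M [_]]; last exact.
by apply: sumr_ge0 => g _; rewrite mulr_ge0 ?powR_ge0.
Qed.

Lemma sup_norm_le (R : realType) (f : R * R -> R) (c : R) :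
  (sup_norm f <= c%:E)%E <-> forall x, `|f x| <= c.
Proof.
split=> [h x|h].
  by rewrite -lee_fin (le_trans _ h)//; apply: ereal_sup_ubound; exists x.
by apply: ge_ereal_sup => _ [x _ <-]; rewrite lee_fin.
Qed.

Theorem proposition1 (R : realType)
    (psi : R -> schwartz R) (psiP : semigroup_kernel psi)
    (A : {fset R}) (bmin : A) (bminP : forall b : A, fsval bmin <= fsval b)
    (bmin_range : - 4 < fsval bmin < 0) (alpha : R) (alpha_gt0 : 0 < alpha) :
  exists C : R,
    forall (T : A -> completeNormedModType R)
      (Gamma : R * R -> bounded_operator (dsum T) (dsum T)),
    skeleton Gamma ->
    forall v : tempered_distribution (dsum T),
    (forall (b : A) (x : R * R) (t : R), 0 < t <= 1 ->
       `|Gamma x (smear v (psi t) x) b| <= (t `^ 4^-1) `^ fsval b) ->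
    forall V : R * R -> bounded_operator (dsum T) R^o,
    modelled Gamma alpha V ->
    exists! RV : tempered_distribution R^o,
      forall t : R, 0 < t <= 1 ->
        (sup_norm (fun x => smear RV (psi t) x - V x (smear v (psi t) x))%R
         <= (C * (1 + skeleton_norm Gamma) ^+ #|` A|.-1
             * modelled_seminorm Gamma alpha V * (t `^ 4^-1) `^ alpha)%R%:E)%E.
Proof.
(* Both factors are fixed by psi, A and alpha before T, Gamma, v and V enter, and at positive times
   psi is determined by its Fourier transform. *)
exists (reconstruction_const psi (alpha / 4) * germ_const psi A alpha).
move=> T Gamma [_ _ /skeleton_norm_const skG] v v_le V [cV [N modN] /modelled_seminorm_const modM].
(* Time t corresponds to length t ^ (1 / 4), so homogeneities are divided by 4 and the bound -4
   becomes -1. *)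
have p0 : 0 < alpha / 4 by rewrite divr_gt0.
have q1 : -1 < fsval bmin / 4.
  by case/andP: bmin_range => h _; rewrite ltr_pdivlMr// mulN1r.
have F_meas t : 0 < t <= 1 -> pmeas (germ psi v V t) by move=> _; exact: germ_pmeas modM t cV.
have F_le t x := germ_le bminP v_le modN (t := t) x.
have F_step tau s x := germ_step psiP bminP v_le modN skG modM (tau := tau) (s := s) x cV.
have F_cvg t x := germ_cvg psiP v V (t := t) x.
have [RV hRV] := reconstruction psiP q1 p0 F_meas F_le F_step.
have bound := reconstruction_bound psiP p0 F_meas F_le F_step F_cvg hRV.
set E := germ_const psi A alpha * _ * _ in bound.
have cE t : reconstruction_const psi (alpha / 4) * germ_const psi A alpha *
    (1 + skeleton_norm Gamma) ^+ #|` A|.-1 * modelled_seminorm Gamma alpha V *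
    (t `^ 4^-1) `^ alpha = reconstruction_const psi (alpha / 4) * E * t `^ (alpha / 4).
  by rewrite -powRrM [4^-1 * _]mulrC /E cardfE -!mulrA.
exists RV; split=> [t t01|RV' hRV'].
  by apply/sup_norm_le => x; rewrite cE; exact: bound.
(* Both candidates lie within the same bound of the germ, hence the factor 2. *)
apply: (smeared_td_inj psiP (K := reconstruction_const psi (alpha / 4) * E *+ 2) p0) => t x t01.
have := (sup_norm_le _ _).1 (hRV' t t01) x; rewrite cE => h'.
rewrite -(subrKA (germ psi v V t x)) (le_trans (ler_normD _ _))//.
by rewrite mulr2n mulrDl lerD// ?bound// distrC.
Qed.
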